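(* Let $n$ be a positive integer. The universal $C^*$-algebra of the relations $x^n=0$ and $\|x\|\le 1$ is projective.
   Context: A representation of the relations $x^n=0$, $\|x\|\le 1$ in a $C^*$-algebra $A$ is an element $a\in A$ with $a^n=0$ and $\|a\|\le 1$. The universal $C^*$-algebra of these relations is a $C^*$-algebra $\mathcal{A}$ together with a representation $x_0\in\mathcal{A}$ of the relations such that any representation factorizes uniquely through it: for every $C^*$-algebra $A$ and every $a\in A$ with $a^n=0$ and $\|a\|\le 1$ there is a unique $*$-homomorphism $\varphi:\mathcal{A}\to A$ with $\varphi(x_0)=a$. ($C^*$-algebras and $*$-homomorphisms are not required to be unital.) A $C^*$-algebra $B$ is projective if for every $C^*$-algebra $A$, every closed two-sided ideal $I$ of $A$ and every $*$-homomorphism $f:B\to A/I$, there is a $*$-homomorphism $g:B\to A$ with $f(b)=g(b)+I$ for all $b\in B$. *)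

(* Defs.v *)
From HB Require Import structures.
From mathcomp Require Import all_boot all_order all_algebra.
From mathcomp Require Import boolp classical_sets reals topology normedtype.
From mathcomp Require Import generic_quotient ring_quotient complex ring lra.

Set Implicit Arguments.
Unset Strict Implicit.
Unset Printing Implicit Defensive.
Import Order.TTheory GRing.Theory Num.Theory numFieldNormedType.Exports.
Import Quotient.
Local Open Scope ring_scope.

Declare Scope star_scope.
Delimit Scope star_scope with star.
Local Open Scope star_scope.
Reserved Notation "x ** y" (at level 40, left associativity).

HB.mixin Record Lmodule_isStarAlgebra (C : numClosedFieldType) A
    of GRing.Lmodule C A := {
  smul : A -> A -> A;
  star : A -> A;
  smulA : associative smul;
  smulDl : left_distributive smul +%R;
  smulDr : right_distributive smul +%R;
  smulZl : forall (a : C) x y, smul (a *: x) y = a *: smul x y;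
  smulZr : forall (a : C) x y, smul x (a *: y) = a *: smul x y;
  starK : involutive star;
  starD : {morph star : x y / x + y};
  starZ : forall (a : C) x, star (a *: x) = a^* *: star x;
  starM : forall x y, star (smul x y) = smul (star y) (star x)
}.

#[short(type="starAlgType")]
HB.structure Definition StarAlgebra (C : numClosedFieldType) :=
  {A of Lmodule_isStarAlgebra C A & GRing.Lmodule C A}.

Notation "x ** y" := (smul x y) : star_scope.

(* The norm, topology and completeness come from CompleteNormedModule. No unit
   is assumed, and the zero algebra is allowed. *)
HB.mixin Record StarAlgebra_isCStar (R : realType) A
    of StarAlgebra R[i] A & CompleteNormedModule R[i] A := {
  cstar_normM : forall x y : A, `|x ** y| <= `|x| * `|y|;
  cstar_norm : forall x : A, `|star x ** x| = `|x| ^+ 2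
}.

#[short(type="cstarAlgType")]
HB.structure Definition CStarAlgebra (R : realType) :=
  {A of StarAlgebra_isCStar R A & StarAlgebra R[i] A
      & CompleteNormedModule R[i] A}.

Section StarAlgebraTheory.
Variables (C : numClosedFieldType) (A : starAlgType C).
Implicit Types x y z : A.

Lemma smul0l x : 0 ** x = 0.
Proof. by rewrite -(scale0r 0) smulZl !scale0r. Qed.
Lemma smul0r x : x ** 0 = 0.
Proof. by rewrite -(scale0r 0) smulZr !scale0r. Qed.
Lemma smulNl x y : (- x) ** y = - (x ** y).
Proof. by apply/eqP; rewrite -addr_eq0 -smulDl addNr smul0l. Qed.
Lemma smulNr x y : x ** (- y) = - (x ** y).
Proof. by apply/eqP; rewrite -addr_eq0 -smulDr addNr smul0r. Qed.
Lemma smulBl x y z : (x - y) ** z = x ** z - y ** z.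
Proof. by rewrite smulDl smulNl. Qed.
Lemma smulBr x y z : x ** (y - z) = x ** y - x ** z.
Proof. by rewrite smulDr smulNr. Qed.
Lemma star0 : star (0 : A) = 0.
Proof. by rewrite -(scale0r 0) starZ conjC0 !scale0r. Qed.
Lemma starN x : star (- x) = - star x.
Proof. by apply/eqP; rewrite -addr_eq0 -starD addNr star0. Qed.
Lemma starB x y : star (x - y) = star x - star y.
Proof. by rewrite starD starN. Qed.
Lemma smul_sumr (I : Type) (r : seq I) (F : I -> A) x :
  x ** (\sum_(i <- r) F i) = \sum_(i <- r) x ** F i.
Proof. exact: (big_morph (smul x) (smulDr x) (smul0r x)). Qed.

End StarAlgebraTheory.

(* The norm of a normed R[i]-module is R[i]-valued; rnorm is the same number
   read in R. *)
Section CStarNorm.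
Variables (R : realType) (A : cstarAlgType R).
Implicit Types x y z : A.

Definition rnorm x : R := complex.Re `|x|.
Local Notation nr := rnorm.

Lemma rnormE x : `|x| = (nr x)%:C%C.
Proof.
have : 0 <= `|x| by exact: normr_ge0.
by rewrite /rnorm; case: (`|x| : R[i]) => a b /ger0_Im /= ->.
Qed.

Lemma rnorm_ge0 x : 0 <= nr x.
Proof. by have := normr_ge0 x; rewrite rnormE lecR. Qed.
Lemma rnormD x y : nr (x + y) <= nr x + nr y.
Proof. by have := ler_normD x y; rewrite !rnormE -rmorphD lecR. Qed.
Lemma rnormN x : nr (- x) = nr x.
Proof. by rewrite /rnorm normrN. Qed.
Lemma rnormB x y : nr (x - y) <= nr x + nr y.
Proof. by rewrite -(rnormN y) rnormD. Qed.
Lemma rnormM x y : nr (x ** y) <= nr x * nr y.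
Proof. by have := cstar_normM x y; rewrite !rnormE -rmorphM lecR. Qed.
Lemma rnorm_star_mul x : nr (star x ** x) = nr x ^+ 2.
Proof. by rewrite /rnorm cstar_norm !rnormE -rmorphXn. Qed.
Lemma rnorm0 : nr 0 = 0.
Proof. by rewrite /rnorm normr0. Qed.
Lemma rnorm_eq0 x : nr x = 0 -> x = 0.
Proof. by move=> h; apply/normr0_eq0; rewrite rnormE h. Qed.
Lemma rnormZ (c : R) x : 0 <= c -> nr (c%:C%C *: x) = c * nr x.
Proof.
by move=> c0; rewrite /rnorm normrZ ger0_norm ?lecR // rnormE -rmorphM.
Qed.
Lemma rnorm_star_le x : nr x <= nr (star x).
Proof.
have [/rnorm_eq0 ->|x0] := eqVneq (nr x) 0; first by rewrite rnorm0 rnorm_ge0.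
have := rnormM (star x) x; rewrite rnorm_star_mul expr2 ler_pM2r //.
by rewrite lt0r x0 rnorm_ge0.
Qed.
Lemma rnorm_star x : nr (star x) = nr x.
Proof. by apply/le_anti; rewrite rnorm_star_le -{2}(starK x) rnorm_star_le. Qed.
Lemma rnorm_mul_star x : nr (x ** star x) = nr x ^+ 2.
Proof. by rewrite -{1}(starK x) rnorm_star_mul rnorm_star. Qed.
Lemma rnorm_small x : (forall e : R, 0 < e -> nr x <= e) -> x = 0.
Proof.
move=> h; apply: rnorm_eq0; apply/le_anti; rewrite rnorm_ge0 andbT.
by apply/ler_addgt0Pl => e e0; rewrite addr0 h.
Qed.

Lemma gt0_real (e : R[i]) : 0 < e -> exists2 r : R, 0 < r & e = r%:C%C.
Proof.
by case: e => a b; rewrite ltcE /= => /andP[/eqP -> a0]; exists a.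
Qed.

Lemma rnorm_closed (I : set A) x : closed I ->
  (forall e : R, 0 < e -> exists2 y, I y & nr (x - y) < e) -> I x.
Proof.
move=> cI h; apply: cI => B /nbhs_ballP [_ /= /gt0_real [e e0 ->] eB].
have [y Iy xy] := h _ e0; exists y; split => //; apply: eB.
by rewrite -ball_normE /ball_ /= rnormE ltcR.
Qed.

Lemma exp2_small (e : R) : 0 < e -> exists n : nat, 2^-1 ^+ n < e.
Proof.
move=> e0; have [n hn] : exists n : nat, e^-1 < n%:R.
  by exists (Num.bound e^-1); apply: archi_boundP; rewrite invr_ge0 ltW.
exists n; rewrite exprVn invf_plt ?posrE ?exprn_gt0 //.
apply: (lt_trans hn); rewrite -natrX ltr_nat; exact: ltn_expl.
Qed.

Lemma rnorm_cauchy (u : nat -> A) :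
  (forall n, nr (u n.+1 - u n) <= 2^-1 ^+ n) ->
  exists w, forall e : R, 0 < e ->
    exists n, forall m, (n <= m)%N -> nr (w - u m) <= e.
Proof.
move=> hu.
have hd n p : nr (u (n + p)%N - u n) <= 2 * 2^-1 ^+ n - 2 * 2^-1 ^+ (n + p).
  elim: p => [|p IH]; first by rewrite addn0 !subrr rnorm0.
  rewrite addnS -(subrKA (u (n + p)%N)) (le_trans (rnormD _ _)) //.
  have := hu (n + p)%N; rewrite exprS; lra.
have hd2 n m : (n <= m)%N -> nr (u m - u n) <= 2 * 2^-1 ^+ n.
  move=> nm; have := hd n (m - n)%N; rewrite subnKC // => /le_trans; apply.
  by rewrite gerBl mulr_ge0 // exprn_ge0 // invr_ge0.
have uc : cvg (u @ \oo)%classic.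
  apply/cauchy_cvgP/cauchy_exP => _ /= /gt0_real [e e0 ->].
  have [n hn] := @exp2_small (e / 2) ltac:(lra).
  exists (u n); exists n => // m /= nm.
  rewrite -ball_normE /ball_ /= rnormE ltcR -rnormN opprB.
  by apply: (le_lt_trans (hd2 _ _ nm)); lra.
exists (lim (u @ \oo)%classic) => e e0.
have /cvgrPdist_le /(_ e%:C%C) := uc.
rewrite ltcR => /(_ e0) [n _ hn]; exists n => m nm.
by have := hn m nm; rewrite rnormE lecR.
Qed.

End CStarNorm.

Record closedIdeal (R : realType) (A : cstarAlgType R) := ClosedIdeal {
  ideal_set :> A -> Prop;
  ideal0 : ideal_set 0;
  idealD : forall x y, ideal_set x -> ideal_set y -> ideal_set (x + y);
  idealZ : forall (a : R[i]) x, ideal_set x -> ideal_set (a *: x);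
  ideal_mull : forall a x, ideal_set x -> ideal_set (a ** x);
  ideal_mulr : forall x a, ideal_set x -> ideal_set (x ** a);
  ideal_closed : closed (ideal_set : set A)
}.

Section IdealStar.
Variables (R : realType) (A : cstarAlgType R) (I : closedIdeal A).
Implicit Types x y z : A.
Local Notation nr := (@rnorm R A).

Lemma idealN x : I x -> I (- x).
Proof. by rewrite -scaleN1r; exact: idealZ. Qed.
Lemma idealB x y : I x -> I y -> I (x - y).
Proof. by move=> Ix Iy; apply: idealD => //; exact: idealN. Qed.

Lemma half_real : (2^-1 : R[i]) = (2^-1 : R)%:C%C.
Proof. by rewrite fmorphV rmorph_nat. Qed.

(* For h = h^* in I with |h| <= 1/2 there is w = w^* in I commuting with h
   with 2w - w^2 = h^2, i.e. 1 - w = sqrt(1 - h^2). *)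
Lemma ideal_sqrt h : I h -> star h = h -> nr h <= 2^-1 ->
  exists w, [/\ I w, star w = w, w ** h = h ** w & w + w = h ** h + w ** w].
Proof.
move=> Ih sh nh; set k := h ** h.
have nk : nr k <= 2^-1.
  by apply: (le_trans (rnormM _ _)); have := rnorm_ge0 h; nra.
pose f (x : A) := (2^-1 : R[i]) *: (k + x ** x).
have nhalf x : nr ((2^-1 : R[i]) *: x) = 2^-1 * nr x.
  by rewrite half_real rnormZ // invr_ge0.
pose u n := iter n f 0.
have uS n : u n.+1 = f (u n) by [].
have nu n : nr (u n) <= 2^-1.
  elim: n => [|n IH]; first by rewrite rnorm0 invr_ge0.
  rewrite uS nhalf; have := rnormD k (u n ** u n); have := rnormM (u n) (u n).
  have := rnorm_ge0 (u n); nra.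
have Iu n : I (u n).
  elim: n => [|n IH]; first exact: ideal0.
  by rewrite uS; apply/idealZ/idealD; apply: ideal_mull.
have su n : star (u n) = u n.
  elim: n => [|n IH]; first exact: star0.
  by rewrite uS starZ starD /k !starM IH sh fmorphV rmorph_nat.
have ch n : u n ** h = h ** u n.
  elim: n => [|n IH]; first by rewrite smul0l smul0r.
  rewrite uS smulZl smulZr smulDl smulDr /k -!smulA; congr (_ *: (_ + _)).
  by rewrite IH smulA IH smulA.
have du n : nr (u n.+1 - u n) <= 2^-1 ^+ n.
  elim: n => [|n IH].
    by rewrite subr0 expr0 (le_trans (nu 1%N)) // invf_le1 // ler1n.
  rewrite uS [X in _ - X]uS -scalerBr nhalf exprS ler_pM2l ?invr_gt0 //.
  have -> : k + u n.+1 ** u n.+1 - (k + u n ** u n)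
     = u n.+1 ** (u n.+1 - u n) + (u n.+1 - u n) ** u n.
    by rewrite smulBl smulBr subrKA opprD addrACA subrr add0r.
  apply: le_trans IH; apply: (le_trans (rnormD _ _)).
  have := rnormM (u n.+1) (u n.+1 - u n); have := rnormM (u n.+1 - u n) (u n).
  have := nu n; have := nu n.+1; have := rnorm_ge0 (u n.+1 - u n).
  have := rnorm_ge0 (u n); have := rnorm_ge0 (u n.+1); nra.
have [w hw] := rnorm_cauchy du.
have hw1 (e : R) : 0 < e -> exists n, nr (w - u n) <= e /\ nr (w - u n.+1) <= e.
  by move=> /hw [n hn]; exists n; split; apply: hn.
exists w; split.
- apply: (rnorm_closed (@ideal_closed _ _ I)) => e e0.
  have [n [hn _]] := @hw1 (e / 2) ltac:(lra).
  by exists (u n) => //; lra.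
- apply/eqP; rewrite -subr_eq0; apply/eqP/rnorm_small => e e0.
  have [n [hn _]] := @hw1 (e / 2) ltac:(lra).
  rewrite -(subrKA (u n)) -{1}(su n) -starB.
  apply: (le_trans (rnormD _ _)); rewrite rnorm_star -(rnormN (_ - w)) opprB; lra.
- apply/eqP; rewrite -subr_eq0; apply/eqP/rnorm_small => e e0.
  have [n [hn _]] := @hw1 e e0.
  rewrite -(subrKA (u n ** h)) -smulBl ch -smulBr.
  apply: (le_trans (rnormD _ _)); have := rnormM (w - u n) h.
  have := rnormM h (u n - w); rewrite -(rnormN (u n - w)) opprB.
  have := rnorm_ge0 (w - u n); have := rnorm_ge0 h; nra.
- apply/eqP; rewrite -subr_eq0; apply/eqP/rnorm_small => e e0.
  have nw : nr w <= 1.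
    have [n [hn _]] := @hw1 2^-1 ltac:(by rewrite invr_gt0).
    by rewrite -(subrK (u n) w); have := rnormD (w - u n) (u n); have := nu n; lra.
  have [n [hn hn1]] := @hw1 (e / 4) ltac:(lra).
  have uu : u n.+1 + u n.+1 = k + u n ** u n.
    by rewrite uS -mulr2n -scaler_nat scalerA divff ?scale1r // pnatr_eq0.
  have -> : w + w - (k + w ** w) =
     ((w - u n.+1) + (w - u n.+1)) - (w ** (w - u n) + (w - u n) ** u n).
    rewrite smulBl smulBr subrKA addrACA -opprD uu !opprD !opprK !addrA.
    by rewrite [RHS]addrAC subrK.
  apply: (le_trans (rnormB _ _)).
  have := rnormD (w - u n.+1) (w - u n.+1).
  have := rnormD (w ** (w - u n)) ((w - u n) ** u n).
  have := rnormM w (w - u n); have := rnormM (w - u n) (u n).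
  have := nu n; have := rnorm_ge0 (w - u n); have := rnorm_ge0 w.
  have := rnorm_ge0 (u n); nra.
Qed.

(* With v := w - ih for the w above, 1 - v is formally unitary, hence acts
   isometrically by right multiplication. *)
Lemma ideal_unitary h : I h -> star h = h -> nr h <= 2^-1 ->
  exists v, [/\ I v, v ** star v = v + star v &
    h ** h - h ** h ** v = ('i / 2 : R[i]) *: (h ** (v + v - v ** v))].
Proof.
move=> Ih sh nh; have [w [Iw sw cwh ww]] := ideal_sqrt Ih sh nh.
have i2 : 'i * 'i = -1 :> R[i] by rewrite -expr2 sqrCi.
have sv : star (w - 'i *: h) = w + 'i *: h.
  by rewrite starB starZ sh sw conjCi scaleNr opprK.
exists (w - 'i *: h); split.
- by apply: idealB => //; apply: idealZ.
- rewrite sv smulBl !smulDr !smulZl !smulZr scalerA i2 scaleN1r cwh.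
  rewrite opprD opprK addrA addrK addrC.
  by rewrite -ww [RHS]addrACA addNr addr0.
- set v := w - _.
  have -> : v + v - v ** v = (- ('i *+ 2) : R[i]) *: (h - h ** v).
    rewrite scaleNr -scalerMnl mulr2n.
    rewrite /v smulBl !smulBr !smulZl !smulZr scalerA i2 scaleN1r cwh.
    rewrite !scalerBr scalerA i2 scaleN1r.
    rewrite addrACA ww.
    move: (h ** h) (w ** w) ('i *: h) ('i *: (h ** w)) => p q b a.
    rewrite opprK !opprD !opprK [RHS]addrACA [LHS]addrAC.
    rewrite [RHS]addrAC [in RHS](addrC (- b)) -[RHS]addrA; congr (_ + _).
    by rewrite addrA [p + q + _]addrA addrK (addrC p).
  clearbody v; rewrite smulZr scalerA smulBr smulA mulrN -(mulr_natr 'i) mulrACA i2.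
  by rewrite mulVf ?pnatr_eq0 // mulr1 opprK scale1r.
Qed.

Section Averages.
Variables (v : A).
Hypotheses (Iv : I v) (vv : v ** star v = v + star v).

Let T x : A := x - x ** v.
Let S x : A := T (T x).

Let T_mul x y : T (x ** y) = x ** T y.
Proof. by rewrite /T smulBr smulA. Qed.
Let T_norm x : nr (T x) = nr x.
Proof.
suff e : T x ** star (T x) = x ** star x.
  have := rnorm_ge0 x; have := rnorm_ge0 (T x).
  have := rnorm_mul_star x; rewrite -e rnorm_mul_star => /eqP.
  by rewrite eqf_sqr => /orP[/eqP //|/eqP]; lra.
rewrite /T starB starM smulBl !smulBr.
have -> : x ** v ** (star v ** star x) =
    x ** v ** star x + x ** (star v ** star x).
  by rewrite smulA -(smulA x v) vv smulDr smulDl -(smulA x (star v)).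
by rewrite opprB [_ + _ - _]addrAC subrr add0r subrK.
Qed.
Let T_ideal x : I (x - T x).
Proof. by rewrite /T opprB addrC subrK; apply: ideal_mull. Qed.

Let S_ideal i x : I (x - iter i S x).
Proof.
elim: i => [|i IH]; first by rewrite subrr; exact: ideal0.
rewrite -(subrKA (iter i S x)); apply: idealD => //.
rewrite iterS /S -(subrKA (T (iter i S x))).
by apply: idealD; exact: T_ideal.
Qed.
Let S_mul i x y : iter i S (x ** y) = x ** iter i S y.
Proof. by elim: i => //= i ->; rewrite /S !T_mul. Qed.
Let S_norm i x : nr (iter i S x) = nr x.
Proof. by elim: i => //= i; rewrite /S !T_norm. Qed.
Let iterTS i x : T (iter i S x) = iter i S (T x).
Proof. by elim: i => //= i IH; rewrite /S IH. Qed.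
Let SZ i (a : R[i]) x : iter i S (a *: x) = a *: iter i S x.
Proof. by elim: i => //= i ->; rewrite /S /T !smulZl -!scalerBr smulZl -scalerBr. Qed.
Let SB i x y : iter i S (x - y) = iter i S x - iter i S y.
Proof.
have TB a b : T (a - b) = T a - T b.
  by rewrite /T smulBl !opprD !opprK addrACA.
by elim: i => //= i ->; rewrite /S (TB (iter _ _ x)) (TB (T _)).
Qed.

Definition cesaro n x : A := (n.+1%:R^-1 : R)%:C%C *: \sum_(i < n.+1) iter i S x.

Lemma rnorm_sum (F : nat -> A) (c : R) n :
  (forall i, nr (F i) <= c) -> nr (\sum_(i < n) F i) <= n%:R * c.
Proof.
move=> h; elim: n => [|n IH]; first by rewrite big_ord0 rnorm0 mul0r.
rewrite big_ord_recr /= (le_trans (rnormD _ _)) // -natr1 mulrDl mul1r.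
by rewrite lerD.
Qed.

Lemma cesaro_norm n x : nr (cesaro n x) <= nr x.
Proof.
rewrite /cesaro rnormZ ?invr_ge0 // ler_pdivrMl ?ltr0n //.
by apply: (rnorm_sum (F := fun i => iter i S x)) => i; rewrite S_norm.
Qed.

Lemma cesaro_mul n x y : cesaro n (x ** y) = x ** cesaro n y.
Proof.
rewrite /cesaro smulZr smul_sumr; congr (_ *: _).
by apply: eq_bigr => i _; rewrite S_mul.
Qed.

Lemma cesaro_ideal n x : I (x - cesaro n x).
Proof.
have -> : x - cesaro n x =
    (n.+1%:R^-1 : R)%:C%C *: \sum_(i < n.+1) (x - iter i S x).
  rewrite sumrB sumr_const card_ord scalerBr; congr (_ - _).
  rewrite -(scaler_nat _ x) scalerA fmorphV rmorph_nat mulVf ?scale1r //.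
  by rewrite pnatr_eq0.
apply: idealZ; elim/big_ind: _ => [|a b|i _].
- exact: ideal0.
- exact: idealD.
- exact: S_ideal.
Qed.

Lemma cesaro_sq n x : nr (cesaro n x) ^+ 2 <= nr (cesaro n (star x ** x)).
Proof.
rewrite -rnorm_star_mul -cesaro_mul (le_trans (cesaro_norm _ _)) //.
by rewrite -rnorm_star starM starK -cesaro_mul.
Qed.

Lemma cesaro_mean_bound h n : star h = h ->
  h ** h - h ** h ** v = ('i / 2 : R[i]) *: (h ** (v + v - v ** v)) ->
  nr (cesaro n (h ** h)) <= n.+1%:R^-1 * nr h.
Proof.
move=> sh hv.
have Thh : T (h ** h) = ('i / 2 : R[i]) *: (h - S h).
  rewrite /T hv /S /T; congr (_ *: _).
  by rewrite smulBl smulBr smulDr smulA !opprB addrCA [h + _]addrC subrK addrAC.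
have cesaroT : T (cesaro n (h ** h)) = cesaro n (T (h ** h)).
  rewrite /cesaro /T smulZl -scalerBr; congr (_ *: _).
  rewrite (big_morph (fun z => z ** v) (fun a b => smulDl a b v) (smul0l v)).
  rewrite -sumrB; apply: eq_bigr => i _.
  by rewrite -[h ** h - _]/(T (h ** h)) -iterTS.
rewrite -T_norm cesaroT Thh /cesaro rnormZ ?invr_ge0 // ler_wpM2l ?invr_ge0 //.
have -> : \sum_(i < n.+1) iter i S (('i / 2 : R[i]) *: (h - S h)) =
  ('i / 2 : R[i]) *: (h - iter n.+1 S h).
  elim: (n.+1) => [|m IH]; first by rewrite big_ord0 /= subrr scaler0.
  rewrite big_ord_recr /= IH SZ SB -scalerDr -iterSr iterS.
  by rewrite subrKA.
have -> : nr (('i / 2 : R[i]) *: (h - iter n.+1 S h)) = 2^-1 * nr (h - iter n.+1 S h).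
  rewrite mulrC -scalerA half_real rnormZ ?invr_ge0 //; congr (_ * _).
  by rewrite /rnorm normrZ normCi mul1r.
have := rnormB h (iter n.+1 S h); rewrite S_norm; lra.
Qed.

End Averages.

Lemma ideal_star_small x : nr x <= 2^-1 -> I x -> I (star x).
Proof.
move=> nx Ix; set h := x ** star x.
have Ih : I h by apply: ideal_mulr.
have sh : star h = h by rewrite starM starK.
have nh : nr h <= 2^-1.
  by rewrite rnorm_mul_star; have := rnorm_ge0 x; nra.
have [v [Iv vv hv]] := ideal_unitary Ih sh nh.
apply: (rnorm_closed (@ideal_closed _ _ I)) => e e0.
have [n hn] : exists n, (e ^+ 4)^-1 < n%:R.
  by exists (Num.bound (e ^+ 4)^-1); apply: archi_boundP;
     rewrite invr_ge0 exprn_ge0 ?ltW.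
exists (star x - cesaro v n (star x)); first exact: cesaro_ideal.
rewrite opprB addrC subrK -(ltr_pXn2r (n := 4)) ?nnegrE ?rnorm_ge0 ?ltW //.
have h1 := cesaro_sq vv n (star x); rewrite starK -/h in h1.
have h2 := cesaro_sq vv n h; rewrite sh in h2.
have h3 := cesaro_mean_bound vv n sh hv.
have h4 : n.+1%:R^-1 < e ^+ 4.
  rewrite invf_plt ?posrE ?exprn_gt0 //.
  by apply: lt_trans hn _; rewrite ltr_nat.
have h5 : n.+1%:R^-1 * nr h <= n.+1%:R^-1.
  by rewrite ler_piMr ?invr_ge0 //; lra.
apply: le_lt_trans (le_lt_trans h5 h4); apply: le_trans h3.
apply: le_trans h2; rewrite (exprM _ 2 2) lerXn2r ?nnegrE ?rnorm_ge0 //.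
by rewrite exprn_ge0 ?rnorm_ge0.
Qed.

(* Closed two-sided ideals are self-adjoint: if U := 1 - v is the unitary above
   for h = x x^*, the means of x^* U^(2j), j <= n, are in x^* + I and tend to
   0. *)
Lemma ideal_star x : I x -> I (star x).
Proof.
move=> Ix; pose c := 2 * (nr x + 1).
have c0 : 0 < c by have := rnorm_ge0 x; rewrite /c; lra.
have : I (star ((c^-1)%:C%C *: x)).
  apply: ideal_star_small; last exact: idealZ.
  rewrite rnormZ ?invr_ge0 ?(ltW c0) // ler_pdivrMl //.
  by rewrite /c; have := rnorm_ge0 x; lra.
move=> /(@idealZ _ _ I ((c^-1)%:C%C^*)^-1); rewrite starZ scalerA mulVf ?scale1r //.
by rewrite conjC_eq0 fmorph_eq0 invr_eq0 gt_eqF.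
Qed.

End IdealStar.

Section IdealQuotient.
Variables (R : realType) (A : cstarAlgType R) (I : closedIdeal A).

Definition ideal_pred : {pred A} := fun x => `[< I x >].

Lemma ideal_predP x : reflect (I x) (x \in ideal_pred).
Proof. exact: asboolP. Qed.

Fact ideal_zmod_closed : zmod_closed ideal_pred.
Proof.
split=> [|x y /ideal_predP Ix /ideal_predP Iy]; apply/ideal_predP.
  exact: ideal0.
exact: idealB.
Qed.
HB.instance Definition _ := GRing.isZmodClosed.Build A ideal_pred ideal_zmod_closed.

(* A/I with the *-algebra structure induced by A. A *-homomorphism is an
   algebraic notion, so the quotient norm is not needed to speak of
   *-homomorphisms into A/I. *)
Definition cquot : Type := {quot ideal_pred}.
HB.instance Definition _ := GRing.Zmodule.on cquot.

Definition cquot_pi (x : A) : cquot := \pi_({quot ideal_pred})%qT x.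

(* The operations are computed on representatives; the lemmas below show that
   they do not depend on the choice. *)
Definition cquot_scale (a : R[i]) (u : cquot) : cquot :=
  cquot_pi (a *: repr u).
Definition cquot_mul (u v : cquot) : cquot := cquot_pi (repr u ** repr v).
Definition cquot_star (u : cquot) : cquot := cquot_pi (star (repr u)).

Lemma cquot_piP x y : cquot_pi x = cquot_pi y <-> I (x - y).
Proof.
rewrite /cquot_pi; split => [/eqP|/ideal_predP h].
  by rewrite -idealrBE => /ideal_predP.
by apply/eqP; rewrite -idealrBE.
Qed.

Lemma cquot_pi_repr (u : cquot) : cquot_pi (repr u) = u.
Proof. exact: reprK. Qed.

Lemma cquot_piD x y : cquot_pi (x + y) = cquot_pi x + cquot_pi y.
Proof. exact: pi_addr. Qed.

Lemma cquot_piZ a x : cquot_pi (a *: x) = cquot_scale a (cquot_pi x).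
Proof.
apply/cquot_piP; rewrite -scalerBr; apply: idealZ.
by apply/cquot_piP; rewrite cquot_pi_repr.
Qed.

Lemma cquot_piM x y : cquot_pi (x ** y) = cquot_mul (cquot_pi x) (cquot_pi y).
Proof.
apply/cquot_piP; rewrite -(subrKA (x ** repr (cquot_pi y))) -smulBr -smulBl.
by apply: idealD; [apply: ideal_mull|apply: ideal_mulr];
  apply/cquot_piP; rewrite cquot_pi_repr.
Qed.

Lemma cquot_pi_star x : cquot_pi (star x) = cquot_star (cquot_pi x).
Proof.
apply/cquot_piP; rewrite -starB; apply: ideal_star.
by apply/cquot_piP; rewrite cquot_pi_repr.
Qed.

Let quotP (P : cquot -> Prop) : (forall x, P (cquot_pi x)) -> forall u, P u.
Proof. by move=> h u; rewrite -(cquot_pi_repr u). Qed.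

Fact cquot_scaleA a b u :
  cquot_scale a (cquot_scale b u) = cquot_scale (a * b) u.
Proof. by elim/quotP: u => x; rewrite -!cquot_piZ scalerA. Qed.
Fact cquot_scale1 : left_id 1 cquot_scale.
Proof. by elim/quotP => x; rewrite -cquot_piZ scale1r. Qed.
Fact cquot_scaleDr : right_distributive cquot_scale +%R.
Proof.
by move=> a; elim/quotP => x; elim/quotP => y; rewrite -!(cquot_piD, cquot_piZ) scalerDr.
Qed.
Fact cquot_scaleDl u : {morph cquot_scale^~ u : a b / a + b}.
Proof. by elim/quotP: u => x a b; rewrite -!cquot_piZ scalerDl cquot_piD. Qed.
HB.instance Definition _ := GRing.Zmodule_isLmodule.Build R[i] cquot
  cquot_scaleA cquot_scale1 cquot_scaleDr cquot_scaleDl.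

Lemma cquot_piZE (a : R[i]) x : cquot_pi (a *: x) = a *: cquot_pi x.
Proof. exact: cquot_piZ. Qed.

Fact cquot_mulA : associative cquot_mul.
Proof.
by elim/quotP => x; elim/quotP => y; elim/quotP => z; rewrite -!cquot_piM smulA.
Qed.
Fact cquot_mulDl : left_distributive cquot_mul +%R.
Proof.
elim/quotP => x; elim/quotP => y; elim/quotP => z.
by rewrite -!(cquot_piD, cquot_piM) smulDl.
Qed.
Fact cquot_mulDr : right_distributive cquot_mul +%R.
Proof.
elim/quotP => x; elim/quotP => y; elim/quotP => z.
by rewrite -!(cquot_piD, cquot_piM) smulDr.
Qed.
Fact cquot_mulZl (a : R[i]) u v : cquot_mul (a *: u) v = a *: cquot_mul u v.
Proof.
elim/quotP: u => x; elim/quotP: v => y.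
by rewrite -!(cquot_piZE, cquot_piM) smulZl.
Qed.
Fact cquot_mulZr (a : R[i]) u v : cquot_mul u (a *: v) = a *: cquot_mul u v.
Proof.
elim/quotP: u => x; elim/quotP: v => y.
by rewrite -!(cquot_piZE, cquot_piM) smulZr.
Qed.
Fact cquot_starK : involutive cquot_star.
Proof. by elim/quotP => x; rewrite -!cquot_pi_star starK. Qed.
Fact cquot_starD : {morph cquot_star : u v / u + v}.
Proof.
by elim/quotP => x; elim/quotP => y; rewrite -!(cquot_piD, cquot_pi_star) starD.
Qed.
Fact cquot_starZ (a : R[i]) u : cquot_star (a *: u) = a^* *: cquot_star u.
Proof.
by elim/quotP: u => x; rewrite -!(cquot_piZE, cquot_pi_star) starZ.
Qed.
Fact cquot_starM u v :
  cquot_star (cquot_mul u v) = cquot_mul (cquot_star v) (cquot_star u).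
Proof.
by elim/quotP: u => x; elim/quotP: v => y; rewrite -!(cquot_piM, cquot_pi_star) starM.
Qed.
HB.instance Definition _ := Lmodule_isStarAlgebra.Build R[i] cquot
  cquot_mulA cquot_mulDl cquot_mulDr cquot_mulZl cquot_mulZr
  cquot_starK cquot_starD cquot_starZ cquot_starM.

End IdealQuotient.

Definition star_morphism (C : numClosedFieldType) (A B : starAlgType C)
    (f : A -> B) : Prop :=
  [/\ linear f, {morph f : x y / x ** y} & {morph f : x / star x}].

(* There is no unit to serve as a zeroth power: the value 0 at n = 0 is junk. *)
Definition spow (C : numClosedFieldType) (A : starAlgType C) (x : A) (n : nat) : A :=
  iterop n (@smul C A) x 0.

Definition nilpotent_contraction (R : realType) (A : cstarAlgType R)
    (n : nat) (a : A) : Prop :=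
  spow a n = 0 /\ `|a| <= 1.

Definition is_universal (R : realType) (n : nat) (U : cstarAlgType R)
    (x0 : U) : Prop :=
  nilpotent_contraction n x0 /\
  forall (A : cstarAlgType R) (a : A), nilpotent_contraction n a ->
    exists! phi : U -> A, star_morphism phi /\ phi x0 = a.

Definition projective (R : realType) (B : cstarAlgType R) : Prop :=
  forall (A : cstarAlgType R) (I : closedIdeal A) (f : B -> cquot I),
    star_morphism f ->
    exists2 g : B -> A, star_morphism g & forall b : B, f b = cquot_pi I (g b).

(* Main.v *)
(* The main point is that a nilpotent contraction of A/I lifts to one of A. Start
   with a lift X with |X^n| <= r^p, and a positive rho which commutes with X,
   equals r near I, and equals a much smaller constant modulo I. The weight
   H = sum_(k < n) rho^(-2Mk) X^k X^*k, with M = 2n, grows by a factor of about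
   rho^(-2M) along X. Hence smooth cut-offs of H turn X into an almost strictly
   triangular element at distance O(r) from X, whose n-th power is O((2 r^2)^p),
   much smaller than (r/2)^p. Modulo I the change is tiny and can be undone.
   The norm is brought below 1 + r/2 by damping along an approximate unit, and
   the iterates converge.

   An element such as rho need not exist in A. It does in the algebra of bounded
   sequences of A modulo null sequences, where a quasi-central approximate unit
   of I commutes with X; the result is pulled back to one term of the sequence.

   For f : U -> A/I, the element f(x0) has lifts of norm at most 1 + d for every
   d > 0, because a self-adjoint h with |h| < 1 is the imaginary part of a unitary.
   A nilpotent contraction X that lifts f(x0) gives g : U -> A with g(x0) = X, and
   f = g + I on a closed *-subalgebra which contains x0; by the uniqueness of
   factorizations this subalgebra is U. *)

(* With spectral projections of H at hand, X could be made exactly strictly triangular. Here the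
   cut-offs are continuous and overlap, so everything is quantitative. A cut-off below one threshold
   times a cut-off above a larger one is O(rho^2), hence O(r^2); raising the cut-offs to the power p
   turns this into (2 r^2)^p, while the distance O(r) between X and its truncation only changes by a
   constant that depends on n. This quadratic gain is what beats (r/2)^p once r is small.

   All cut-offs are rational expressions in X, X^* and the inverse of rho, so truncation is
   compatible with quotients. Modulo I, where rho is a scalar s, the truncation of X therefore
   agrees with that of any other lift Y with the scalar s. If Y is chosen with |Y^n| <= s^p, then Y
   differs from its own truncation by O(s) only, and adding this difference restores the class of
   X. *)
From HB Require Import structures.
From Stdlib Require Ncring Ncring_tac.
Require Import Defs.
From mathcomp Require Import all_boot all_order all_algebra.
From mathcomp Require Import boolp classical_sets reals topology normedtype sequences.
From mathcomp Require Import complex ring lra zify.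

Set Implicit Arguments.
Unset Strict Implicit.
Unset Printing Implicit Defensive.
Import Order.TTheory GRing.Theory Num.Theory numFieldNormedType.Exports.
Local Open Scope ring_scope.

(* [nle x c] stands for |x| <= c: the norms of the unitization and of the algebra
   of sequences modulo null sequences are infima or suprema, and are only used
   through their upper bounds. *)
HB.mixin Record PzRing_isNormedStar (R : realType) E of GRing.PzRing E := {
  sc : R -> E;
  adj : E -> E;
  nle : E -> R -> Prop;
  sc_zmod : zmod_morphism sc;
  sc_monoid : monoid_morphism sc;
  scC : forall c (x : E), sc c * x = x * sc c;
  adjK : involutive adj;
  adjD : {morph adj : x y / x + y};
  adjM : forall x y : E, adj (x * y) = adj y * adj x;
  adj_sc : forall c, adj (sc c) = sc c;
  nle_ge0 : forall x c, nle x c -> 0 <= c;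
  nle_ex : forall x, exists c, nle x c;
  nle_mono : forall x c d, nle x c -> c <= d -> nle x d;
  nle_lim : forall x c, (forall e, 0 < e -> nle x (c + e)) -> nle x c;
  nle_eq0 : forall x, nle x 0 -> x = 0;
  nleD : forall x y c d, nle x c -> nle y d -> nle (x + y) (c + d);
  nleM : forall x y c d, nle x c -> nle y d -> nle (x * y) (c * d);
  nle_adj : forall x c, nle x c -> nle (adj x) c;
  nle_cstar : forall x c, 0 <= c -> nle (adj x * x) (c ^+ 2) -> nle x c;
  nle_sc : forall c, nle (sc c) `|c|
}.

#[short(type="normedStarType")]
HB.structure Definition NormedStar (R : realType) :=
  {E of PzRing_isNormedStar R E & GRing.PzRing E}.

Notation "c %:S" := (sc c) (at level 1, format "c %:S").

HB.instance Definition _ (R : realType) (E : normedStarType R) :=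
  GRing.isZmodMorphism.Build R E (@sc R E) (@sc_zmod R E).
HB.instance Definition _ (R : realType) (E : normedStarType R) :=
  GRing.isMonoidMorphism.Build R E (@sc R E) (@sc_monoid R E).

#[export] Instance pzRing_ops (E : pzRingType) :
  @Ncring.Ring_ops E 0 1 +%R *%R (fun x y => x - y) -%R eq := {}.
#[export] Instance pzRing_ncring (E : pzRingType) :
  @Ncring.Ring E _ _ _ _ _ _ _ (pzRing_ops E).
Proof.
split; try by move=> * ; subst.
- exact: RelationClasses.eq_equivalence.
- by move=> ? ? -> ? ? ->.
- by move=> ? ? -> ? ? ->.
- by move=> ? ? -> ? ? ->.
- by move=> ? ? ->.
- exact: add0r.
- exact: addrC.
- exact: addrA.
- exact: mul1r.
- exact: mulr1.
- exact: mulrA.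
- exact: mulrDl.
- by move=> x y z; exact: mulrDr.
- exact: subrr.
Qed.

(* [refine] resets the type of the equation to the carrier of a canonical ring, on
   which the instance above is found. *)
Lemma pzRing_eq (E : pzRingType) (x y : E) : x = y -> x = y. Proof. by []. Qed.

Ltac ncring := rewrite ?expr2 ?mulr2n; refine (@pzRing_eq _ _ _ _); Ncring_tac.non_commutative_ring.

Lemma commr_mulCA (E : pzRingType) (x y z : E) :
  GRing.comm x y -> y * (x * z) = x * (y * z).
Proof. by move=> xy; rewrite !mulrA xy. Qed.

(** * Removing constants by taking roots *)

Section PowerTrick.
Variable R : realType.

Lemma expr_small (k c e : R) : 0 <= k < 1 -> 0 < e -> exists N, k ^+ N * c < e.
Proof.
move=> /andP[k0 k1] e0.
have /cvgrPdist_lt /(_ (e / (`|c| + 1))) h : ((fun n => k ^+ n) @ \oo --> (0 : R))%classic.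
  by apply: cvg_expr; rewrite ger0_norm.
have d0 : 0 < `|c| + 1 by rewrite ltr_wpDl.
have [|N _ hN] := h; first exact: divr_gt0.
exists N; have := hN N (leqnn N); rewrite /= sub0r normrN ger0_norm ?exprn_ge0 //.
rewrite ltr_pdivlMr // => /(le_lt_trans _); apply.
by rewrite ler_wpM2l ?exprn_ge0 // (le_trans (ler_norm _)) // lerDl.
Qed.

(** The factor [c] disappears in 2^k-th roots. Estimates of high powers that lose a constant thus
    become sharp; the proofs of positivity and of the averaging bound both end in this way. *)
Lemma le_of_pow2 (x y c : R) : 0 <= x -> 0 <= y ->
  (forall k, x ^+ (2 ^ k) <= c * y ^+ (2 ^ k)) -> x <= y.
Proof.
move=> x0 y0 h; rewrite leNgt; apply/negP => yx.
have xp : 0 < x by exact: le_lt_trans yx.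
have q01 : 0 <= y / x < 1 by rewrite divr_ge0 // ltr_pdivrMr // mul1r.
have [N hN] := expr_small c q01 (ltr01 : 0 < 1 :> R).
have := h N; rewrite leNgt => /negP; apply.
rewrite -[ltRHS]mul1r -ltr_pdivrMr ?exprn_gt0 // -mulrA -expr_div_n mulrC.
have c0 : 0 <= c.
  have := h 0%N; rewrite expn0 !expr1 => hc; rewrite leNgt; apply/negP => cl.
  by nra.
apply: le_lt_trans hN; apply: ler_wpM2r => //.
have /andP[q0 q1] := q01.
by apply: ler_wiXn2l => //; [exact: ltW | exact/ltnW/ltn_expl].
Qed.

End PowerTrick.

(** * Norm calculus derived from upper bounds *)

Section NormedStarTheory.
Variables (R : realType) (E : normedStarType R).
Implicit Types (x y z : E) (c d : R).

Definition nm x : R := inf [set c | nle x c]%classic.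

Lemma nm_lb x : has_lbound [set c | nle x c]%classic.
Proof. by exists 0 => c /nle_ge0. Qed.

Lemma nm_le x c : nle x c -> nm x <= c.
Proof. by move=> h; apply: ge_inf => //; exact: nm_lb. Qed.

(** By [nle_lim] the infimum is attained, so [nm] is itself an admissible bound. *)
Lemma nmP x : nle x (nm x).
Proof.
apply: nle_lim => e e0.
have hi : has_inf [set c | nle x c]%classic.
  by split; [have [c] := nle_ex x; exists c | exact: nm_lb].
have [c /= hc hce] := inf_adherent e0 hi.
by apply: nle_mono hc _; exact: ltW.
Qed.

Lemma nmE x c : nle x c <-> nm x <= c.
Proof. by split; [exact: nm_le | move=> h; apply: nle_mono h; exact: nmP]. Qed.

Lemma nm_ge0 x : 0 <= nm x. Proof. exact: nle_ge0 (nmP x). Qed.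
Lemma nmD x y : nm (x + y) <= nm x + nm y.
Proof. by apply/nm_le/nleD; exact: nmP. Qed.
Lemma nmM x y : nm (x * y) <= nm x * nm y.
Proof. by apply/nm_le/nleM; exact: nmP. Qed.
Lemma nm_sc c : nm (c%:S : E) <= `|c|.
Proof. exact/nm_le/nle_sc. Qed.
Lemma nm1 : nm 1 <= 1.
Proof. by rewrite -(rmorph1 (@sc R E)) (le_trans (nm_sc _)) ?normr1. Qed.
Lemma nm0 : nm 0 = 0.
Proof.
apply/le_anti; rewrite nm_ge0 andbT -(rmorph0 (@sc R E)).
by rewrite (le_trans (nm_sc _)) ?normr0.
Qed.
Lemma nm_eq0 x : nm x <= 0 -> x = 0.
Proof. by move=> /nmE/nle_eq0. Qed.
Lemma nmM_le x y c d : nm x <= c -> nm y <= d -> nm (x * y) <= c * d.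
Proof. by move=> /nmE hx /nmE hy; apply/nmE/nleM. Qed.
Lemma nmD_le x y c d : nm x <= c -> nm y <= d -> nm (x + y) <= c + d.
Proof. by move=> hx hy; rewrite (le_trans (nmD _ _)) ?lerD. Qed.
Lemma nm_scM c x : nm (c%:S * x) <= `|c| * nm x.
Proof. exact: nmM_le (nm_sc c) (lexx _). Qed.
Lemma nmN x : nm (- x) = nm x.
Proof.
have h y : nm (- y) <= nm y.
  rewrite -mulN1r -(rmorph1 (@sc R E)) -rmorphN (le_trans (nm_scM _ _)) //.
  by rewrite normrN normr1 mul1r.
by apply/le_anti; rewrite h -{1}(opprK x) h.
Qed.
Lemma nmB x y : nm (x - y) <= nm x + nm y.
Proof. by rewrite -(nmN y) nmD. Qed.
Lemma nmB_le x y c d : nm x <= c -> nm y <= d -> nm (x - y) <= c + d.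
Proof. by move=> hx hy; rewrite (le_trans (nmB _ _)) ?lerD. Qed.
Lemma nmBC x y : nm (x - y) = nm (y - x).
Proof. by rewrite -nmN opprB. Qed.
Lemma nm_adj x : nm (adj x) = nm x.
Proof.
have h y : nm (adj y) <= nm y by apply/nm_le/nle_adj; exact: nmP.
by apply/le_anti; rewrite h -{1}(adjK x) h.
Qed.
Lemma nm_cstar_le x c : 0 <= c -> nm (adj x * x) <= c ^+ 2 -> nm x <= c.
Proof. by move=> c0 /nmE/(nle_cstar _ _ c0)/nm_le. Qed.
Lemma nm_cstar x : nm (adj x * x) = nm x ^+ 2.
Proof.
apply/le_anti; rewrite expr2; apply/andP; split.
  by rewrite -{1}(nm_adj x) nmM.
rewrite -expr2 -[leRHS]sqr_sqrtr ?nm_ge0 // lerXn2r ?nnegrE ?nm_ge0 ?sqrtr_ge0 //.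
by apply: nm_cstar_le; rewrite ?sqrtr_ge0 // sqr_sqrtr ?nm_ge0.
Qed.
Lemma nm_cstar' x : nm (x * adj x) = nm x ^+ 2.
Proof. by rewrite -{1}(adjK x) nm_cstar nm_adj. Qed.

Lemma adj0 : adj (0 : E) = 0.
Proof. by rewrite -(rmorph0 (@sc R E)) adj_sc. Qed.
Lemma adj1 : adj (1 : E) = 1.
Proof. by rewrite -(rmorph1 (@sc R E)) adj_sc. Qed.
Lemma adjN x : adj (- x) = - adj x.
Proof. by apply/eqP; rewrite -addr_eq0 -adjD addNr adj0. Qed.
Lemma adjB x y : adj (x - y) = adj x - adj y.
Proof. by rewrite adjD adjN. Qed.
Lemma adjX x n : adj (x ^+ n) = adj x ^+ n.
Proof. by elim: n => [|n IH]; rewrite ?expr0 ?adj1 // exprS exprSr adjM IH. Qed.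
Lemma adj_sum (I : Type) (r : seq I) (F : I -> E) :
  adj (\sum_(i <- r) F i) = \sum_(i <- r) adj (F i).
Proof. exact: (big_morph (@adj R E) (@adjD R E) adj0). Qed.

Lemma nmX x n : nm (x ^+ n) <= nm x ^+ n.
Proof.
elim: n => [|n IH]; first by rewrite !expr0 nm1.
by rewrite !exprS nmM_le.
Qed.
Lemma nmX_le x c n : nm x <= c -> nm (x ^+ n) <= c ^+ n.
Proof.
move=> h; apply: le_trans (nmX _ _) _.
by rewrite lerXn2r ?nnegrE ?nm_ge0 // (le_trans _ h) ?nm_ge0.
Qed.

Lemma nm_pow2 x k : adj x = x -> nm (x ^+ (2 ^ k)) = nm x ^+ (2 ^ k).
Proof.
move=> sx; elim: k => [|k IH]; first by rewrite expn0 !expr1.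
rewrite expnSr !exprM -IH -(nm_cstar (x ^+ _)); congr nm.
by rewrite adjX sx expr2.
Qed.

Lemma nm_sum (I : Type) (r : seq I) (F : I -> E) :
  nm (\sum_(i <- r) F i) <= \sum_(i <- r) nm (F i).
Proof.
elim: r => [|i r IH]; first by rewrite !big_nil nm0.
by rewrite !big_cons (le_trans (nmD _ _)) ?lerD.
Qed.

Lemma nm_sum_le (n : nat) (F : nat -> E) c :
  (forall i, (i < n)%N -> nm (F i) <= c) -> nm (\sum_(i < n) F i) <= n%:R * c.
Proof.
move=> h; apply: le_trans (nm_sum _ _) _.
rewrite -[n in n%:R]card_ord -sum1_card natr_sum mulr_suml ler_sum // => i _.
by rewrite mul1r h.
Qed.

Lemma nm_small x : (forall e, 0 < e -> nm x <= e) -> x = 0.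
Proof.
by move=> h; apply: nm_eq0; apply/ler_addgt0Pl => e e0; rewrite addr0 h.
Qed.

Lemma comm_adj x y : adj x = x -> GRing.comm x y -> GRing.comm x (adj y).
Proof. by move=> sx; rewrite /GRing.comm => /(congr1 (@adj R E)); rewrite !adjM sx. Qed.

Lemma sc_mul_adj (c : R) (w : E) : c%:S * w * adj (c%:S * w) = (c * c)%:S * (w * adj w).
Proof.
by rewrite adjM adj_sc -scC -mulrA (mulrA w) -scC rmorphM !mulrA.
Qed.

(** These finite sums stand for the positive elements. Keeping the list of summands makes them pass
    to sequences term by term, and addition is concatenation. *)
Definition psum (s : seq E) : E := \sum_(w <- s) w * adj w.

Lemma adj_psum s : adj (psum s) = psum s.
Proof. by rewrite adj_sum; apply: eq_bigr => w _; rewrite adjM adjK. Qed.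

Definition ninv x : E := xget 0 [set y | x * y = 1 /\ y * x = 1]%classic.

Definition invertible x := exists y, x * y = 1 /\ y * x = 1.

Lemma ninvP x : invertible x -> x * ninv x = 1 /\ ninv x * x = 1.
Proof.
move=> [y hy].
by apply: (@xgetPex _ 0 [set y | x * y = 1 /\ y * x = 1]%classic); exists y.
Qed.

Lemma comm_inv x y z : x * y = 1 -> y * x = 1 -> GRing.comm z x -> GRing.comm z y.
Proof.
move=> xy yx; rewrite /GRing.comm => h.
by rewrite -[LHS]mul1r -yx -!mulrA (mulrA x z) -h -!mulrA xy mulr1.
Qed.

Lemma adj_inv x y : adj x = x -> x * y = 1 -> y * x = 1 -> adj y = y.
Proof.
move=> sx xy yx.
have : adj (x * y) = 1 by rewrite xy adj1.
by rewrite adjM sx => h; rewrite -[RHS]mul1r -h -mulrA xy mulr1.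
Qed.

End NormedStarTheory.

(* The two consequences of positivity which the lifting uses. Unlike spectral
   theory, they pass to sequences modulo null sequences. *)
HB.mixin Record NormedStar_isPositive (R : realType) E of NormedStar R E := {
  nle_psum : forall (s t : seq E) (c : R), nle (psum s + psum t) c -> nle (psum s) c;
  psum_inv : forall s : seq E, invertible (1 + psum s)
}.

#[short(type="posStarType")]
HB.structure Definition PosStar (R : realType) :=
  {E of NormedStar_isPositive R E & NormedStar R E & GRing.PzRing E}.

(** * Norm estimates from positivity *)

Section PosStarTheory.
Variables (R : realType) (E : posStarType R).
Implicit Types (x y z : E) (c d : R).

Lemma nm_psum (s t : seq E) : nm (psum s) <= nm (psum s + psum t).
Proof. by apply/nm_le/(@nle_psum R E s t)/nmP. Qed.

Lemma nm_psum_mem (s : seq E) w : w \in s -> nm w ^+ 2 <= nm (psum s).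
Proof.
elim: s => // a s IH; rewrite inE => /orP[/eqP ->|/IH h].
  have := nm_psum [:: a] s; rewrite /psum big_seq1 nm_cstar' => h.
  by rewrite big_cons.
apply: le_trans h _; have := nm_psum s [:: a].
by rewrite /psum big_seq1 big_cons addrC.
Qed.

(* For T = sum of w w^*, [T^(-1/2) w] is a contraction; the statement avoids the
   square root.  With m = w^* T^-1 w, the identity m = sum_v (w^* T^-1 v)(w^* T^-1 v)^*
   gives |m|^2 <= |m|. *)
Lemma psum_kernel (s : seq E) V w v :
  psum s * V = 1 -> V * psum s = 1 -> w \in s -> v \in s ->
  nm (adj w * V * v) <= 1.
Proof.
move=> TV VT ws vs.
have sV : adj V = V by apply: adj_inv TV VT; exact: adj_psum.
pose t := [seq adj w * V * u | u <- s].
have tE : psum t = adj w * V * w.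
  rewrite /psum big_map.
  under eq_bigr => u _ do rewrite !adjM adjK sV -!mulrA (mulrA u).
  rewrite -!mulr_sumr -mulr_suml -/(psum s).
  by rewrite (mulrA (psum s)) TV mul1r mulrA.
have In_t u : u \in s -> adj w * V * u \in t by exact: map_f.
have hw := nm_psum_mem (In_t _ ws); have hv := nm_psum_mem (In_t _ vs).
rewrite tE in hw hv.
have m1 : nm (adj w * V * w) <= 1 by have := nm_ge0 (adj w * V * w); nra.
by have := nm_ge0 (adj w * V * v); nra.
Qed.

End PosStarTheory.

(** * Completeness, closed conditions and fixed points *)

Section Closedness.
Variables (R : realType) (E : normedStarType R).
Implicit Types (x y z : E) (P : E -> Prop).

Definition ncomplete := forall u : nat -> E,
  (forall e : R, 0 < e -> exists N, forall m, (N <= m)%N -> nm (u m - u N) <= e) ->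
  exists w, forall e : R, 0 < e -> exists N, forall m, (N <= m)%N -> nm (w - u m) <= e.

Definition nclosed P :=
  forall x, (forall e : R, 0 < e -> exists2 y, P y & nm (x - y) <= e) -> P x.

Lemma nclosed_comm z : nclosed (GRing.comm z).
Proof.
move=> x h; apply/eqP; rewrite -subr_eq0; apply/eqP/nm_small => e e0.
pose d := e / (2 * nm z + 1).
have z0 := nm_ge0 z.
have [|y zy hy] := h d; first by rewrite divr_gt0 //; lra.
have -> : z * x - x * z = z * (x - y) - (x - y) * z.
  rewrite mulrBr mulrBl zy; ncring.
apply: le_trans (nmB_le (nmM_le (lexx _) hy) (nmM_le hy (lexx _))) _.
have : d * (2 * nm z + 1) = e by rewrite divfK //; apply/lt0r_neq0; lra.
have : 0 <= d by apply: divr_ge0; lra.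
nra.
Qed.

Lemma nclosed_sa : nclosed (fun x => adj x = x).
Proof.
move=> x h; apply/eqP; rewrite -subr_eq0; apply/eqP/nm_small => e e0.
have [|y sy hy] := h (e / 2); first by lra.
have -> : adj x - x = adj (x - y) - (x - y) by rewrite adjB sy; ncring.
by apply: le_trans (nmB _ _) _; rewrite nm_adj; lra.
Qed.

Lemma nclosed_le c : nclosed (fun x => nm x <= c).
Proof.
move=> x h; apply/ler_addgt0Pl => e e0.
have [y hy hxy] := h e e0.
by rewrite -(subrK y x) (le_trans (nmD _ _)) ?lerD.
Qed.

(** The iteration starts at 0, so every closed condition that holds at 0 and is preserved by [G]
    passes to the fixed point. This is how self-adjointness and commutation are obtained for square
    roots. *)
Lemma contraction_fixpoint (G : E -> E) (t k : R) : ncomplete -> 0 <= t -> 0 <= k < 1 ->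
  (forall x, nm x <= t -> nm (G x) <= t) ->
  (forall x y, nm x <= t -> nm y <= t -> nm (G x - G y) <= k * nm (x - y)) ->
  exists w, [/\ nm w <= t, G w = w &
    forall P, nclosed P -> P 0 -> (forall x, P x -> P (G x)) -> P w].
Proof.
move=> cE t0 k01 Gt Gk; have /andP[k0 k1] := k01.
pose u n := iter n G 0.
have hu n : nm (u n) <= t by elim: n => [|n IH] /=; [rewrite nm0 | exact: Gt].
have hd n p : nm (u (n + p)%N - u n) <= k ^+ n * t.
  elim: n => [|n IH]; first by rewrite add0n expr0 mul1r subr0.
  rewrite addSn (le_trans (Gk _ _ (hu _) (hu _))) //.
  by rewrite exprS -mulrA ler_wpM2l.
have [|w hw] := cE u.
  move=> e e0; have [N hN] := expr_small t k01 e0.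
  by exists N => m Nm; rewrite -(subnKC Nm) (le_trans (hd _ _)) ?ltW.
have wP P : nclosed P -> P 0 -> (forall x, P x -> P (G x)) -> P w.
  move=> cP P0 PG; apply: cP => e /hw[N hN]; exists (u N); last exact: hN.
  by elim: N {hN} => //= N; exact: PG.
have wt : nm w <= t by apply: (wP _ (@nclosed_le t)); rewrite ?nm0.
exists w; split => //.
apply/eqP; rewrite -subr_eq0; apply/eqP/nm_small => e e0.
have [|N hN] := hw (e / 2); first by lra.
have -> : G w - w = (G w - G (u N)) - (w - u N.+1) by rewrite /=; ncring.
apply: le_trans (nmB _ _) _.
have := Gk _ _ wt (hu N); have := hN N (leqnn _); have := hN N.+1 (leqnSn _).
have := nm_ge0 (w - u N); nra.
Qed.

End Closedness.

(* Positivity of a a^* (Fukamiya, Kelley-Vaught) without spectral theory. For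
   |a| < 1 put k = 1 - a^* a = d^2 and c_j = a d^j. Then sum_(j < N) c_j^* c_j
   = 1 - k^N and sum_(j < N) c_j c_j^* = 1 - (1 - a a^* )^N, while every
   c_j c_j^* + c_j^* c_j is a sum of squares of self-adjoint elements; hence
   0 <= (1 - a a^* )^N <= 2 for N = 2^l, and so |1 - a a^* | <= 1. *)
Section Positivity.
Variables (R : realType) (E : normedStarType R) (J : E).
Hypotheses (cE : ncomplete E) (JJ : J * J = -1) (adjJ : adj J = - J).
Hypothesis JC : forall x, J * x = x * J.
Implicit Types (a b x y z : E) (c : R).

Lemma sc_half x : (2^-1)%:S * (x + x) = x.
Proof.
rewrite mulrDr -mulrDl -rmorphD /=.
have -> : 2^-1 + 2^-1 = 1 :> R by lra.
by rewrite rmorph1 mul1r.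
Qed.

(** The equation says (1 - w)^2 = 1 - b, and [w] is a fixed point of x -> (b + x^2)/2. *)
Lemma sqrt_1B b : nm b < 1 ->
  exists w, w + w = b + w * w /\
    forall P, nclosed P -> P 0 -> (forall x, P x -> P ((2^-1)%:S * (b + x * x))) -> P w.
Proof.
move=> b1; have b0 := nm_ge0 b.
(* [t] is both the radius of an invariant ball, since (|b| + t^2)/2 <= t amounts to t <= 1, and the
   contraction ratio (|x| + |y|)/2 on it. *)
pose t := (1 + nm b) / 2.
have t1 : 0 <= t < 1 by apply/andP; split; rewrite /t; lra.
have hhalf x : nm ((2^-1)%:S * x) <= 2^-1 * nm x.
  by apply: le_trans (nm_scM _ _) _; rewrite ger0_norm ?invr_ge0.
have [||||w [_ hw wP]] :=
  @contraction_fixpoint _ _ (fun x => (2^-1)%:S * (b + x * x)) t t cE.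
- by case/andP: t1.
- exact: t1.
- move=> x xt; apply: le_trans (hhalf _) _.
  have := nmD b (x * x); have := nmM x x; have := nm_ge0 x.
  have tE : 2 * t = 1 + nm b by rewrite /t; lra.
  case/andP: t1 => t0 t1; nra.
- move=> x y xt yt; rewrite -mulrBr; apply: le_trans (hhalf _) _.
  have -> : b + x * x - (b + y * y) = x * (x - y) + (x - y) * y by ncring.
  have := nmD (x * (x - y)) ((x - y) * y).
  have := nmM x (x - y); have := nmM (x - y) y.
  have := nm_ge0 (x - y); have := nm_ge0 x; have := nm_ge0 y; nra.
by exists w; split=> //; rewrite -{1 2}hw -mulrDr sc_half.
Qed.

Lemma sqrt_1B_sa b : adj b = b -> nm b < 1 ->
  exists d, [/\ adj d = d, d * d = 1 - b & forall z, GRing.comm z b -> GRing.comm z d].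
Proof.
move=> sb /sqrt_1B[w [ww wP]]; exists (1 - w); split.
- rewrite adjB adj1; congr (_ - _).
  apply: (wP _ (@nclosed_sa _ _)); first exact: adj0.
  by move=> x sx; rewrite adjM adjD adjM sb sx adj_sc scC.
- have -> : (1 - w) * (1 - w) = 1 - (w + w) + w * w by ncring.
  by rewrite ww; ncring.
- move=> z zb; apply/commrB; first exact: commr1.
  apply: (wP _ (@nclosed_comm _ _ z)); first exact: commr0.
  move=> x zx; apply/commrM; first by rewrite /GRing.comm scC.
  by apply: commrD => //; exact: commrM.
Qed.

(** The element u = x + J y is normal with u^* u = c^2, and [x] is its real part. *)
Lemma nm_sqD x y c : adj x = x -> adj y = y -> GRing.comm x y -> 0 <= c ->
  x * x + y * y = (c ^+ 2)%:S -> nm x <= c.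
Proof.
move=> sx sy xy c0 h; pose u := x + J * y.
have su : adj u = x - J * y by rewrite adjD adjM sx sy adjJ mulrN -JC.
have uc : nm u <= c.
  apply: nm_cstar_le => //.
  have -> : adj u * u = (c ^+ 2)%:S.
    rewrite su -h.
    have -> : (x - J * y) * u = x * x + (x * J * y - J * (y * x)) - J * (y * J) * y.
      by rewrite /u; ncring.
    by rewrite -(JC x) -(JC y) !mulrA JJ -!mulrA xy; ncring.
  by apply: le_trans (nm_sc _ _) _; rewrite ger0_norm ?exprn_ge0.
have -> : x = (2^-1)%:S * (u + adj u).
  by rewrite su /u addrACA subrr addr0 sc_half.
apply: le_trans (nm_scM _ _) _; rewrite ger0_norm ?invr_ge0 //.
have := nmD u (adj u); rewrite nm_adj; lra.
Qed.

(** The norm form of positivity: the spectrum lies in [0, 2c]. In this form stability under sums is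
    immediate. *)
Definition pos b := adj b = b /\ exists c, nm (c%:S - b) <= c.

Lemma posD a b : pos a -> pos b -> pos (a + b).
Proof.
move=> [sa [c hc]] [sb [d hd]]; split; first by rewrite adjD sa sb.
exists (c + d); have -> : (c + d)%:S - (a + b) = (c%:S - a) + (d%:S - b).
  by rewrite rmorphD /=; ncring.
exact: nmD_le.
Qed.

Lemma pos_sc c : 0 <= c -> pos c%:S.
Proof. by move=> c0; split; [exact: adj_sc | exists c; rewrite subrr nm0]. Qed.

Lemma posZ c b : 0 <= c -> pos b -> pos (c%:S * b).
Proof.
move=> c0 [sb [d hd]]; split; first by rewrite adjM sb adj_sc scC.
exists (c * d); rewrite rmorphM -mulrBr.
by apply: le_trans (nmM_le (nm_sc _ _) hd) _; rewrite ger0_norm.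
Qed.

Lemma pos_sum (n : nat) (F : nat -> E) : (forall i, pos (F i)) -> pos (\sum_(i < n) F i).
Proof.
move=> h; elim: n => [|n IH]; last by rewrite big_ord_recr; exact: posD.
by rewrite big_ord0 -(rmorph0 (@sc R E)); exact: pos_sc.
Qed.

(** b + e = (c + e)(1 - y) with y = (c - b)/(c + e). The summand [e] makes |y| < 1 strict, as
    [sqrt_1B_sa] demands. *)
Lemma pos_sqrt b e : pos b -> 0 < e ->
  exists d, [/\ adj d = d, d * d = b + e%:S & forall z, GRing.comm z b -> GRing.comm z d].
Proof.
move=> [sb [c hc]] e0.
have c0 : 0 <= c by exact: le_trans (nm_ge0 _) hc.
have ce : 0 < c + e by lra.
pose y := ((c + e)^-1)%:S * (c%:S - b).
have [||d [sd dd dz]] := @sqrt_1B_sa y.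
- by rewrite adjM adjB !adj_sc sb -scC.
- apply: le_lt_trans (nmM_le (nm_sc _ _) hc) _.
  rewrite gtr0_norm ?invr_gt0 // mulrC ltr_pdivrMr //; lra.
exists ((Num.sqrt (c + e))%:S * d); split.
- by rewrite adjM adj_sc sd scC.
- rewrite -mulrA (mulrA d) -scC -!mulrA mulrA -rmorphM /= -expr2 sqr_sqrtr ?ltW //.
  rewrite dd mulrBr mulr1 /y mulrA -rmorphM divff ?gt_eqF // rmorph1 mul1r rmorphD /=.
  by ncring.
- move=> z zb; apply: commrM; first by rewrite /GRing.comm scC.
  apply: dz; apply: commrM; first by rewrite /GRing.comm scC.
  by apply: commrB => //; rewrite /GRing.comm scC.
Qed.

(** After scaling, |y| < 1 and d = (1 - y^2)^(1/2) satisfies d^2 + y^2 = 1. Hence |d| <= 1 by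
    [nm_sqD], and r^2 - h^2 = r^2 d^2. *)
Lemma pos_sq h : adj h = h -> pos (h * h).
Proof.
move=> sh; split; first by rewrite adjM sh.
pose r := nm h + 1; have r0 : 0 < r by have := nm_ge0 h; rewrite /r; lra.
pose y := (r^-1)%:S * h.
have sy : adj y = y by rewrite adjM sh adj_sc -scC.
have yy : y * y = (r^-1 ^+ 2)%:S * (h * h).
  by rewrite /y -mulrA (mulrA h) -scC expr2 rmorphM /=; ncring.
have y1 : nm y < 1.
  apply: le_lt_trans (nm_scM _ _) _.
  by rewrite gtr0_norm ?invr_gt0 // mulrC ltr_pdivrMr // mul1r /r; lra.
have [||d [sd dd dz]] := @sqrt_1B_sa (y * y).
- by rewrite adjM sy.
- by apply: le_lt_trans (nmM _ _) _; have := nm_ge0 y; nra.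
have d1 : nm d <= 1.
  apply: (@nm_sqD d y) => //.
  - by apply/commr_sym/dz; exact: commrM.
  - by rewrite dd subrK expr1n rmorph1.
exists (r ^+ 2); have -> : (r ^+ 2)%:S - h * h = (r ^+ 2)%:S * (d * d).
  rewrite dd mulrBr mulr1 yy (mulrA (r ^+ 2)%:S) -rmorphM /= -exprMn.
  rewrite divff ?gt_eqF // expr1n rmorph1.
  by rewrite mul1r.
apply: le_trans (nmM_le (nm_sc _ _) (nmM_le d1 d1)) _.
by rewrite gtr0_norm ?exprn_gt0 // !mulr1.
Qed.

(** Let x and y be commuting square roots of c + a + e and c - a + e. Then a^2 + (x y)^2 = (c +
    e)^2, and [nm_sqD] bounds a. *)
Lemma pos_bound a c : adj a = a -> 0 <= c -> pos (c%:S + a) -> pos (c%:S - a) -> nm a <= c.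
Proof.
move=> sa c0 pp pm; apply/ler_addgt0Pr => e e0.
have [x [sx xx xz]] := pos_sqrt pp e0; have [y [sy yy yz]] := pos_sqrt pm e0.
have cz z : GRing.comm z (c%:S : E) by rewrite /GRing.comm scC.
have ax : GRing.comm a x by apply: xz; apply: commrD.
have ay : GRing.comm a y by apply: yz; apply: commrB.
have xy : GRing.comm x y.
  by apply: yz; apply: commrB; [exact: cz | exact: commr_sym].
apply: (@nm_sqD a (x * y)) => //.
- by rewrite adjM sx sy -xy.
- exact: commrM.
- lra.
- have -> : x * y * (x * y) = (x * x) * (y * y).
    by rewrite -!mulrA (mulrA y x) -xy -!mulrA.
  rewrite xx yy.
  have -> : a * a + (c%:S + a + e%:S) * (c%:S - a + e%:S) =
    (c%:S + e%:S) * (c%:S + e%:S) + (a * c%:S - c%:S * a) + (a * e%:S - e%:S * a) by ncring.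
  by rewrite !scC !subrr !addr0 -rmorphD -rmorphM expr2.
Qed.

Lemma pos_mul_adjD (c : E) : pos (c * adj c + adj c * c).
Proof.
have -> : c * adj c + adj c * c = (2^-1)%:S *
    ((c + adj c) * (c + adj c) + (J * (c - adj c)) * (J * (c - adj c))).
  have -> : J * (c - adj c) * (J * (c - adj c)) = - ((c - adj c) * (c - adj c)).
    by rewrite {1}JC -mulrA (mulrA J J) JJ mulN1r mulrN.
  have -> : (c + adj c) * (c + adj c) + - ((c - adj c) * (c - adj c)) =
     (c * adj c + adj c * c) + (c * adj c + adj c * c) by ncring.
  by rewrite sc_half.
apply: posZ; rewrite ?invr_ge0 //; apply: posD; apply: pos_sq.
- by rewrite adjD adjK addrC.
- by rewrite adjM adjB adjK adjJ mulrN -JC -mulrN opprB.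
Qed.

Lemma pos_mul_adj_lt1 a : nm a < 1 -> nm (1 - a * adj a) <= 1.
Proof.
move=> a1; set t := a * adj a; pose k := 1 - adj a * a.
have [||d [sd dd dz]] := @sqrt_1B_sa (adj a * a).
- by rewrite adjM adjK.
- by rewrite nm_cstar; have := nm_ge0 a; nra.
rewrite -/k in dd.
have sk : adj k = k by rewrite adjB adj1 adjM adjK.
have st : adj (1 - t) = 1 - t by rewrite adjB adj1 adjM adjK.
have dk : GRing.comm d k by rewrite /GRing.comm -dd mulrA.
have dX j : d ^+ j * d ^+ j = k ^+ j by rewrite -dd exprMn_comm.
pose c j := a * d ^+ j.
have cc1 N : \sum_(j < N) adj (c j) * c j = 1 - k ^+ N.
  elim: N => [|N IH]; first by rewrite big_ord0 expr0 subrr.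
  rewrite big_ord_recr /= IH /c adjM adjX sd.
  have -> : d ^+ N * adj a * (a * d ^+ N) = (1 - k) * k ^+ N.
    have e : adj a * a = 1 - k by rewrite /k; ncring.
    rewrite -mulrA (mulrA (adj a)) e -dX mulrA [RHS]mulrA; congr (_ * _).
    by apply/commr_sym/commrX/commr_sym/commrB => //; exact: commr1.
  by rewrite exprS; ncring.
have ak j : a * k ^+ j = (1 - t) ^+ j * a.
  elim: j => [|j IH]; first by rewrite !expr0 mulr1 mul1r.
  by rewrite exprSr mulrA IH exprSr -!mulrA; congr (_ * _); rewrite /k /t; ncring.
have cc2 N : \sum_(j < N) c j * adj (c j) = 1 - (1 - t) ^+ N.
  elim: N => [|N IH]; first by rewrite big_ord0 expr0 subrr.
  rewrite big_ord_recr /= IH /c adjM adjX sd.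
  have -> : a * d ^+ N * (d ^+ N * adj a) = (1 - t) ^+ N * t.
    by rewrite -mulrA (mulrA (d ^+ N)) dX mulrA ak -mulrA.
  by rewrite exprSr; ncring.
have pX x l : adj x = x -> pos (x ^+ (2 ^ l.+1)).
  move=> sx; rewrite expnSr exprM expr2; apply: pos_sq.
  by rewrite adjX sx.
have hl l : nm (1 - t) ^+ (2 ^ l.+1) <= 2.
  set N := (2 ^ l.+1)%N.
  (* By [cc1] and [cc2] the sum equals 2 - (1 - t)^N - k^N; adding the even power k^N, which is
     positive, leaves 2 - (1 - t)^N. *)
  have h : pos (1%:S + (1 - (1 - t) ^+ N)).
    have -> : 1%:S + (1 - (1 - t) ^+ N) =
        \sum_(j < N) (c j * adj (c j) + adj (c j) * c j) + k ^+ N.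
      by rewrite big_split /= cc1 cc2 rmorph1; ncring.
    apply: posD; last exact: pX.
    by apply: (@pos_sum N (fun j => c j * adj (c j) + adj (c j) * c j)) => j; exact: pos_mul_adjD.
  have h' : pos (1%:S - (1 - (1 - t) ^+ N)).
    have -> : 1%:S - (1 - (1 - t) ^+ N) = (1 - t) ^+ N by rewrite rmorph1; ncring.
    exact: pX.
  have {h h'} := pos_bound _ ler01 h h'; rewrite adjB adj1 adjX st => /(_ erefl) h.
  rewrite -nm_pow2 //; have -> : (1 - t) ^+ N = 1 - (1 - (1 - t) ^+ N) by ncring.
  have := nmB 1 (1 - (1 - t) ^+ N); have := nm1 E; lra.
apply: (@le_of_pow2 _ _ _ 2) => [|//|l]; first exact: nm_ge0.
(* [hl] only covers even exponents; the exponent 1 follows from the square. *)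
rewrite expr1n mulr1; case: l => [|l]; last exact: hl.
by have := hl 0%N; rewrite expn0 expn1 expr1; have := nm_ge0 (1 - t); nra.
Qed.

Lemma pos_mul_adj a : pos (a * adj a).
Proof.
split; first by rewrite adjM adjK.
pose r := nm a + 1; have r0 : 0 < r by have := nm_ge0 a; rewrite /r; lra.
pose b := (r^-1)%:S * a.
have /pos_mul_adj_lt1 : nm b < 1.
  apply: le_lt_trans (nm_scM _ _) _.
  by rewrite gtr0_norm ?invr_gt0 // mulrC ltr_pdivrMr // mul1r /r; lra.
exists (r ^+ 2); have -> : (r ^+ 2)%:S - a * adj a = (r ^+ 2)%:S * (1 - b * adj b).
  rewrite mulrBr mulr1; congr (_ - _).
  rewrite sc_mul_adj (mulrA (r ^+ 2)%:S) -rmorphM /= expr2 mulrACA divff ?gt_eqF // mulr1 rmorph1.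
  by rewrite mul1r.
by apply: le_trans (nmM_le (nm_sc _ _) (_ : _ <= 1)) _; rewrite // gtr0_norm ?mulr1 // exprn_gt0.
Qed.

Lemma pos_psum (s : seq E) : pos (psum s).
Proof.
elim: s => [|w s IH]; rewrite /psum ?big_nil ?big_cons.
  by rewrite -(rmorph0 (@sc R E)); exact: pos_sc.
by apply: posD => //; exact: pos_mul_adj.
Qed.

(** From 0 <= S <= S + T <= c, the centred element S - c/2 lies between -c/2 and c/2, where
    [pos_bound] applies. *)
Lemma complete_nle_psum (s t : seq E) c : nle (psum s + psum t) c -> nle (psum s) c.
Proof.
move=> h; have c0 := nle_ge0 _ _ h; move/nmE: h => h; apply/nmE.
have [sa _] := pos_psum s.
have -> : psum s = (c / 2)%:S + (psum s - (c / 2)%:S) by ncring.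
have e : c / 2 + c / 2 = c by lra.
rewrite -[leRHS]e; apply: nmD_le.
  by apply: le_trans (nm_sc _ _) _; rewrite ger0_norm //; lra.
apply: pos_bound; [by rewrite adjB sa adj_sc | lra | |].
- have -> : (c / 2)%:S + (psum s - (c / 2)%:S) = psum s by ncring.
  exact: pos_psum.
- have -> : (c / 2)%:S - (psum s - (c / 2)%:S) = (c%:S - (psum s + psum t)) + psum t.
    by rewrite -{3}e rmorphD /=; ncring.
  apply: posD; last exact: pos_psum.
  split; first by rewrite adjB adj_sc adjD !adj_psum.
  by exists c; rewrite opprB addrC subrK.
Qed.

(** 1 + S = (c + 1)(1 - y) with |y| <= c/(c + 1) < 1. The Neumann series of 1 - y is obtained as the
    fixed point of x -> 1 + y x. *)
Lemma complete_psum_inv (s : seq E) : invertible (1 + psum s).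
Proof.
have [sa [c hc]] := pos_psum s.
have c0 : 0 <= c by exact: le_trans (nm_ge0 _) hc.
have c1 : 0 < c + 1 by lra.
pose y := ((c + 1)^-1)%:S * (c%:S - psum s); pose k := c / (c + 1).
have k01 : 0 <= k < 1.
  by apply/andP; split; [apply: divr_ge0; lra | rewrite /k ltr_pdivrMr //; lra].
have /andP[k0 k1] := k01.
have yk : nm y <= k.
  apply: le_trans (nmM_le (nm_sc _ _) hc) _.
  by rewrite gtr0_norm ?invr_gt0 // mulrC.
have k2 : 1 - k != 0 by rewrite subr_eq0 eq_sym lt_eqF.
have [||||w [_ hw wP]] := @contraction_fixpoint _ _ (fun x => 1 + y * x) (1 - k)^-1 k cE.
- by rewrite invr_ge0; lra.
- exact: k01.
- move=> x hx; apply: le_trans (nmD_le (nm1 E) (nmM_le yk hx)) _.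
  by have -> : 1 + k * (1 - k)^-1 = (1 - k)^-1 by field.
- move=> x z _ _; have -> : 1 + y * x - (1 + y * z) = y * (x - z) by ncring.
  exact: nmM_le.
have yw : GRing.comm y w.
  apply: (wP _ (@nclosed_comm _ _ y)); first exact: commr0.
  by move=> x yx; apply: commrD; [exact: commr1 | exact: commrM].
have Ty : 1 + psum s = (c + 1)%:S * (1 - y).
  rewrite mulrBr mulr1 /y mulrA -rmorphM divff ?gt_eqF // rmorph1 mul1r rmorphD rmorph1.
  by ncring.
have w1 : (1 - y) * w = 1 by rewrite mulrBl mul1r -{1}hw; ncring.
have w2 : w * (1 - y) = 1 by rewrite mulrBr mulr1 -yw -{1}hw; ncring.
exists (((c + 1)^-1)%:S * w); rewrite Ty; split.
- rewrite -mulrA (mulrA (1 - y)) -scC -[_ * _ * w]mulrA w1 mulr1 -rmorphM divff ?gt_eqF //.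
  by rewrite rmorph1.
- rewrite -mulrA (mulrA w) -scC -[_ * w * _]mulrA w2 mulr1 -rmorphM mulVf ?gt_eqF //.
  by rewrite rmorph1.
Qed.

End Positivity.

(** * Means with commuting operator weights *)

Section Averaging.
Variables (R : realType) (E : posStarType R) (g h : E).
Hypotheses (sg : adj g = g) (sh : adj h = h) (ghC : GRing.comm g h).
Hypothesis gh1 : g * g + h * h = 1.
Implicit Types (a b : E) (m : R).

Lemma nm_sq_le1 : nm (g * g) <= 1.
Proof.
have := nm_psum [:: g] [:: h]; rewrite /psum !big_seq1 sg sh gh1 => h1.
exact: le_trans h1 (nm1 E).
Qed.

(* y y^* + z z^* = g^2 a a^* + h^2 b b^* for y = g^2 a + h^2 b, z = g h (a - b). *)
Lemma nm_average_sq a b : GRing.comm g a -> GRing.comm h a ->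
  GRing.comm g b -> GRing.comm h b ->
  nm (g * g * a + h * h * b) ^+ 2 <= nm (g * g * (a * adj a) + h * h * (b * adj b)).
Proof.
move=> ga ha gb hb.
pose G := g * g; pose d := a - b; pose k := g * h.
have hE : h * h = 1 - G by rewrite -gh1 /G; ncring.
have gd : GRing.comm g d by exact: commrB.
have hd : GRing.comm h d by exact: commrB.
have cM (x y z : E) : GRing.comm x z -> GRing.comm y z -> GRing.comm (x * y) z.
  by move=> xz yz; apply/commr_sym/commrM; exact/commr_sym.
have Gb : GRing.comm G b by exact: cM.
have Gd : GRing.comm G d by exact: cM.
have kd : GRing.comm k d by exact: cM.
have sG : adj G = G by rewrite adjM sg.
have sk : adj k = k by rewrite adjM sg sh -ghC.
have kk : k * k = G * (1 - G) by rewrite -hE /k /G -!mulrA (mulrA h) -ghC -!mulrA.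
have yE : G * a + h * h * b = b + G * d by rewrite hE /d; ncring.
rewrite -/G yE -nm_cstar'; apply: le_trans (_ : nm (psum [:: b + G * d]) <= _).
  by rewrite /psum big_seq1.
apply: le_trans (nm_psum _ [:: k * d]) _.
rewrite le_eqVlt; apply/orP; left; apply/eqP; congr nm.
have sy : adj (b + G * d) = adj b + G * adj d.
  by rewrite adjD [adj (G * d)]adjM sG -(comm_adj sG Gd).
have sz : adj (k * d) = k * adj d by rewrite [adj (k * d)]adjM sk -(comm_adj sk kd).
rewrite /psum !big_seq1 sy sz hE.
have -> : (b + G * d) * (adj b + G * adj d) + k * d * (k * adj d) =
  b * adj b + G * d * adj b + b * (G * adj d) + G * (d * (G * adj d)) +
    k * (d * (k * adj d)) by ncring.
rewrite !(commr_mulCA _ Gb) !(commr_mulCA _ Gd) (commr_mulCA _ kd) (mulrA k) kk.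
have aE : a = d + b by rewrite /d subrK.
by clearbody d; rewrite aE adjD; ncring.
Qed.

(** The triangle inequality loses a factor 2. Passing k times from a, b to a a^*, b b^* by
    [nm_average_sq] gives the bound 2 m^(2^k) for the power 2^k, and the factor disappears in the
    roots. *)
Lemma nm_average a b m : GRing.comm g a -> GRing.comm h a ->
  GRing.comm g b -> GRing.comm h b -> nm a <= m -> nm b <= m ->
  nm (g * g * a + h * h * b) <= m.
Proof.
move=> ga ha gb hb am bm.
have m0 : 0 <= m by exact: le_trans (nm_ge0 _) am.
apply: (@le_of_pow2 _ _ _ 2) => // [|k]; first exact: nm_ge0.
elim: k a b m ga ha gb hb am bm m0 => [|k IH] a b m ga ha gb hb am bm m0.
  rewrite expn0 !expr1; have G1 := nm_sq_le1.
  have H1 : nm (h * h) <= 1.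
    have := nm_psum [:: h] [:: g]; rewrite /psum !big_seq1 sg sh addrC gh1 => h1.
    exact: le_trans h1 (nm1 E).
  by have := nmD_le (nmM_le G1 am) (nmM_le H1 bm); lra.
rewrite expnS !exprM; apply: le_trans (IH (a * adj a) (b * adj b) (m ^+ 2) _ _ _ _ _ _ _);
  try by [apply: commrM => //; exact: comm_adj | rewrite exprn_ge0
         | rewrite nm_cstar' lerXn2r ?nnegrE ?nm_ge0].
by rewrite lerXn2r ?nnegrE ?exprn_ge0 ?nm_ge0 // nm_average_sq.
Qed.

End Averaging.

(** * Truncation along the layers of the weight *)

Section PowerBounds.
Variables (R : realType) (E : normedStarType R).
Implicit Types (W Y : E).

(** 1 - W^p is 1 + W + ... + W^(p-1) times 1 - W, and the coefficients 1, 2, 4, ... add up to 2^p -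
    1. The induction needs this sharper constant. *)
Lemma nm_1BX_mul W Y p : nm W <= 2 ->
  nm ((1 - W ^+ p) * Y) <= 2 ^+ p * nm ((1 - W) * Y).
Proof.
move=> W2; elim: p => [|p IH].
  by rewrite expr0 subrr mul0r nm0 mulr_ge0 ?exprn_ge0 ?nm_ge0.
have h : nm ((1 - W ^+ p.+1) * Y) <= (2 ^+ p.+1 - 1) * nm ((1 - W) * Y).
  elim: p {IH} => [|p IH]; first by rewrite !expr1; have := nm_ge0 ((1 - W) * Y); lra.
  have -> : (1 - W ^+ p.+2) * Y = (1 - W) * Y + W * ((1 - W ^+ p.+1) * Y).
    by rewrite (exprS W p.+1); ncring.
  apply: le_trans (nmD_le (lexx _) (nmM_le W2 IH)) _.
  by rewrite (exprS 2 p.+1); lra.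
by apply: le_trans h _; rewrite ler_wpM2r ?nm_ge0 // gerBl.
Qed.

Lemma nm_mul_1BX W Y p : nm W <= 2 ->
  nm (Y * (1 - W ^+ p)) <= 2 ^+ p * nm (Y * (1 - W)).
Proof.
move=> W2; have := @nm_1BX_mul (adj W) (adj Y) p.
have sB U : 1 - adj U = adj (1 - U) by rewrite adjB adj1.
by rewrite nm_adj => /(_ W2); rewrite -adjX !sB -!adjM !nm_adj.
Qed.

End PowerBounds.

(* [io] is the inverse of a positive element rho that commutes with X, and X is
   to be made nilpotent of order q+1. The weight [wsum] = H, the sum of the
   rho^(-2Mk) X^k X^*k with M = 2(q+1), grows by a factor rho^(-2M) along X.
   [low A] and [high A] are smooth cut-offs to H <= rho^(-2A) and to
   H >= rho^(-2A); in [trunc], the i-th term maps H <= rho^(-4q(i+1)) to a higher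
   layer. [locked] only prevents unwanted conversions. *)
Section TruncationDef.
Variables (R : realType) (E : normedStarType R) (X io : E) (q : nat).

(** The exponent is M q + M with M = 2(q+1): where rho is r, a bound r^p on |X^(q+1)| absorbs
    rho^(-Mq) and still leaves r^M. *)
Definition tpow := (2 * q.+1 ^ 2)%N.
Definition wpow k : E := locked (io ^+ (2 * q.+1 * k) * X ^+ k).
Definition wsum : E := locked (psum [seq wpow k | k <- iota 0 q.+1]).
Definition wthr A : E := locked (io ^+ A * adj (io ^+ A) + wsum).
Definition low A : E := locked (io ^+ A * ninv (wthr A) * io ^+ A).
Definition high A : E := locked (wsum * ninv (wthr A)).
(** The thresholds are spaced by 2q, less than the growth M = 2q + 2 along X, so X reaches the next
    layer. Since M (q - 1) = 2 q^2 - 2 is below 2 q^2, there are enough of them with q layers. The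
    offset 1 separates [high] from [low] at the same layer, as [PQ_small] demands. The value 0
    beyond [q] lets the differences in [trunc] telescope. *)
Definition cutoff j : E := if (j <= q)%N then high (2 * q * j).+1 ^+ tpow else 0.
Definition trunc : E :=
  \sum_(i < q) (cutoff i.+1 - cutoff i.+2) * X * low (2 * q * i.+1) ^+ tpow.

Lemma wpowE k : wpow k = io ^+ (2 * q.+1 * k) * X ^+ k.
Proof. exact/esym/lock. Qed.
Lemma wsum_psum : wsum = psum [seq wpow k | k <- iota 0 q.+1].
Proof. exact/esym/lock. Qed.
Lemma wsumE : wsum = \sum_(k < q.+1) wpow k * adj (wpow k).
Proof.
rewrite wsum_psum /psum big_map.
by rewrite -(big_mkord xpredT (fun k => wpow k * adj (wpow k))) /index_iota subn0.
Qed.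
Lemma wsum1D : wsum = 1 + psum [seq wpow k | k <- iota 1 q].
Proof.
by rewrite wsum_psum /psum /= big_cons {1 2}wpowE muln0 !expr0 mul1r adj1 mulr1.
Qed.
Lemma wthrE A : wthr A = io ^+ A * adj (io ^+ A) + wsum.
Proof. exact/esym/lock. Qed.
Lemma lowE A : low A = io ^+ A * ninv (wthr A) * io ^+ A.
Proof. exact/esym/lock. Qed.
Lemma highE A : high A = wsum * ninv (wthr A).
Proof. exact/esym/lock. Qed.

End TruncationDef.

(** The term k = 0 of the weight is 1, so the threshold element has the form 1 + [psum]. *)
Lemma wthr_inv (R : realType) (E : posStarType R) (X io : E) q A :
  invertible (wthr X io q A).
Proof.
rewrite wthrE wsum1D addrCA.
have := @psum_inv R E (io ^+ A :: [seq wpow X io q k | k <- iota 1 q]).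
by rewrite {1}/psum big_cons.
Qed.

Section Truncation.
Variables (R : realType) (E : posStarType R) (X rho io : E) (q : nat) (r : R).
Hypotheses (q0 : (0 < q)%N) (r01 : 0 <= r <= 1) (X2 : nm X <= 2).
Hypotheses (srho : adj rho = rho) (rhor : nm rho <= r).
Hypotheses (ri : rho * io = 1) (ir : io * rho = 1) (rX : GRing.comm rho X).
Hypothesis Xn : nm (io ^+ (2 * q.+1 * q) * X ^+ q.+1) <= r.

Local Notation M := (2 * q.+1)%N.
Local Notation p := (tpow q).
Local Notation Z := (wpow X io q).
Local Notation H := (wsum X io q).
Local Notation T := (wthr X io q).
Local Notation P := (low X io q).
Local Notation Q := (high X io q).
Local Notation V A := (ninv (wthr X io q A)).
Local Notation D := (cutoff X io q).
Local Notation cm := GRing.comm.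

Let r0 : 0 <= r. Proof. by case/andP: r01. Qed.
Let r1 : r <= 1. Proof. by case/andP: r01. Qed.

Let sio : adj io = io. Proof. exact: adj_inv srho ri ir. Qed.
Let rio : cm rho io. Proof. by rewrite /cm ri ir. Qed.
Let iX : cm io X. Proof. exact/commr_sym/(comm_inv ri ir)/commr_sym. Qed.
Let siA A : adj (io ^+ A) = io ^+ A. Proof. by rewrite adjX sio. Qed.

Let TV A : T A * V A = 1 /\ V A * T A = 1.
Proof. exact/ninvP/wthr_inv. Qed.

Let TE A : T A = psum (io ^+ A :: [seq Z k | k <- iota 0 q.+1]).
Proof.
by rewrite wthrE wsum_psum [RHS]big_cons.
Qed.

(** Both io^A and Z k are among the elements whose [psum] is T A, so [psum_kernel] applies. *)
Let kernel_iZ A k : (k <= q)%N -> nm (io ^+ A * V A * Z k) <= 1.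
Proof.
move=> kq; have [h1 h2] := TV A; rewrite -{1}siA.
apply: (psum_kernel (s := io ^+ A :: [seq Z k | k <- iota 0 q.+1])); rewrite -?TE //.
  exact: mem_head.
by rewrite inE map_f ?orbT // mem_iota.
Qed.

Let adjV A : adj (V A) = V A.
Proof. by have [h1 h2] := TV A; apply: adj_inv h1 h2; rewrite TE adj_psum. Qed.

Let kernel_Zi A k : (k <= q)%N -> nm (adj (Z k) * V A * io ^+ A) <= 1.
Proof.
move=> kq; rewrite -nm_adj (adjM (_ * _)) (adjM (adj _)) adjK adjV siA mulrA.
exact: kernel_iZ.
Qed.

Let nmP A : nm (P A) <= 1.
Proof.
have [h1 h2] := TV A; rewrite lowE -{1}siA.
by apply: (psum_kernel (s := io ^+ A :: [seq Z k | k <- iota 0 q.+1]));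
  rewrite -?TE // mem_head.
Qed.

Let cZ u k : adj u = u -> cm u X -> cm u io -> cm u (Z k).
Proof. by move=> su uX ui; rewrite wpowE; apply: commrM; exact: commrX. Qed.

Let cH u : adj u = u -> cm u X -> cm u io -> cm u H.
Proof.
move=> su uX ui; rewrite wsumE; apply: commr_sum => k _.
by apply: commrM; [|apply: comm_adj => //]; exact: cZ.
Qed.

Let cT u A : adj u = u -> cm u X -> cm u io -> cm u (T A).
Proof.
move=> su uX ui; rewrite wthrE; apply: commrD; last exact: cH.
by rewrite siA; apply: commrM; exact: commrX.
Qed.

Let cV u A : adj u = u -> cm u X -> cm u io -> cm u (V A).
Proof. by move=> su uX ui; have [h1 h2] := TV A; apply: (comm_inv h1 h2); exact: cT. Qed.

Let rA A : adj (rho ^+ A) = rho ^+ A. Proof. by rewrite adjX srho. Qed.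
Let cmX (u v : E) A : cm u v -> cm (u ^+ A) v.
Proof. by move=> uv; apply/commr_sym/commrX/commr_sym. Qed.
Let crV u A : cm (rho ^+ u) (V A). Proof. by apply: cV; rewrite ?rA //; exact: cmX. Qed.
Let ciV u A : cm (io ^+ u) (V A). Proof. by apply: cV; rewrite ?siA //; exact: cmX. Qed.
Let crZ u k : cm (rho ^+ u) (Z k). Proof. by apply: cZ; rewrite ?rA //; exact: cmX. Qed.
Let crX u : cm (rho ^+ u) X. Proof. exact: cmX. Qed.
Let ciX u : cm (io ^+ u) X. Proof. exact: cmX. Qed.
Let cri u v : cm (rho ^+ u) (io ^+ v). Proof. by apply/cmX/commrX. Qed.
Let ciH u : cm (io ^+ u) H. Proof. by apply: cH; rewrite ?siA //; exact: cmX. Qed.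

Let pow_ri a b : (a <= b)%N -> rho ^+ b * io ^+ a = rho ^+ (b - a).
Proof.
move=> ab; rewrite -{1}(subnK ab) exprD -mulrA -exprMn_comm // ri expr1n mulr1 //.
Qed.

Let nm_rho a : nm (rho ^+ a) <= 1.
Proof. by apply: le_trans (nmX_le a rhor) _; rewrite exprn_ile1. Qed.

Let nm_rhoS a : (0 < a)%N -> nm (rho ^+ a) <= r.
Proof.
case: a => // a _; rewrite exprS; apply: le_trans (nmM_le rhor (nm_rho a)) _.
by rewrite mulr1.
Qed.

Let PQ A : P A + Q A = 1.
Proof.
have [h1 h2] := TV A.
by rewrite lowE -mulrA -ciV mulrA -{2}siA highE -mulrDl -wthrE.
Qed.

Let PE A : 1 - Q A = P A. Proof. by rewrite -(PQ A) addrK. Qed.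
Let QE A : 1 - P A = Q A. Proof. by rewrite -(PQ A) addrAC subrr add0r. Qed.

Let nmQ A : nm (Q A) <= 2.
Proof. by rewrite -QE; apply: le_trans (nmB_le (nm1 E) (nmP A)) _; lra. Qed.

Let cHV A : cm H (V A).
Proof.
have [h1 h2] := TV A; apply: (comm_inv h1 h2).
by rewrite wthrE; apply: commrD => //; rewrite siA; apply: commrM; apply/commr_sym/ciH.
Qed.

Let cVV A B : cm (V A) (V B).
Proof.
have [h1 h2] := TV B; apply: (comm_inv h1 h2).
rewrite (wthrE _ _ _ B); apply: commrD; last exact/commr_sym/cHV.
have h : cm (V A) (io ^+ B) by exact: commr_sym (ciV _ _).
by rewrite siA; exact: commrM.
Qed.

Let cPQ A B : cm (P A) (Q B).
Proof.
have h u : cm u H -> cm u (V B) -> cm u (Q B) by move=> *; rewrite highE; exact: commrM.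
have hi : cm (io ^+ A) (Q B) by apply: h.
have hV : cm (V A) (Q B) by apply: h => //; exact/commr_sym.
by rewrite lowE; apply/commr_sym/commrM; [apply: commrM|]; exact/commr_sym.
Qed.

Let crH u : cm (rho ^+ u) H. Proof. by apply: cH; rewrite ?rA //; exact: cmX. Qed.
Let crQ u A : cm (rho ^+ u) (Q A). Proof. by rewrite highE; exact: commrM. Qed.
Let lowE' A : P A = io ^+ A * io ^+ A * V A.
Proof. by rewrite lowE -mulrA -ciV mulrA. Qed.

Let ri1 A : rho ^+ A * io ^+ A = 1.
Proof. by rewrite pow_ri // subnn. Qed.

(** Exchanging the thresholds produces the factor rho^(2(B - A)). Both of its halves have norm at
    most r; this is the quadratic gain. *)
Let PQ_small A B : (A < B)%N -> nm (P A * Q B) <= 2 * r ^+ 2.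
Proof.
move=> AB; have -> : P A * Q B = rho ^+ (B - A) * rho ^+ (B - A) * (Q A * P B).
  have -> : P A * Q B = io ^+ A * io ^+ A * (Q A * V B).
    by rewrite lowE' !highE -!mulrA (mulrA (V A)) -(cHV A) -!mulrA.
  have -> : V B = rho ^+ B * rho ^+ B * P B.
    by rewrite lowE' !mulrA -(mulrA (rho ^+ B)) ri1 mulr1 ri1 mul1r.
  rewrite -(pow_ri (ltnW AB)).
  rewrite -!mulrA (mulrA (Q A)) -(crQ B A) -!mulrA (mulrA (Q A)) -(crQ B A) -!mulrA.
  by do 3!rewrite ?(mulrA (io ^+ A) (rho ^+ B)) -?(cri B A) -?mulrA.
apply: le_trans (nmM_le (nmM_le (nm_rhoS _) (nm_rhoS _)) (nmM_le (nmQ A) (nmP B))) _;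
  rewrite ?subn_gt0 //; lra.
Qed.

(** This identity is the growth of the weight along X. *)
Let XZ k : X * Z k = rho ^+ M * Z k.+1.
Proof.
rewrite !wpowE (mulnS M k) exprD -!mulrA (mulrA (rho ^+ M)) ri1 mul1r.
by rewrite mulrA -ciX -mulrA -exprS.
Qed.

Let highE' A : Q A = \sum_(k < q.+1) Z k * (adj (Z k) * V A * io ^+ A) * rho ^+ A.
Proof.
rewrite highE wsumE mulr_suml.
apply: eq_bigr => k _.
by rewrite -!mulrA -cri ri1 mulr1.
Qed.

Let nm_highE A (W : E) (c : R) :
  (forall k, (k <= q)%N -> nm (W * Z k * (adj (Z k) * V A * io ^+ A) * rho ^+ A) <= c) ->
  nm (W * Q A) <= q.+1%:R * c.
Proof.
move=> h; rewrite highE' mulr_sumr.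
apply: (@nm_sum_le _ _ q.+1 (fun k => W * (Z k * (adj (Z k) * V A * io ^+ A) * rho ^+ A))).
by move=> k kq; rewrite !mulrA -4!mulrA; move: (h k kq); rewrite -!mulrA.
Qed.

Let low_mul A N (Y : E) : (A <= N)%N ->
  P A * (rho ^+ N * Y) = rho ^+ (N - A) * (io ^+ A * V A * Y).
Proof.
move=> AN; rewrite -(pow_ri AN) lowE -!mulrA.
rewrite (commr_mulCA _ (ciV A A)).
by rewrite !(commr_mulCA _ (crV N A)) !(commr_mulCA _ (cri N A)).
Qed.

Let kernelE A k : Z k * (adj (Z k) * V A * io ^+ A) * rho ^+ A =
  rho ^+ A * (Z k * (adj (Z k) * V A * io ^+ A)).
Proof.
have h : cm (rho ^+ A) (adj (Z k)) by apply: comm_adj.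
by rewrite -!mulrA -cri (commr_mulCA _ (crV A A)) (commr_mulCA _ h) (commr_mulCA _ (crZ A k)).
Qed.

(** X carries the region H >= rho^(-2B) into H >= rho^(-2(B+M)), away from H <= rho^(-2A). Expanding
    [Q B] over k, the terms k < q gain rho^(B+M-A) from [XZ]; the term k = q is small by [Xn]. *)
Let middle A B : (A < B + M)%N -> nm (P A * X * Q B) <= q.+1%:R * r.
Proof.
move=> AB; apply: nm_highE => k; rewrite leq_eqVlt => /orP[/eqP ->|kq].
  have -> : P A * X * Z q = P A * (io ^+ (M * q) * X ^+ q.+1).
    by rewrite wpowE -mulrA (mulrA X) -ciX -!mulrA -exprS.
  apply: le_trans (nmM_le (nmM_le (nmM_le (nmP A) Xn) (kernel_Zi B (leqnn q))) (nm_rho B)) _.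
  by rewrite !mulr1 mul1r.
have -> : P A * X * Z k * (adj (Z k) * V B * io ^+ B) * rho ^+ B =
    rho ^+ (B + M - A) * ((io ^+ A * V A * Z k.+1) * (adj (Z k) * V B * io ^+ B)).
  have h : cm (rho ^+ B) (adj (Z k)) by apply: comm_adj.
  rewrite -!mulrA (mulrA X) XZ -mulrA -cri (commr_mulCA _ (crV B B)) (commr_mulCA _ h).
  rewrite (commr_mulCA _ (crZ B k.+1)) (mulrA (rho ^+ M)) -exprD addnC low_mul 1?ltnW //.
  by rewrite -!mulrA.
apply: le_trans (nmM_le (nm_rhoS _) (nmM_le (kernel_iZ _ kq) (kernel_Zi _ (ltnW kq)))) _.
  by rewrite subn_gt0.
by rewrite !mulr1.
Qed.

(** X = X Z_0 = rho^M Z_1, and M = 2q + 2 exceeds the first threshold 2q + 1 by one. *)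
Let bottom : nm (P (2 * q).+1 * X) <= r.
Proof.
have Z0 : Z 0 = 1 by rewrite wpowE muln0 !expr0 mul1r.
have -> : P (2 * q).+1 * X = rho ^+ (M - (2 * q).+1) * (io ^+ (2 * q).+1 * V (2 * q).+1 * Z 1).
  by rewrite -low_mul; [rewrite -XZ Z0 mulr1 | lia].
apply: le_trans (nmM_le (nm_rhoS _) (kernel_iZ _ q0)) _; first lia.
by rewrite mulr1.
Qed.

(** The terms k < q of the weight are at most of order rho^(-2Mk) with M k < 2 q^2, too small for
    this threshold; X nearly annihilates the term k = q by [Xn]. *)
Let top : nm (X * Q (2 * q * q)) <= q.+1%:R * (2 ^+ q.+1 * r).
Proof.
apply: nm_highE => k; rewrite leq_eqVlt => /orP[/eqP ->|kq].
  have -> : X * Z q = io ^+ (M * q) * X ^+ q.+1.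
    by rewrite wpowE (mulrA X) -ciX -!mulrA -exprS.
  apply: le_trans (nmM_le (nmM_le Xn (kernel_Zi _ (leqnn q))) (nm_rho _)) _.
  by rewrite !mulr1 ler_peMl // exprn_ege1 // ler1n.
set B := (2 * q * q)%N; have kB : (M * k < B)%N by rewrite /B; nia.
have -> : X * Z k * (adj (Z k) * V B * io ^+ B) * rho ^+ B =
    rho ^+ (B - M * k) * (X ^+ k.+1 * (adj (Z k) * V B * io ^+ B)).
  rewrite -!(mulrA X) kernelE (commr_mulCA _ (crX B)); set c := adj _ * _ * _.
  rewrite wpowE -(mulrA _ (X ^+ k)) (commr_mulCA _ (ciX _)) mulrA (pow_ri (ltnW kB)).
  by rewrite (exprS X) !mulrA.
apply: le_trans (nmM_le (nm_rhoS _) (nmM_le (nmX_le _ X2) (kernel_Zi _ (ltnW kq)))) _.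
  by rewrite subn_gt0.
rewrite mulr1 mulrC; apply: ler_wpM2r => //.
by apply: ler_weXn2l; rewrite ?ler1n // ltnS ltnW.
Qed.

Definition trunc_dist : R := 2 ^+ p + q%:R * (2 ^+ p * (2 ^+ p * (q.+1%:R * 2 ^+ q.+1) *+ 2)).

Let nm_cut j (Y : E) : (j <= q)%N -> nm ((1 - D j) * Y) <= 2 ^+ p * nm (P (2 * q * j).+1 * Y).
Proof. by move=> jq; rewrite /cutoff jq -PE; exact: nm_1BX_mul. Qed.

Let Dq1 j : (q < j)%N -> D j = 0.
Proof. by rewrite ltnNge => /negbTE jq; rewrite /cutoff jq. Qed.

Let trunc_sum : \sum_(i < q) (D i.+1 - D i.+2) = D 1.
Proof.
suff h k : \sum_(i < k) (D i.+1 - D i.+2) = D 1 - D k.+1 by rewrite h (Dq1 (leqnn _)) subr0.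
by elim: k => [|k IH]; [rewrite big_ord0 subrr | rewrite big_ord_recr /= IH; ncring].
Qed.

Lemma nm_trunc_dist : nm (X - trunc X io q) <= trunc_dist * r.
Proof.
(* The differences of the [D] add up to [D 1]. The error is the part of X below the first layer and,
   for each layer, what its right-hand cut-off removes. *)
have -> : X - trunc X io q = (1 - D 1) * X +
    \sum_(i < q) (D i.+1 - D i.+2) * X * (1 - P (2 * q * i.+1) ^+ p).
  rewrite /trunc; under [in RHS]eq_bigr => i _ do rewrite mulrBr mulr1.
  by rewrite sumrB -mulr_suml trunc_sum; ncring.
rewrite /trunc_dist [leRHS]mulrDl; apply: nmD_le.
  apply: le_trans (nm_cut _ _) _ => //; rewrite ler_wpM2l ?exprn_ge0 // muln1.
  exact: bottom.
rewrite -[leRHS]mulrA; apply: (@nm_sum_le _ _ q (fun i =>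
  (D i.+1 - D i.+2) * X * (1 - P (2 * q * i.+1) ^+ p))).
move=> i iq; have P2 A : nm (P A) <= 2 by apply: le_trans (nmP A) _; lra.
apply: le_trans (nm_mul_1BX _ _ (P2 _)) _.
rewrite -[leRHS]mulrA ler_wpM2l ?exprn_ge0 // QE.
have c0 : 0 <= q.+1%:R * r by rewrite mulr_ge0.
have e1 : 1 <= 2 ^+ q.+1 :> R by rewrite exprn_ege1 // ler1n.
(* The last layer has no upper cut-off, because [D q.+1] is 0; [top] handles it. *)
move: iq; rewrite leq_eqVlt => /orP[/eqP iq|iq].
  have qi : (i.+1 <= q)%N by rewrite iq.
  rewrite (Dq1 (_ : q < i.+2)%N) ?iq ?ltnS // subr0 -(mulrA _ X).
  have -> : D q = Q (2 * q * q).+1 ^+ p by rewrite /cutoff leqnn.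
  apply: le_trans (nmM_le (nmX_le p (nmQ (2 * q * q).+1)) top) _.
  rewrite -mulrnAr -[leRHS]mulrA ler_wpM2l ?exprn_ge0 // mulr2n.
  have x0 : 0 <= q.+1%:R * 2 ^+ q.+1 :> R by rewrite mulr_ge0 ?exprn_ge0.
  by rewrite mulrDl mulrA lerDl mulr_ge0.
(* In terms of the complements 1 - D, [nm_cut] reduces each part to a product P X Q as in
   [middle]. *)
have -> : D i.+1 - D i.+2 = (1 - D i.+2) - (1 - D i.+1) by ncring.
rewrite -(mulrA _ X) mulrBl.
have h1 j : (i <= j)%N -> (j.+1 <= i.+2)%N -> (j.+1 <= q)%N ->
    nm ((1 - D j.+1) * (X * Q (2 * q * i.+1))) <= 2 ^+ p * (q.+1%:R * 2 ^+ q.+1 * r).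
  move=> ij ji jq; apply: le_trans (nm_cut _ jq) _; rewrite ler_wpM2l ?exprn_ge0 //.
  rewrite mulrA; apply: le_trans (middle _) _.
    have : (2 * q * j.+1 <= 2 * q * i.+2)%N by rewrite leq_mul2l ji orbT.
    by clear; rewrite !mulnS; lia.
  by rewrite -mulrA [2 ^+ _ * r]mulrC mulrA ler_peMr.
apply: le_trans (nmB_le (h1 i.+1 _ _ _) (h1 i _ _ _)) _ => //; first exact: ltnW.
by move: (2 ^+ p) (2 ^+ q.+1) (q.+1%:R) => a b c; lra.
Qed.

Local Notation N := (q%:R * (2 ^+ p * 4) : R).
Local Notation F := (trunc X io q).
Let g : R := (2 * r ^+ 2) ^+ p.
Let g0 : 0 <= g. Proof. by rewrite exprn_ge0 // mulr_ge0 // exprn_ge0. Qed.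

Let nmPX A : nm (P A ^+ p) <= 1.
Proof. by rewrite -(expr1n _ p); exact/nmX_le/nmP. Qed.

Let nmD j : nm (D j) <= 2 ^+ p.
Proof.
rewrite /cutoff; case: ifP => _; first exact/nmX_le/nmQ.
by rewrite nm0 exprn_ge0.
Qed.

Let PD_small k j : (k <= j)%N -> nm (P (2 * q * k) ^+ p * D j) <= g.
Proof.
move=> kj; case: (leqP j q) => [jq|/Dq1 ->]; last by rewrite mulr0 nm0.
rewrite /cutoff jq -exprMn_comm //; apply/nmX_le/PQ_small.
by rewrite ltnS leq_mul2l kj orbT.
Qed.

Let Dstep j : nm (D j - D j.+1) <= 2 ^+ p * 2.
Proof. by apply: le_trans (nmB_le (nmD _) (nmD _)) _; lra. Qed.

(** Almost strict triangularity: F lifts [y] by one layer. The j-th term is small by the hypothesis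
    on [y] if j + 1 <= i; otherwise k <= j + 1, and the cut-offs on its left are almost orthogonal
    to P(2qk). *)
Let trunc_step i (y : E) (e B : R) : 0 <= e -> nm y <= B ->
  (forall k, (0 < k <= i)%N -> nm (P (2 * q * k) ^+ p * y) <= e) ->
  forall k, (0 < k <= i.+1)%N -> nm (P (2 * q * k) ^+ p * (F * y)) <= N * (e + g * B).
Proof.
move=> e0 yB h k /andP[k0 ki]; rewrite /trunc mulr_suml mulr_sumr -mulrA.
have B0 : 0 <= B by exact: le_trans (nm_ge0 _) yB.
have gB : 0 <= g * B by exact: mulr_ge0.
have p1 : 1 <= 2 ^+ p :> R by rewrite exprn_ege1 // ler1n.
apply: (@nm_sum_le _ _ q (fun j => P (2 * q * k) ^+ p *
  ((D j.+1 - D j.+2) * X * P (2 * q * j.+1) ^+ p * y))) => j jq.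
have [ji|ij] := leqP j.+1 i.
  rewrite -(mulrA _ _ y).
  apply: le_trans (nmM_le (nmPX _) (nmM_le (nmM_le (Dstep _) X2) (h _ _))) _; first by [].
  by move: (2 ^+ p) p1 => a a1; nra.
have -> : P (2 * q * k) ^+ p * ((D j.+1 - D j.+2) * X * P (2 * q * j.+1) ^+ p * y) =
  (P (2 * q * k) ^+ p * D j.+1 - P (2 * q * k) ^+ p * D j.+2) * X * P (2 * q * j.+1) ^+ p * y.
  by rewrite -mulrBr !mulrA.
have kj : (k <= j.+1)%N by exact: leq_trans ki ij.
have Pd := nmB_le (PD_small kj) (PD_small (leqW kj)).
apply: le_trans (nmM_le (nmM_le (nmM_le Pd X2) (nmPX _)) yB) _.
by move: (2 ^+ p) p1 => a a1; nra.
Qed.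

Let nm_trunc : nm F <= N.
Proof.
rewrite /trunc; apply: (@nm_sum_le _ _ q (fun j => (D j.+1 - D j.+2) * X * P (2 * q * j.+1) ^+ p)).
move=> j _; apply: le_trans (nmM_le (nmM_le (Dstep _) X2) (nmPX _)) _.
by move: (2 ^+ p) => a; lra.
Qed.

(** After q steps F^q is small below all q layers, and every term of F has one of these [low]
    cut-offs on its right. *)
Lemma nm_trunc_nilp : nm (F ^+ q.+1) <= q.+1%:R * N ^+ q.+1 * (2 * r ^+ 2) ^+ p.
Proof.
have N0 : 0 <= N by rewrite !mulr_ge0 ?exprn_ge0.
have h i k : (0 < k <= i)%N -> nm (P (2 * q * k) ^+ p * F ^+ i) <= i%:R * N ^+ i * g.
  elim: i k => [|i IH] k; first by case: k.
  move=> ki; rewrite exprS; apply: le_trans (trunc_step _ (nmX_le i nm_trunc) IH ki) _.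
    by apply: mulr_ge0 => //; apply: mulr_ge0 => //; exact: exprn_ge0.
  by rewrite (exprS _ i) -(natr1 i); move: (N ^+ i) => a; lra.
rewrite exprS {1}/trunc mulr_suml.
apply: le_trans (_ : q%:R * (2 ^+ p * 4 * (q%:R * N ^+ q * g)) <= _).
  apply: (@nm_sum_le _ _ q (fun j =>
    (D j.+1 - D j.+2) * X * P (2 * q * j.+1) ^+ p * F ^+ q)) => j jq.
  rewrite -(mulrA _ _ (F ^+ q)).
  apply: le_trans (nmM_le (nmM_le (Dstep _) X2) (h q j.+1 jq)) _.
  by move: (2 ^+ p) (N ^+ q) => a b; lra.
rewrite (exprS _ q) -(natr1 q) -/g.
have : 0 <= N * N ^+ q * g.
  by apply: mulr_ge0 => //; apply: mulr_ge0 => //; exact: exprn_ge0.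
by move: (2 ^+ p) (N ^+ q) => a b; lra.
Qed.

End Truncation.

(* Bounded sequences modulo null sequences. An approximate unit which commutes
   asymptotically with an element X becomes an element that commutes with X. *)
Section Asymptotic.
Variables (R : realType) (E : normedStarType R).
Implicit Types (u v w : nat -> E) (c d e : R).

Definition bdd u := exists c, forall k, nm (u k) <= c.
Definition null u :=
  forall e, 0 < e -> exists N, forall k, (N <= k)%N -> nm (u k) <= e.

Lemma bdd_cst (x : E) : bdd (fun=> x). Proof. by exists (nm x). Qed.
Lemma bddD u v : bdd u -> bdd v -> bdd (fun k => u k + v k).
Proof. by move=> [c hc] [d hd]; exists (c + d) => k; exact: nmD_le. Qed.
Lemma bddM u v : bdd u -> bdd v -> bdd (fun k => u k * v k).
Proof. by move=> [c hc] [d hd]; exists (c * d) => k; exact: nmM_le. Qed.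
Lemma bddN u : bdd u -> bdd (fun k => - u k).
Proof. by move=> [c hc]; exists c => k; rewrite nmN. Qed.
Lemma bdd_adj u : bdd u -> bdd (fun k => adj (u k)).
Proof. by move=> [c hc]; exists c => k; rewrite nm_adj. Qed.

Lemma null0 : null (fun=> 0).
Proof. by move=> e e0; exists 0%N => k _; rewrite nm0 ltW. Qed.
Lemma nullD u v : null u -> null v -> null (fun k => u k + v k).
Proof.
move=> hu hv e e0; have [|N hN] := hu (e / 2); first lra.
have [|N' hN'] := hv (e / 2); first lra.
exists (maxn N N') => k; rewrite geq_max => /andP[/hN h1 /hN' h2].
by apply: le_trans (nmD_le h1 h2) _; lra.
Qed.
Lemma nullN u : null u -> null (fun k => - u k).
Proof. by move=> hu e /hu[N hN]; exists N => k; rewrite nmN; exact: hN. Qed.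
Lemma null_adj u : null u -> null (fun k => adj (u k)).
Proof. by move=> hu e /hu[N hN]; exists N => k; rewrite nm_adj; exact: hN. Qed.
Lemma nullMl u v : bdd u -> null v -> null (fun k => u k * v k).
Proof.
move=> [c hc] hv e e0; have c0 : 0 <= c by exact: le_trans (nm_ge0 _) (hc 0%N).
have c1 : 0 < c + 1 by lra.
have [|N hN] := hv (e / (c + 1)); first exact: divr_gt0.
exists N => k /hN h; apply: le_trans (nmM_le (hc k) h) _.
rewrite mulrC -mulrA ger_pMr // mulrC ler_pdivrMr //; lra.
Qed.
Lemma nullMr u v : null u -> bdd v -> null (fun k => u k * v k).
Proof.
move=> hu hv e /(nullMl (bdd_adj hv) (null_adj hu))[N hN].
by exists N => k /hN; rewrite -adjM nm_adj.
Qed.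
Lemma eq_null u v : u =1 v -> null u -> null v.
Proof. by move=> uv hu e /hu[N hN]; exists N => k; rewrite -uv; exact: hN. Qed.

(** A representative that depends only on the class, by [canon_eq]. Classes are encoded as the
    sequences fixed by [canon], so equality of classes is Leibniz equality. *)
Definition canon u : nat -> E :=
  xget (fun=> 0) [set v | bdd v /\ null (fun k => u k - v k)]%classic.

Lemma canonP u : bdd u -> bdd (canon u) /\ null (fun k => u k - canon u k).
Proof.
move=> bu; apply: (@xgetPex _ (fun=> 0) [set v | bdd v /\ null (fun k => u k - v k)]%classic).
by exists u; split=> //; apply: eq_null null0 => k; rewrite subrr.
Qed.

Lemma canon_eq u v : null (fun k => u k - v k) -> canon u = canon v.
Proof.
move=> h; rewrite /canon; congr xget; apply/funext => w; apply/propext; split=> -[bw nw];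
  split=> //.
- by apply: eq_null (nullD nw (nullN h)) => k; ncring.
- by apply: eq_null (nullD nw h) => k; ncring.
Qed.

Record asym := Asym {
  arep : nat -> E;
  arep_bdd : bdd arep;
  arep_canon : canon arep = arep
}.

HB.instance Definition _ := gen_eqMixin asym.
HB.instance Definition _ := gen_choiceMixin asym.

Lemma asym_eq (U V : asym) : arep U = arep V -> U = V.
Proof.
case: U V => [u bu cu] [v bv cv] /= uv; case: _ / uv bv cv => bv cv.
by congr Asym; exact: Prop_irrelevance.
Qed.

Fact canon_id u : bdd u -> canon (canon u) = canon u.
Proof.
move=> bu; have [h1 h2] := canonP bu; apply: canon_eq.
by apply: eq_null (nullN h2) => k; ncring.
Qed.

Fact bdd0 : bdd (fun=> 0). Proof. exact: bdd_cst. Qed.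

Definition api u : asym :=
  match pselect (bdd u) with
  | left bu => Asym (proj1 (canonP bu)) (canon_id bu)
  | right _ => Asym (proj1 (canonP bdd0)) (canon_id bdd0)
  end.

Lemma arep_api u : bdd u -> arep (api u) = canon u.
Proof. by rewrite /api; case: pselect. Qed.

Lemma api_arep U : api (arep U) = U.
Proof. by apply: asym_eq; rewrite arep_api; [exact: arep_canon | exact: arep_bdd]. Qed.

Lemma api_null u : bdd u -> null (fun k => u k - arep (api u) k).
Proof. by move=> bu; rewrite arep_api //; have [] := canonP bu. Qed.

Lemma api_eq u v : bdd u -> bdd v -> (api u = api v <-> null (fun k => u k - v k)).
Proof.
move=> bu bv; split=> [uv|h].
  have := api_null bu; rewrite uv => h; apply: eq_null (nullD h (nullN (api_null bv))).
  by move=> k; ncring.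
by apply: asym_eq; rewrite !arep_api //; exact: canon_eq.
Qed.

Lemma asymP (P : asym -> Prop) : (forall u, bdd u -> P (api u)) -> forall U, P U.
Proof. by move=> h U; rewrite -(api_arep U); apply: h; exact: arep_bdd. Qed.

Definition aadd U V := api (fun k => arep U k + arep V k).
Definition amul U V := api (fun k => arep U k * arep V k).
Definition aopp U := api (fun k => - arep U k).
Definition aadj U := api (fun k => adj (arep U k)).
Definition acst (x : E) := api (fun=> x).

Lemma api_add u v : bdd u -> bdd v -> api (fun k => u k + v k) = aadd (api u) (api v).
Proof.
move=> bu bv; apply/api_eq; [exact: bddD | by apply: bddD; exact: arep_bdd |].
by apply: eq_null (nullD (api_null bu) (api_null bv)) => k; ncring.
Qed.

Lemma api_opp u : bdd u -> api (fun k => - u k) = aopp (api u).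
Proof.
move=> bu; apply/api_eq; [exact: bddN | by apply: bddN; exact: arep_bdd |].
by apply: eq_null (nullN (api_null bu)) => k; ncring.
Qed.

Lemma api_mul u v : bdd u -> bdd v -> api (fun k => u k * v k) = amul (api u) (api v).
Proof.
move=> bu bv; apply/api_eq; [exact: bddM | by apply: bddM; exact: arep_bdd |].
apply: eq_null (nullD (nullMr (api_null bu) bv)
  (nullMl (arep_bdd (api u)) (api_null bv))) => k; ncring.
Qed.

Lemma api_adj u : bdd u -> api (fun k => adj (u k)) = aadj (api u).
Proof.
move=> bu; apply/api_eq; [exact: bdd_adj | by apply: bdd_adj; exact: arep_bdd |].
by apply: eq_null (null_adj (api_null bu)) => k; rewrite adjB.
Qed.

Fact aaddA : associative aadd.
Proof.
elim/asymP => u bu; elim/asymP => v bv; elim/asymP => w bw.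
rewrite -!api_add //; try exact: bddD.
by congr api; apply/funext => k; rewrite addrA.
Qed.
Fact aaddC : commutative aadd.
Proof.
elim/asymP => u bu; elim/asymP => v bv.
by rewrite -!api_add //; congr api; apply/funext => k; rewrite addrC.
Qed.
Fact aadd0 : left_id (acst 0) aadd.
Proof.
elim/asymP => u bu; rewrite -api_add //; last exact: bdd_cst.
by congr api; apply/funext => k; rewrite add0r.
Qed.
Fact aaddN : left_inverse (acst 0) aopp aadd.
Proof.
elim/asymP => u bu; rewrite -api_opp // -api_add //; last exact: bddN.
by congr api; apply/funext => k; rewrite addNr.
Qed.
HB.instance Definition _ := GRing.isZmodule.Build asym aaddA aaddC aadd0 aaddN.

Fact amulA : associative amul.
Proof.
elim/asymP => u bu; elim/asymP => v bv; elim/asymP => w bw.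
rewrite -!api_mul //; try exact: bddM.
by congr api; apply/funext => k; rewrite mulrA.
Qed.
Fact amul1 : left_id (acst 1) amul.
Proof.
elim/asymP => u bu; rewrite -api_mul //; last exact: bdd_cst.
by congr api; apply/funext => k; rewrite mul1r.
Qed.
Fact amulr1 : right_id (acst 1) amul.
Proof.
elim/asymP => u bu; rewrite -api_mul //; last exact: bdd_cst.
by congr api; apply/funext => k; rewrite mulr1.
Qed.
Fact amulDl : left_distributive amul aadd.
Proof.
elim/asymP => u bu; elim/asymP => v bv; elim/asymP => w bw.
rewrite -!(api_mul, api_add) //; try by [exact: bddD | exact: bddM].
by congr api; apply/funext => k; rewrite mulrDl.
Qed.
Fact amulDr : right_distributive amul aadd.
Proof.
elim/asymP => u bu; elim/asymP => v bv; elim/asymP => w bw.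
rewrite -!(api_mul, api_add) //; try by [exact: bddD | exact: bddM].
by congr api; apply/funext => k; rewrite mulrDr.
Qed.
HB.instance Definition _ := GRing.Zmodule_isPzRing.Build asym
  amulA amul1 amulr1 amulDl amulDr.

Lemma apiD u v : bdd u -> bdd v -> api (fun k => u k + v k) = api u + api v.
Proof. exact: api_add. Qed.
Lemma apiN u : bdd u -> api (fun k => - u k) = - api u.
Proof. exact: api_opp. Qed.
Lemma apiM u v : bdd u -> bdd v -> api (fun k => u k * v k) = api u * api v.
Proof. exact: api_mul. Qed.
Lemma acst1 : acst 1 = 1. Proof. by []. Qed.
Lemma acst0 : acst 0 = 0. Proof. by []. Qed.
Lemma acstD x y : acst (x + y) = acst x + acst y.
Proof. by rewrite -apiD //; exact: bdd_cst. Qed.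
Lemma acstN x : acst (- x) = - acst x.
Proof. by rewrite -apiN //; exact: bdd_cst. Qed.
Lemma acstM x y : acst (x * y) = acst x * acst y.
Proof. by rewrite -apiM //; exact: bdd_cst. Qed.

(** The limit superior of the norms is at most [c]; this does not depend on the representative by
    [anle_api]. *)
Definition anle (U : asym) c := 0 <= c /\
  forall e, 0 < e -> exists N, forall k, (N <= k)%N -> nm (arep U k) <= c + e.

Lemma anle_api u c : bdd u -> 0 <= c ->
  (anle (api u) c <->
   forall e, 0 < e -> exists N, forall k, (N <= k)%N -> nm (u k) <= c + e).
Proof.
move=> bu c0; have nu := api_null bu; split=> [[_ h] e e0|h].
  have [|N hN] := h (e / 2); first lra; have [|N' hN'] := nu (e / 2); first lra.
  exists (maxn N N') => k; rewrite geq_max => /andP[/hN h1 /hN' h2].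
  have -> : u k = (u k - arep (api u) k) + arep (api u) k by ncring.
  by apply: le_trans (nmD_le h2 h1) _; lra.
split=> // e e0.
have [|N hN] := h (e / 2); first lra; have [|N' hN'] := nu (e / 2); first lra.
exists (maxn N N') => k; rewrite geq_max => /andP[/hN h1 /hN' h2].
have -> : arep (api u) k = u k - (u k - arep (api u) k) by ncring.
by apply: le_trans (nmB_le h1 h2) _; lra.
Qed.

Fact anle_ex U : exists c, anle U c.
Proof.
have [c hc] := arep_bdd U; exists c; split; first exact: le_trans (nm_ge0 _) (hc 0%N).
by move=> e e0; exists 0%N => k _; apply: le_trans (hc k) _; lra.
Qed.
Fact anle_mono U c d : anle U c -> c <= d -> anle U d.
Proof.
move=> [c0 h] cd; split; first exact: le_trans cd.
by move=> e /h[N hN]; exists N => k /hN hk; lra.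
Qed.
Fact anle_lim U c : (forall e, 0 < e -> anle U (c + e)) -> anle U c.
Proof.
move=> h; split; first by apply/ler_addgt0Pr => e /h[].
move=> e e0; have [|_ h'] := h (e / 2); first lra.
have [|N hN] := h' (e / 2); first lra.
by exists N => k /hN hk; lra.
Qed.
Fact anle_eq0 U : anle U 0 -> U = 0.
Proof.
move=> [_ h]; rewrite -(api_arep U) -acst0; apply/api_eq; [exact: arep_bdd | exact: bdd_cst |].
by move=> e /h[N hN]; exists N => k /hN; rewrite subr0 add0r.
Qed.
Fact anleD U V c d : anle U c -> anle V d -> anle (U + V) (c + d).
Proof.
move=> [c0 hU] [d0 hV]; rewrite -[U]api_arep -[V]api_arep -apiD; try exact: arep_bdd.
apply/anle_api; [by apply: bddD; exact: arep_bdd | exact: addr_ge0 |] => e e0.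
have [|N hN] := hU (e / 2); first lra; have [|N' hN'] := hV (e / 2); first lra.
exists (maxn N N') => k; rewrite geq_max => /andP[/hN h1 /hN' h2].
by apply: le_trans (nmD_le h1 h2) _; lra.
Qed.
Fact anleM U V c d : anle U c -> anle V d -> anle (U * V) (c * d).
Proof.
move=> [c0 hU] [d0 hV]; rewrite -[U]api_arep -[V]api_arep -apiM; try exact: arep_bdd.
apply/anle_api; [by apply: bddM; exact: arep_bdd | exact: mulr_ge0 |] => e e0.
pose s := c + d + 1; have s0 : 0 < s by rewrite /s; lra.
pose e' := Num.min 1 (e / s).
have e'0 : 0 < e' by rewrite lt_min ltr01 divr_gt0.
have [N hN] := hU _ e'0; have [N' hN'] := hV _ e'0.
exists (maxn N N') => k; rewrite geq_max => /andP[/hN h1 /hN' h2].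
apply: le_trans (nmM_le h1 h2) _.
have e'1 : e' <= 1 by rewrite ge_min lexx.
have : e' * s <= e by rewrite -ler_pdivlMr // ge_min lexx orbT.
rewrite /s; nra.
Qed.
Fact anle_adj U c : anle U c -> anle (aadj U) c.
Proof.
move=> [c0 hU]; rewrite -[U]api_arep -api_adj; last exact: arep_bdd.
apply/anle_api => //; first by apply: bdd_adj; exact: arep_bdd.
by move=> e /hU[N hN]; exists N => k; rewrite nm_adj; exact: hN.
Qed.
Fact anle_cstar U c : 0 <= c -> anle (aadj U * U) (c ^+ 2) -> anle U c.
Proof.
move=> c0; have bU := arep_bdd U; rewrite -[U]api_arep -api_adj // -apiM //; last exact: bdd_adj.
have c2 : 0 <= c ^+ 2 by exact: exprn_ge0.
move=> /(anle_api (bddM (bdd_adj bU) bU) c2) h; apply/anle_api => // e e0.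
have [|N hN] := h (e ^+ 2); first exact: exprn_gt0.
exists N => k /hN; rewrite nm_cstar => hk.
by have := nm_ge0 (arep U k); nra.
Qed.
Fact anle_sc c : anle (acst c%:S) `|c|.
Proof.
apply/anle_api => //; first exact: bdd_cst.
by move=> e e0; exists 0%N => k _; apply: le_trans (nm_sc _ _) _; lra.
Qed.
Fact acst_sc_zmod : zmod_morphism (fun c => acst c%:S).
Proof. by move=> c d; rewrite rmorphB acstD acstN. Qed.
Fact acst_sc_monoid : monoid_morphism (fun c => acst c%:S).
Proof. by split=> [|c d]; rewrite ?rmorph1 // rmorphM acstM. Qed.
Fact acst_scC c (U : asym) : acst c%:S * U = U * acst c%:S.
Proof.
elim/asymP: U => u bu; rewrite -!apiM //; try exact: bdd_cst.
by congr api; apply/funext => k; rewrite scC.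
Qed.
Fact aadjK : involutive aadj.
Proof.
elim/asymP => u bu; rewrite -!api_adj //; last exact: bdd_adj.
by congr api; apply/funext => k; rewrite adjK.
Qed.
Fact aadjD : {morph aadj : U V / U + V}.
Proof.
elim/asymP => u bu; elim/asymP => v bv.
rewrite -apiD // -!api_adj // -?apiD; try by [exact: bddD | exact: bdd_adj].
by congr api; apply/funext => k; rewrite adjD.
Qed.
Fact aadjM U V : aadj (U * V) = aadj V * aadj U.
Proof.
elim/asymP: U => u bu; elim/asymP: V => v bv.
rewrite -apiM // -!api_adj // -?apiM; try by [exact: bddM | exact: bdd_adj].
by congr api; apply/funext => k; rewrite adjM.
Qed.
Fact aadj_sc c : aadj (acst c%:S) = acst c%:S.
Proof.
rewrite -api_adj; last exact: bdd_cst.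
by congr api; apply/funext => k; rewrite adj_sc.
Qed.
Fact anle_ge0 U c : anle U c -> 0 <= c. Proof. by case. Qed.

HB.instance Definition _ := PzRing_isNormedStar.Build R asym
  acst_sc_zmod acst_sc_monoid acst_scC aadjK aadjD aadjM aadj_sc
  anle_ge0 anle_ex anle_mono anle_lim anle_eq0 anleD anleM anle_adj anle_cstar anle_sc.

Lemma apiA u : bdd u -> api (fun k => adj (u k)) = adj (api u).
Proof. exact: api_adj. Qed.

Lemma nm_api_le u c : bdd u -> 0 <= c ->
  (nm (api u) <= c <->
   forall e, 0 < e -> exists N, forall k, (N <= k)%N -> nm (u k) <= c + e).
Proof. by move=> bu c0; rewrite -nmE; exact: anle_api. Qed.

End Asymptotic.

Arguments arep {R E}.
Arguments api {R E}.
Arguments acst {R E}.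
Arguments asym {R}.

Section AsymptoticPositive.
Variables (R : realType) (E : posStarType R).
Local Notation A := (asym E).

Lemma api_psum (s : seq A) : bdd (fun k => psum [seq arep U k | U <- s]) /\
  api (fun k => psum [seq arep U k | U <- s]) = psum s.
Proof.
elim: s => [|U s [bs IH]].
  have -> : (fun k => psum [seq arep U k | U <- [::] : seq A]) = fun=> 0.
    by apply/funext => k; rewrite /psum big_nil.
  by rewrite /psum big_nil; split; [exact: bdd_cst | exact: acst0].
have bU := arep_bdd U; have bU' := bdd_adj bU; have bUU := bddM bU bU'.
have -> : (fun k => psum [seq arep V k | V <- U :: s]) =
    fun k => arep U k * adj (arep U k) + psum [seq arep V k | V <- s].
  by apply/funext => k; rewrite /psum big_cons.
split; first exact: bddD.
by rewrite apiD // apiM // apiA // api_arep IH /psum big_cons.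
Qed.

Fact asym_nle_psum (s t : seq A) c : nle (psum s + psum t) c -> nle (psum s) c.
Proof.
move=> h; have c0 := nle_ge0 _ _ h; move: h.
have [bs <-] := api_psum s; have [bt <-] := api_psum t.
rewrite -apiD // => /nmE/(nm_api_le (bddD bs bt) c0) h; apply/nmE/nm_api_le => // e /h[N hN].
by exists N => k /hN; apply: le_trans; exact: nm_psum.
Qed.

Fact asym_psum_inv (s : seq A) : invertible (1 + psum s).
Proof.
have [bs <-] := api_psum s.
pose T k := 1 + psum [seq arep U k | U <- s].
have bT : bdd T by apply: bddD => //; exact: bdd_cst.
have TE : 1 + api (fun k => psum [seq arep U k | U <- s]) = api T.
  by rewrite -(acst1 E) -apiD //; exact: bdd_cst.
have TV k : T k * ninv (T k) = 1 /\ ninv (T k) * T k = 1 by apply/ninvP/psum_inv.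
(* The inverses are uniformly bounded: 1 is one of the summands of [T k], so [psum_kernel] with w =
   v = 1 bounds each inverse by 1. *)
have bV : bdd (fun k => ninv (T k)).
  exists 1 => k; have [h1 h2] := TV k.
  have e : T k = psum (1 :: [seq arep U k | U <- s]).
    by rewrite /psum big_cons mul1r adj1.
  have := @psum_kernel _ _ (1 :: [seq arep U k | U <- s]) (ninv (T k)) 1 1.
  by rewrite -e adj1 mul1r mulr1 mem_head; apply.
rewrite TE; exists (api (fun k => ninv (T k))).
rewrite -!apiM // -(acst1 E); split; congr api; apply/funext => k; by have [] := TV k.
Qed.

HB.instance Definition _ := NormedStar_isPositive.Build R A asym_nle_psum asym_psum_inv.

End AsymptoticPositive.

(** * Quasi-central approximate units *)

Record nideal (R : realType) (E : normedStarType R) := NIdeal {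
  nideal_set :> E -> Prop;
  nideal0 : nideal_set 0;
  nidealD : forall x y, nideal_set x -> nideal_set y -> nideal_set (x + y);
  nidealMl : forall a x, nideal_set x -> nideal_set (a * x);
  nidealMr : forall a x, nideal_set x -> nideal_set (x * a);
  nideal_adj : forall x, nideal_set x -> nideal_set (adj x);
  nideal_closed : nclosed nideal_set
}.

Section ApproximateUnit.
Variables (R : realType) (E : posStarType R) (I : nideal E).
Implicit Types (x y i : E) (s : seq E).

Lemma nidealN x : I x -> I (- x).
Proof. by move=> Ix; rewrite -mulN1r; exact: nidealMl. Qed.
Lemma nidealB x y : I x -> I y -> I (x - y).
Proof. by move=> Ix Iy; apply: nidealD => //; exact: nidealN. Qed.
Lemma nideal_sum (n : nat) (F : nat -> E) :
  (forall k, (k < n)%N -> I (F k)) -> I (\sum_(k < n) F k).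
Proof.
move=> h; elim: n h => [|n IH] h; first by rewrite big_ord0; exact: nideal0.
rewrite big_ord_recr; apply: nidealD; last exact: h.
by apply: IH => k kn; apply: h; exact: ltnW.
Qed.

Lemma psum_sc_inv (c : R) s : 0 < c -> invertible (psum (c%:S :: s)).
Proof.
move=> c0; have [y [h1 h2]] := @psum_inv R E [seq (c^-1)%:S * w | w <- s].
have e : psum (c%:S :: s) = (c * c)%:S * (1 + psum [seq (c^-1)%:S * w | w <- s]).
  rewrite /psum big_cons adj_sc mulrDr mulr1 -[in LHS]rmorphM; congr (_ + _).
  rewrite big_map mulr_sumr; apply: eq_bigr => w _.
  rewrite sc_mul_adj (mulrA (c * c)%:S) -rmorphM /= mulrACA divff ?gt_eqF // mulr1 rmorph1.
  by rewrite mul1r.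
exists (((c * c)^-1)%:S * y); rewrite e; split.
- rewrite -mulrA (mulrA (1 + _)) -scC -(mulrA _%:S) h1 mulr1 -rmorphM divff ?rmorph1 //.
  by rewrite gt_eqF // mulr_gt0.
- rewrite -mulrA (mulrA y) -scC -(mulrA _%:S) h2 mulr1 -rmorphM mulVf ?rmorph1 //.
  by rewrite gt_eqF // mulr_gt0.
Qed.

(* [e = h (h + eps^2)^-1], where h is the sum of the i i^*. *)
Lemma approx_unit s (eps : R) : 0 < eps -> (forall i, i \in s -> I i) ->
  exists e, [/\ I e, adj e = e, nm (1 - e) <= 1 &
    forall i, i \in s -> nm ((1 - e) * i) <= eps].
Proof.
move=> e0 sI; have [h1 h2] := ninvP (psum_sc_inv s e0).
set T := psum _ in h1 h2; set V := ninv T in h1 h2.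
have sV : adj V = V by apply: adj_inv h1 h2; exact: adj_psum.
have TE : T = eps%:S * eps%:S + psum s by rewrite /T /psum big_cons adj_sc.
have eE : 1 - psum s * V = eps%:S * V * eps%:S.
  by rewrite -h1 TE mulrDl addrK -mulrA -[RHS]mulrA -[V * eps%:S]scC.
have em := mem_head eps%:S s.
exists (psum s * V); split.
- apply: nidealMr; rewrite /psum big_seq.
  by elim/big_ind: _ => [|x y|i /sI Ii]; [exact: nideal0 | exact: nidealD | exact: nidealMr].
- have -> : psum s * V = 1 - eps%:S * V * eps%:S by rewrite -eE; ncring.
  by rewrite adjB adj1 !adjM adj_sc sV mulrA.
- by rewrite eE -{1}(adj_sc eps); exact: (psum_kernel h1 h2 em em).
move=> i si; rewrite eE.
have -> : eps%:S * V * eps%:S * i = eps%:S * (adj eps%:S * V * i).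
  by rewrite adj_sc -!mulrA (commr_mulCA _ (scC eps V)).
have iT : i \in eps%:S :: s by rewrite inE si orbT.
apply: le_trans (nmM_le (nm_sc _ _) (psum_kernel h1 h2 em iT)) _.
by rewrite mulr1 gtr0_norm.
Qed.

(** Each f_k comes after the earlier ones and is almost a unit for their commutators with [ys],
    which lie in the ideal. Including the products with y^* is what makes the commutators almost
    orthogonal. *)
Definition almost_central (N : nat) s (ys : seq E) (eta : R) (f : nat -> E) :=
  (forall k, (k < N)%N -> [/\ I (f k), adj (f k) = f k, nm (1 - f k) <= 1 &
     forall i, i \in s -> nm ((1 - f k) * i) <= eta]) /\
  (forall j k y, (j < k < N)%N -> y \in ys ->
     nm ((1 - f k) * (f j * y - y * f j)) <= eta /\
     nm ((1 - f k) * (adj y * (f j * y - y * f j))) <= eta).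

Lemma almost_central_ex N s (ys : seq E) (eta : R) : 0 < eta -> (forall i, i \in s -> I i) ->
  exists f, almost_central N s ys eta f.
Proof.
move=> eta0 sI; elim: N => [|N [f [f1 f2]]].
  by exists (fun=> 0); split=> // j k y; rewrite ltn0 andbF.
pose z j y := f j * y - y * f j.
pose t := s ++ [seq z j y | j <- iota 0 N, y <- ys] ++
  [seq adj y * z j y | j <- iota 0 N, y <- ys].
have Iz j y : (j < N)%N -> I (z j y).
  by move=> jN; have [If _ _ _] := f1 j jN; apply: nidealB; [exact: nidealMr | exact: nidealMl].
have [|e [Ie se e1 et]] := @approx_unit t eta eta0.
  move=> i; rewrite !mem_cat => /or3P[/sI //| |] /allpairsP[[j y] /= [+ _ ->]];
    rewrite mem_iota add0n => /andP[_ jN]; first exact: Iz.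
  by apply: nidealMl; exact: Iz.
exists (fun k => if k == N then e else f k); split=> [k|j k y /andP[jk kN] yys].
  rewrite ltnS leq_eqVlt; case: eqP => [_ _|_ /= kN]; last exact: f1.
  by split=> // i si; apply: et; rewrite mem_cat si.
have jN : (j < N)%N by exact: leq_trans jk _.
rewrite (ltn_eqF jN); move: kN; rewrite ltnS leq_eqVlt; case: eqP => [_ _|_ /= kN].
  split; apply: et; rewrite !mem_cat; apply/or3P; [apply: Or32|apply: Or33];
    by apply/allpairsP; exists (j, y); rewrite mem_iota add0n jN.
by apply: f2; rewrite ?jk.
Qed.

(* The commutators [z_k = f_k y - y f_k] are almost orthogonal: f_k acts almost
   as a unit on z_j and on y^* z_j for j < k, so z_j^* z_k is almost 0. *)
Lemma almost_central_sum N s (ys : seq E) (eta B : R) f y : 0 <= eta -> 0 <= B ->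
  almost_central N s ys eta f ->
  y \in ys -> nm y <= B -> N%:R * (2 * (eta * (B + 1))) <= 1 ->
  nm (\sum_(k < N) (f k * y - y * f k)) ^+ 2 <= N%:R * (16 * B ^+ 2 + 1).
Proof.
move=> eta0 B0 [f1 f2] yys yB hN; pose z k := f k * y - y * f k.
have f_le k : (k < N)%N -> nm (f k) <= 2.
  move=> /f1[_ _ h _]; have -> : f k = 1 - (1 - f k) by ncring.
  by apply: le_trans (nmB_le (nm1 E) h) _; lra.
have z_le k : (k < N)%N -> nm (z k) <= 4 * B.
  by move=> /f_le h; apply: le_trans (nmB_le (nmM_le h yB) (nmM_le yB h)) _; lra.
have zz j k : (j < k < N)%N -> nm (adj (z j) * z k) <= eta * (B + 1).
  move=> jk; have [h1 h2] := f2 j k y jk yys.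
  have /andP[_ kN] := jk; have [_ sf _ _] := f1 k kN.
  have s1 : adj (1 - f k) = 1 - f k by rewrite adjB adj1 sf.
  (* z_k is minus the commutator of 1 - f_k with y. Each of its two terms puts 1 - f_k next to y^*
     z_j or z_j. *)
  have -> : adj (z j) * z k =
      adj ((1 - f k) * (adj y * z j)) - adj ((1 - f k) * z j) * y.
    by rewrite (adjM (1 - _)) (adjM (1 - _)) s1 (adjM (adj y)) adjK /z; ncring.
  by apply: le_trans (nmB_le (_ : _ <= eta) (nmM_le (_ : _ <= eta) yB)) _; rewrite ?nm_adj //; lra.
have {}hN n : (n <= N)%N -> n%:R * (eta * (B + 1)) <= 2^-1.
  move=> nN; have : n%:R <= N%:R :> R by rewrite ler_nat.
  have : 0 <= eta * (B + 1) by apply: mulr_ge0 => //; lra.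
  by move: (n%:R) (N%:R) (eta * _) hN => a b c; nra.
suff h n : (n <= N)%N -> nm (\sum_(k < n) z k) ^+ 2 <= n%:R * (16 * B ^+ 2 + 1) by exact: h.
elim: n => [|n IH] nN; first by rewrite big_ord0 nm0 mul0r expr0n.
rewrite big_ord_recr /=; set S := \sum_(_ < _) _.
(* The cross term and its adjoint contribute 1/2 each, which is the summand 1 in the bound. *)
have Sz : nm (adj S * z n) <= 2^-1.
  apply: le_trans (hN n (ltnW nN)); rewrite adj_sum mulr_suml.
  by apply: (@nm_sum_le _ _ n (fun j => adj (z j) * z n)) => j jn; apply: zz; rewrite jn.
rewrite -nm_cstar; have -> : adj (S + z n) * (S + z n) =
    adj S * S + adj S * z n + (adj (adj S * z n) + adj (z n) * z n).
  by rewrite adjD adjM adjK; ncring.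
have h1 := IH (ltnW nN); rewrite -nm_cstar in h1.
have h2 : nm (adj (z n) * z n) <= 16 * B ^+ 2.
  by rewrite nm_cstar; have := z_le n nN; have := nm_ge0 (z n); nra.
have h3 : nm (adj (adj S * z n)) <= 2^-1 by rewrite nm_adj.
apply: le_trans (nmD_le (nmD_le h1 Sz) (nmD_le h3 h2)) _.
by rewrite -(natr1 n); lra.
Qed.

(** A sum of N almost orthogonal commutators has norm O(N^(1/2)), so the mean of the f_k has
    commutators of norm O(N^(-1/2)). This explicit mean takes the place of a convexity argument. *)
Lemma quasicentral s (ys : seq E) (eps : R) : 0 < eps -> (forall i, i \in s -> I i) ->
  exists e, [/\ I e, adj e = e, nm e <= 2,
    forall y, y \in ys -> nm (e * y - y * e) <= eps &
    forall i, i \in s -> nm ((1 - e) * i) <= eps].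
Proof.
move=> eps0 sI.
pose B := \sum_(y <- ys) nm y.
have B0 : 0 <= B by apply: sumr_ge0 => y _; exact: nm_ge0.
have yB y : y \in ys -> nm y <= B.
  move=> yys; rewrite /B (big_rem y) //= lerDl.
  by apply: sumr_ge0 => x _; exact: nm_ge0.
pose N := (Num.bound ((16 * B ^+ 2 + 1) / eps ^+ 2)).+1.
have N0 : 0 < N%:R :> R by rewrite ltr0n.
have hN : 16 * B ^+ 2 + 1 <= eps ^+ 2 * N%:R.
  have x0 : 0 <= (16 * B ^+ 2 + 1) / eps ^+ 2.
    by rewrite divr_ge0 ?exprn_ge0 ?(ltW eps0) // addr_ge0 // mulr_ge0 ?exprn_ge0.
  rewrite [leRHS]mulrC -ler_pdivrMr ?exprn_gt0 //; apply: ltW.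
  by apply: lt_le_trans (archi_boundP x0) _; rewrite ler_nat.
(* The second bound is the total allowance for cross terms in [almost_central_sum], the first the
   required accuracy on [s]. *)
pose eta := Num.min eps ((2 * (B + 1) * N%:R)^-1).
have d0 : 0 < 2 * (B + 1) * N%:R by apply: mulr_gt0 => //; lra.
have eta0 : 0 < eta by rewrite lt_min eps0 invr_gt0.
have heta : N%:R * (2 * (eta * (B + 1))) <= 1.
  have -> : N%:R * (2 * (eta * (B + 1))) = eta * (2 * (B + 1) * N%:R) by ring.
  by rewrite -ler_pdivlMr // mul1r ge_min lexx orbT.
have [f fP] := almost_central_ex N ys eta0 sI; have [f1 f2] := fP.
have nf k : (k < N)%N -> nm (f k) <= 2.
  move=> /f1[_ _ h _]; have -> : f k = 1 - (1 - f k) by ncring.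
  by apply: le_trans (nmB_le (nm1 E) h) _; lra.
have avg (W : nat -> E) (c : R) : (forall k, (k < N)%N -> nm (W k) <= c) ->
    nm ((N%:R^-1)%:S * \sum_(k < N) W k) <= c.
  move=> h; apply: le_trans (nmM_le (nm_sc _ _) (nm_sum_le h)) _.
  by rewrite gtr0_norm ?invr_gt0 // mulrA mulVf ?mul1r // gt_eqF.
have sN : (N%:R^-1)%:S * \sum_(k < N) 1 = 1 :> E.
  have -> : \sum_(k < N) 1 = (N%:R : R)%:S :> E.
    by rewrite rmorph_nat sumr_const card_ord.
  by rewrite -rmorphM /= mulVf ?gt_eqF // rmorph1.
exists ((N%:R^-1)%:S * \sum_(k < N) f k); split.
- by apply: nidealMl; apply: nideal_sum => k /f1[].
- rewrite adjM adj_sc -scC adj_sum; congr (_ * _); apply: eq_bigr => k _.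
  by have [_ -> _ _] := f1 k (ltn_ord k).
- exact: avg.
- move=> y yys; have h := almost_central_sum (ltW eta0) B0 fP yys (yB y yys) heta.
  have -> : (N%:R^-1)%:S * (\sum_(k < N) f k) * y - y * ((N%:R^-1)%:S * (\sum_(k < N) f k)) =
      (N%:R^-1)%:S * \sum_(k < N) (f k * y - y * f k).
    rewrite (commr_mulCA _ (scC _ y)) -mulrA -mulrBr; congr (_ * _).
    by rewrite mulr_suml mulr_sumr -sumrB.
  apply: le_trans (nm_scM _ _) _; rewrite gtr0_norm ?invr_gt0 // mulrC ler_pdivrMr //.
  rewrite -(ler_pXn2r (n := 2)) ?nnegrE ?nm_ge0 ?mulr_ge0 ?(ltW eps0) ?(ltW N0) //.
  apply: le_trans h _; rewrite exprMn.
  by move: (N%:R) N0 hN => a a0 h; nra.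
- move=> i si; have -> : (1 - (N%:R^-1)%:S * (\sum_(k < N) f k)) * i =
      (N%:R^-1)%:S * \sum_(k < N) ((1 - f k) * i).
    by rewrite -{1}sN -mulrBr -mulrA -sumrB -mulr_suml.
  apply: (avg (fun k => (1 - f k) * i)) => k /f1[_ _ _ /(_ i si) h].
  by apply: le_trans h _; rewrite ge_min lexx.
Qed.

End ApproximateUnit.

(* g = 2e/(1+e^2) and h = (1-e^2)/(1+e^2) satisfy g^2 + h^2 = 1. *)
Lemma sa_partition (R : realType) (B : normedStarType R) (e w : B) : adj e = e ->
  (1 + e * e) * w = 1 -> w * (1 + e * e) = 1 ->
  let g := (e + e) * w in let h := (1 - e * e) * w in
  [/\ [/\ adj g = g, adj h = h, GRing.comm g h & g * g + h * h = 1],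
      forall z, GRing.comm z e -> GRing.comm z g /\ GRing.comm z h &
      forall i, (1 - e) * i = 0 -> h * i = 0].
Proof.
move=> se w1 w2 g h.
have cw z : GRing.comm z e -> GRing.comm z w.
  move=> ze; apply: (comm_inv w1 w2); apply: commrD; first exact: commr1.
  exact: commrM.
have we : GRing.comm e w by exact: cw.
have sw : adj w = w by apply: adj_inv w1 w2; rewrite adjD adj1 adjM se.
have ww (a b : B) : GRing.comm b w -> a * w * (b * w) = a * b * (w * w).
  by move=> bw; rewrite -!mulrA (commr_mulCA _ bw).
have gw : GRing.comm (e + e) w by apply/commr_sym/commrD; exact/commr_sym.
have hw : GRing.comm (1 - e * e) w.
  by apply/commr_sym/commrB; [exact: commr1 | apply: commrM; exact/commr_sym].
have cgh z : GRing.comm z e -> GRing.comm z g /\ GRing.comm z h.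
  move=> ze; have zw := cw _ ze; split; apply: commrM => //; first exact: commrD.
  by apply: commrB; [exact: commr1 | exact: commrM].
split=> //.
- split.
  + by rewrite adjM adjD se sw -gw.
  + by rewrite adjM adjB adj1 adjM se sw -hw.
  + have [_ h1] := cgh e erefl; have [_ h2] := cgh w (commr_sym we).
    by apply/commr_sym/commrM; [apply: commrD|]; exact/commr_sym.
  + rewrite /g /h !ww // -mulrDl.
    have -> : (e + e) * (e + e) + (1 - e * e) * (1 - e * e) = (1 + e * e) * (1 + e * e) by ncring.
    by rewrite -mulrA (mulrA (1 + e * e) w) w1 mul1r.
- move=> i ei; have -> : h = w * (1 + e) * (1 - e) by rewrite /h hw; ncring.
  by rewrite -(mulrA _ (1 - e) i) ei mulr0.
Qed.

(** * Asymptotic elements modulo the ideal *)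

Section Congruence.
Variables (R : realType) (E : posStarType R) (I : nideal E).
Implicit Types (U V W : asym E) (x y z : E).

(* U is represented by a sequence of elements of y + I. *)
Definition cong U y := exists u, [/\ bdd u, api u = U & forall k, I (u k - y)].

Lemma cong_cst x y : I (x - y) -> cong (acst x) y.
Proof. by move=> h; exists (fun=> x); split=> //; exact: bdd_cst. Qed.

Lemma cong_refl x : cong (acst x) x.
Proof. by apply: cong_cst; rewrite subrr; exact: nideal0. Qed.

Lemma congD U V x y : cong U x -> cong V y -> cong (U + V) (x + y).
Proof.
move=> [u [bu <- hu]] [v [bv <- hv]]; exists (fun k => u k + v k); split.
- exact: bddD.
- by rewrite apiD.
- by move=> k; rewrite opprD addrACA; exact: nidealD.
Qed.

Lemma congN U x : cong U x -> cong (- U) (- x).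
Proof.
move=> [u [bu <- hu]]; exists (fun k => - u k); split.
- exact: bddN.
- by rewrite apiN.
- by move=> k; rewrite -opprD; exact: nidealN.
Qed.

Lemma congB U V x y : cong U x -> cong V y -> cong (U - V) (x - y).
Proof. by move=> hu hv; apply: congD => //; exact: congN. Qed.

Lemma congM U V x y : cong U x -> cong V y -> cong (U * V) (x * y).
Proof.
move=> [u [bu <- hu]] [v [bv <- hv]]; exists (fun k => u k * v k); split.
- exact: bddM.
- by rewrite apiM.
- move=> k; have -> : u k * v k - x * y = (u k - x) * v k + x * (v k - y) by ncring.
  by apply: nidealD; [exact: nidealMr | exact: nidealMl].
Qed.

Lemma cong_adj U x : cong U x -> cong (adj U) (adj x).
Proof.
move=> [u [bu <- hu]]; exists (fun k => adj (u k)); split.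
- exact: bdd_adj.
- by rewrite apiA.
- by move=> k; rewrite -adjB; exact: nideal_adj.
Qed.

Lemma cong0 : cong 0 0. Proof. by rewrite -(acst0 E); exact: cong_refl. Qed.
Lemma cong1 : cong 1 1. Proof. by rewrite -(acst1 E); exact: cong_refl. Qed.
Lemma cong_sc (c : R) : cong c%:S c%:S. Proof. exact: (cong_refl c%:S). Qed.

Lemma congX U x n : cong U x -> cong (U ^+ n) (x ^+ n).
Proof.
by move=> h; elim: n => [|n IH]; rewrite ?expr0 ?exprS; [exact: cong1 | exact: congM].
Qed.

Lemma cong_sum n (F : nat -> asym E) (f : nat -> E) :
  (forall k, (k < n)%N -> cong (F k) (f k)) -> cong (\sum_(k < n) F k) (\sum_(k < n) f k).
Proof.
elim: n => [|n IH] h; first by rewrite !big_ord0; exact: cong0.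
rewrite !big_ord_recr; apply: congD; last exact: h.
by apply: IH => k kn; apply: h; exact: ltnW.
Qed.

(** A representative of V need not be congruent to [y] term by term. But V = y - V (U - x) y,
    because V U = 1 and x y = 1, and the right-hand side gives such a representative. *)
Lemma cong_inv U x V y : cong U x -> U * V = 1 -> V * U = 1 -> x * y = 1 -> y * x = 1 ->
  cong V y.
Proof.
move=> [u [bu <- hu]] UV VU xy yx.
have bV := arep_bdd V; set v := arep V in bV; have vV : api v = V by exact: api_arep.
pose w k := y - v k * (u k - x) * y.
have bux : bdd (fun k => u k - x) by apply: bddD => //; exact: bdd_cst.
have bw : bdd w.
    by apply: bddD; [|apply: bddN; apply: bddM; [exact: bddM|]]; exact: bdd_cst.
exists w; split=> // [|k].
  rewrite /w apiD; [|exact: bdd_cst|by apply: bddN; apply: bddM; [exact: bddM | exact: bdd_cst]].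
  rewrite apiN; last by apply: bddM; [exact: bddM | exact: bdd_cst].
  rewrite apiM; [|exact: bddM|exact: bdd_cst].
  rewrite apiM // apiD //; last exact: bdd_cst.
  rewrite vV mulrDr VU mulrDl mul1r -/(acst y) -/(acst (- x)) acstN mulrN mulNr -mulrA.
  by rewrite -acstM xy acst1 mulr1; ncring.
rewrite /w addrAC subrr add0r; apply: nidealN.
by apply: nidealMr; exact: nidealMl.
Qed.

Lemma cong_ninv U x : cong U x -> invertible U -> invertible x -> cong (ninv U) (ninv x).
Proof. by move=> h /ninvP[h1 h2] /ninvP[h3 h4]; exact: cong_inv h h1 h2 h3 h4. Qed.

(** The truncation is built from sums, products, adjoints and inverses. Its class modulo the ideal
    can therefore be computed from any congruent data, in particular from a scalar instead of [U]'s
    partner [V]. *)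
Lemma cong_trunc U x V y q : cong U x -> cong V y -> cong (trunc U V q) (trunc x y q).
Proof.
move=> Ux Vy.
have cw k : cong (wpow U V q k) (wpow x y q k).
  by rewrite !wpowE; apply: congM; exact: congX.
have cs : cong (wsum U V q) (wsum x y q).
  rewrite !wsumE; apply: (cong_sum (F := fun k => wpow U V q k * adj (wpow U V q k))
    (f := fun k => wpow x y q k * adj (wpow x y q k))) => k _.
  by apply: congM => //; exact: cong_adj.
have ct A : cong (ninv (wthr U V q A)) (ninv (wthr x y q A)).
  apply: cong_ninv; [|exact: wthr_inv|exact: wthr_inv].
  by rewrite !wthrE; apply: congD => //; apply: congM; [|apply: cong_adj]; exact: congX.
have cl A : cong (low U V q A) (low x y q A).
  by rewrite !lowE; apply: congM; [apply: congM => //|]; exact: congX.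
have ch A : cong (high U V q A) (high x y q A) by rewrite !highE; exact: congM.
have cc j : cong (cutoff U V q j) (cutoff x y q j).
  by rewrite /cutoff; case: ifP => _; [exact: congX | exact: cong0].
apply: (cong_sum (F := fun i => (cutoff U V q i.+1 - cutoff U V q i.+2) * U
   * low U V q (2 * q * i.+1) ^+ tpow q)
  (f := fun i => (cutoff x y q i.+1 - cutoff x y q i.+2) * x
   * low x y q (2 * q * i.+1) ^+ tpow q)) => i _.
by apply: congM; [apply: congM => //; exact: congB | exact: congX].
Qed.

(** One term far out in the sequence satisfies all the norm bounds up to [d], while its congruence
    modulo the ideal is exact. *)
Lemma cong_extract U y z n (a b c d : R) : 0 < d -> cong U y ->
  nm U <= a -> nm (U ^+ n) <= b -> nm (U - acst z) <= c ->
  exists x, [/\ I (x - y), nm x <= a + d, nm (x ^+ n) <= b + d & nm (x - z) <= c + d].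
Proof.
move=> d0 [u [bu <- hu]] ha hb hc.
have h (v : nat -> E) (t : R) : bdd v -> nm (api v) <= t ->
    exists N, forall k, (N <= k)%N -> nm (v k) <= t + d.
  by move=> bv vt; apply: (proj1 (nm_api_le bv (le_trans (nm_ge0 _) vt)) vt).
have bX : bdd (fun k => u k ^+ n) /\ api (fun k => u k ^+ n) = api u ^+ n.
  elim: (n) => [|m [b' e]]; first by split; [exact: bdd_cst|].
  have -> : (fun k => u k ^+ m.+1) = fun k => u k * u k ^+ m.
    by apply/funext => k; rewrite exprS.
  by split; [exact: bddM | rewrite apiM // e exprS].
have bz : bdd (fun k => u k - z) by apply: bddD => //; exact: bdd_cst.
have ez : api (fun k => u k - z) = api u - acst z.
  by rewrite apiD //; [congr (_ + _); exact: acstN | exact: bdd_cst].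
rewrite -(proj2 bX) in hb; rewrite -ez in hc.
have [N1 h1] := h _ _ bu ha; have [N2 h2] := h _ _ (proj1 bX) hb; have [N3 h3] := h _ _ bz hc.
exists (u (maxn N1 (maxn N2 N3))); split => //.
- by apply: h1; exact: leq_maxl.
- by apply: h2; rewrite leq_max leq_maxl orbT.
- by apply: h3; rewrite leq_max leq_maxr orbT.
Qed.

(** Quasi-central elements with tolerance 1/(k+1) form a sequence whose class e commutes exactly
    with [ys], is a unit for [s] and is represented in the ideal; g and h come from
    [sa_partition]. *)
Lemma asym_partition (s ys : seq E) : (forall i, i \in s -> I i) -> exists g h : asym E,
  [/\ [/\ adj g = g, adj h = h, GRing.comm g h & g * g + h * h = 1],
      forall y, y \in ys -> GRing.comm (acst y) g /\ GRing.comm (acst y) h,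
      forall i, i \in s -> h * acst i = 0, cong g 0 & cong h 1].
Proof.
move=> sI.
have [f fP] : exists f : nat -> E, forall k, [/\ I (f k), adj (f k) = f k, nm (f k) <= 2,
    forall y, y \in ys -> nm (f k * y - y * f k) <= k.+1%:R^-1 &
    forall i, i \in s -> nm ((1 - f k) * i) <= k.+1%:R^-1].
  have ex k := @quasicentral _ _ I s ys k.+1%:R^-1 _ sI.
  have k0 k : 0 < k.+1%:R^-1 :> R by rewrite invr_gt0.
  by exists (fun k => projT1 (cid (ex k0 k))) => k; case: cid.
have bf : bdd f by exists 2 => k; have [] := fP k.
have inv_null (u : nat -> E) : (forall k, nm (u k) <= k.+1%:R^-1) -> null u.
  move=> hu d d0; exists (Num.bound d^-1) => k hk; apply: le_trans (hu k) _.
  rewrite invf_ple ?posrE //; apply: ltW.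
  have dV : 0 <= d^-1 by rewrite invr_ge0 ltW.
  by apply: lt_le_trans (archi_boundP dV) _; rewrite ler_nat (leq_trans hk).
have [e [se ey ei ce]] : exists e : asym E, [/\ adj e = e,
    forall y, y \in ys -> GRing.comm (acst y) e,
    forall i, i \in s -> (1 - e) * acst i = 0 & cong e 0].
  exists (api f); split.
  - by rewrite -apiA //; congr api; apply/funext => k; have [] := fP k.
  - move=> y yys; rewrite /GRing.comm -!apiM //; try exact: bdd_cst.
    apply/api_eq; try by [apply: bddM => //; exact: bdd_cst].
    by apply: inv_null => k; have [_ _ _ h _] := fP k; rewrite nmBC; exact: h.
  - move=> i si; rewrite -(acst1 E) -apiN // -apiD; [|exact: bdd_cst|exact: bddN].
    have b1 : bdd (fun k => 1 - f k) by apply: bddD; [exact: bdd_cst | exact: bddN].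
    rewrite -apiM //; last exact: bdd_cst.
    rewrite -(acst0 E); apply/api_eq; [by apply: bddM => //; exact: bdd_cst | exact: bdd_cst |].
    by apply: inv_null => k; have [_ _ _ _ h] := fP k; rewrite subr0; exact: h.
  - by exists f; split=> // k; rewrite subr0; have [] := fP k.
have [w [w1 w2]] := @psum_inv R (asym E) [:: e].
rewrite /psum big_seq1 se in w1 w2.
have [gh ghz ghi] := sa_partition se w1 w2.
have cw : cong w 1.
  by apply: (cong_inv (congD cong1 (congM ce ce)) w1 w2); rewrite mul0r addr0 mulr1.
exists ((e + e) * w), ((1 - e * e) * w); split=> //.
- by move=> y yys; exact: ghz (ey y yys).
- by move=> i si; exact: ghi (ei i si).
- by have := congM (congD ce ce) cw; rewrite addr0 mul0r.
- by have := congM (congB cong1 (congM ce ce)) cw; rewrite mul0r subr0 mulr1.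
Qed.

End Congruence.

(** * Estimates for a single correction *)

Section Bounds.
Variables (R : realType) (B : posStarType R).
Implicit Types (X g h : B) (r : R).

Lemma nm_powB (x y : B) (c : R) n : 1 <= c -> nm x <= c -> nm y <= c ->
  nm (x ^+ n - y ^+ n) <= n%:R * c ^+ n * nm (x - y).
Proof.
move=> c1 xc yc; elim: n => [|n IH]; first by rewrite !expr0 subrr nm0 !mul0r.
have -> : x ^+ n.+1 - y ^+ n.+1 = x * (x ^+ n - y ^+ n) + (x - y) * y ^+ n.
  by rewrite !exprS; ncring.
apply: le_trans (nmD_le (nmM_le xc IH) (nmM_le (lexx _) (nmX_le n yc))) _.
have a1 : 0 <= c ^+ n by rewrite exprn_ge0 // (le_trans _ c1).
have : 0 <= c ^+ n * nm (x - y) by rewrite mulr_ge0 ?nm_ge0.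
rewrite (exprS c) -(natr1 n); move: (c ^+ n) (nm _) (n%:R) => a b k; nra.
Qed.

Lemma trunc_dist_ge0 (q : nat) : 0 <= trunc_dist R q.
Proof.
rewrite /trunc_dist addr_ge0 ?exprn_ge0 // mulr_ge0 // mulr_ge0 ?exprn_ge0 //.
by rewrite mulrn_wge0 // !mulr_ge0 ?exprn_ge0.
Qed.

Lemma nm_perturb X F D (c e1 e2 : R) n : 0 <= e1 -> 0 <= e2 -> 2 + e1 + e2 <= c ->
  nm X <= 2 -> nm (X - F) <= e1 -> nm D <= e2 ->
  [/\ nm (F + D) <= c, nm (F + D - X) <= e1 + e2 &
      nm ((F + D) ^+ n) <= nm (F ^+ n) + n%:R * c ^+ n * e2].
Proof.
move=> e10 e20 hc X2 XF De2.
have nF : nm F <= c.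
  have -> : F = X - (X - F) by ncring.
  by have := nmB_le X2 XF; lra.
have nU : nm (F + D) <= c.
  have -> : F + D = (X - (X - F)) + D by ncring.
  by have := nmD_le (nmB_le X2 XF) De2; lra.
split=> //.
  have -> : F + D - X = D - (X - F) by ncring.
  by have := nmB_le De2 XF; lra.
have c1 : 1 <= c by lra.
have -> : (F + D) ^+ n = F ^+ n + ((F + D) ^+ n - F ^+ n) by ncring.
apply: le_trans (nmD_le (lexx _) (nm_powB n c1 nU nF)) _.
have -> : F + D - F = D by ncring.
by rewrite lerD2l ler_wpM2l // mulr_ge0 // exprn_ge0 // (le_trans _ c1).
Qed.

Definition trunc_pow (q : nat) : R := q.+1%:R * (q%:R * (2 ^+ tpow q * 4)) ^+ q.+1.

Lemma trunc_pow_ge0 (q : nat) : 0 <= trunc_pow q.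
Proof. by rewrite mulr_ge0 // exprn_ge0 // !mulr_ge0 ?exprn_ge0. Qed.

(** On X^(q+1) the inverse of rho acts as 1/r. Since p = M q + M, what remains of r^p is r^M, at
    most r. *)
Lemma nm_inv_eigen X rho io q r : 0 < r <= 1 -> rho * io = 1 -> io * rho = 1 ->
  rho * X ^+ q.+1 = r%:S * X ^+ q.+1 -> nm (X ^+ q.+1) <= r ^+ tpow q ->
  nm (io ^+ (2 * q.+1 * q) * X ^+ q.+1) <= r.
Proof.
move=> /andP[r0 r1] ri ir rX Xr; have rn : r != 0 by rewrite gt_eqF.
have iX k : io ^+ k * X ^+ q.+1 = (r^-1 ^+ k)%:S * X ^+ q.+1.
  elim: k => [|k IH]; first by rewrite !expr0 rmorph1.
  have e : X ^+ q.+1 = (r^-1)%:S * (rho * X ^+ q.+1).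
    by rewrite rX mulrA -rmorphM /= mulVf // rmorph1 mul1r.
  rewrite exprSr -mulrA {1}e (commr_mulCA _ (scC _ io)) (mulrA io) ir mul1r.
  by rewrite (commr_mulCA _ (scC _ _)) IH mulrA -rmorphM -exprS.
rewrite iX; apply: le_trans (nmM_le (nm_sc _ _) Xr) _.
rewrite ger0_norm ?exprn_ge0 ?invr_ge0 ?(ltW r0) //.
have -> : tpow q = (2 * q.+1 * q + 2 * q.+1)%N by rewrite /tpow; lia.
rewrite exprD mulrA -exprMn mulVf // expr1n mul1r.
have -> : (2 * q.+1 = (2 * q).+1.+1)%N by lia.
by rewrite exprS ger_pMr // exprn_ile1 // ltW.
Qed.

Section Partition.
Variables (X g h : B).
Hypotheses (sg : adj g = g) (sh : adj h = h) (ghC : GRing.comm g h).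
Hypotheses (gh1 : g * g + h * h = 1) (Xg : GRing.comm X g) (Xh : GRing.comm X h).

(** Here rho = s + (r - s) g^2 is r where h vanishes and s where g vanishes. As h annihilates
    X^(q+1), rho acts on it as r. *)
Lemma trunc_partition q (r s : R) : (0 < q)%N -> 0 < s -> s <= r -> r <= 1 ->
  nm X <= 2 -> h * X ^+ q.+1 = 0 -> nm (X ^+ q.+1) <= r ^+ tpow q ->
  exists io, [/\ (s%:S + (r - s)%:S * (g * g)) * io = 1,
    io * (s%:S + (r - s)%:S * (g * g)) = 1,
    nm (X - trunc X io q) <= trunc_dist R q * r &
    nm (trunc X io q ^+ q.+1) <= trunc_pow q * (2 * r ^+ 2) ^+ tpow q].
Proof.
move=> q0 s0 sr r1 X2 hX Xr; set rho := s%:S + _.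
have r0 : 0 < r by exact: lt_le_trans sr.
have rs : 0 <= r - s by rewrite subr_ge0.
(* As a [psum] with a positive scalar entry, rho is invertible by [psum_sc_inv]. *)
have rhoE : rho = psum [:: (Num.sqrt s)%:S; (Num.sqrt (r - s))%:S * g].
  rewrite /psum big_cons big_seq1 sc_mul_adj adj_sc sg -rmorphM /= -!expr2.
  by rewrite !sqr_sqrtr // ltW.
have [ri ir] : rho * ninv rho = 1 /\ ninv rho * rho = 1.
  by apply: ninvP; rewrite rhoE; apply: psum_sc_inv; rewrite sqrtr_gt0.
have srho : adj rho = rho by rewrite rhoE adj_psum.
have rX : GRing.comm rho X.
  apply/commr_sym/commrD; first by rewrite /GRing.comm scC.
  by apply: commrM; [rewrite /GRing.comm scC | exact: commrM].
have rhor : nm rho <= r.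
  apply: le_trans (nmD_le (nm_sc _ _) (nmM_le (nm_sc _ _) (nm_sq_le1 sg sh gh1))) _.
  by rewrite !ger0_norm ?(ltW s0) //; lra.
have rhoX : rho * X ^+ q.+1 = r%:S * X ^+ q.+1.
  have gX : g * g * X ^+ q.+1 = X ^+ q.+1.
    have -> : g * g = 1 - h * h by rewrite -gh1; ncring.
    by rewrite mulrBl mul1r -mulrA hX mulr0 subr0.
  by rewrite /rho mulrDl -mulrA gX -mulrDl -rmorphD /= addrC subrK.
have r01 : 0 <= r <= 1 by rewrite ltW.
exists (ninv rho); split=> //.
- apply: (nm_trunc_dist q0 r01 X2 srho rhor ri ir rX).
  by apply: nm_inv_eigen ri ir rhoX Xr; rewrite r0.
- exact: (nm_trunc_nilp q r01 X2 srho rhor ri ir rX).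
Qed.

Lemma cutoff_nilpotent q : h * X ^+ q.+1 = 0 -> (h * X) ^+ q.+1 = 0.
Proof.
move=> hX; rewrite exprMn_comm; last exact: commr_sym.
by rewrite exprSr -mulrA hX mulr0.
Qed.

Lemma nm_part_le1 : nm h <= 1.
Proof.
apply: nm_cstar_le => //; rewrite sh expr1n; apply: (@nm_sq_le1 _ _ h g) => //.
by rewrite addrC.
Qed.

(** U is a weighted mean of (2 - b) X and X1, and (2 - b) b <= 1. Because h X = h X1, it is also k X
    with a contraction k that commutes with X, so powers do not grow. *)
Lemma contract_partition (X1 : B) (b c : R) n : GRing.comm X1 g -> GRing.comm X1 h ->
  1 <= b <= 2 -> 1 <= c -> nm X <= b -> nm X1 <= c -> h * X = h * X1 ->
  let U := g * g * ((2 - b)%:S * X) + h * h * X1 in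
  [/\ nm U <= c, nm (U ^+ n) <= nm (X ^+ n) & nm (U - X) <= (b - 1) * 2].
Proof.
move=> X1g X1h /andP[b1 b2] c1 Xb X1c hX U.
have b02 : 0 <= 2 - b by lra.
have csc (s : R) (z : B) : GRing.comm z s%:S by rewrite /GRing.comm scC.
pose k := g * g * (2 - b)%:S + h * h * 1.
have UE : U = k * X.
  by rewrite /U /k mulr1 mulrDl -!mulrA hX.
have kX : GRing.comm k X.
  by apply/commr_sym/commrD; apply: commrM; try exact: commrM; [exact: csc | exact: commr1].
split.
- apply: nm_average => //; try by [exact: commr_sym]; try by apply: commrM => //; exact: commr_sym.
  apply: le_trans (nmM_le (nm_sc _ _) Xb) _; rewrite ger0_norm //; nra.
- rewrite UE exprMn_comm // -[leRHS]mul1r; apply: nmM_le => //.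
  rewrite -(expr1n _ n); apply: nmX_le; apply: nm_average => //; try exact: commr1.
  + by apply: le_trans (nm_sc _ _) _; rewrite ger0_norm //; lra.
  + exact: nm1.
- have -> : U - X = - ((b - 1)%:S * (g * g * X)).
    rewrite UE /k; have -> : h * h = 1 - g * g by rewrite -gh1; ncring.
    have -> : b - 1 = 1 - (2 - b) by ring.
    by rewrite [(1 - (2 - b))%:S]rmorphB rmorph1 -[g * g * _%:S]scC; ncring.
  rewrite nmN; apply: le_trans (nmM_le (nm_sc _ _) (nmM_le (nm_sq_le1 sg sh gh1) Xb)) _.
  rewrite ger0_norm; [|lra]; nra.
Qed.

End Partition.
End Bounds.

(** * Corrections of a lift within its class *)

Section Steps.
Variables (R : realType) (E : posStarType R) (I : nideal E) (q : nat).
Hypothesis q0 : (0 < q)%N.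
Implicit Types (x y X : E) (d r : R).

Lemma nideal_powB x y n : I (x - y) -> I (x ^+ n - y ^+ n).
Proof.
move=> xy; elim: n => [|n IH]; first by rewrite !expr0 subrr; exact: nideal0.
have -> : x ^+ n.+1 - y ^+ n.+1 = x * (x ^+ n - y ^+ n) + (x - y) * y ^+ n.
  by rewrite !exprS; ncring.
by apply: nidealD; [exact: nidealMl | exact: nidealMr].
Qed.

Lemma nideal_trans x y z : I (x - y) -> I (y - z) -> I (x - z).
Proof. by move=> xy yz; rewrite -(subrK y x) -addrA; exact: nidealD. Qed.

Lemma acstX x n : acst x ^+ n = acst (x ^+ n).
Proof. by elim: n => [|n IH]; rewrite ?expr0 ?exprS ?IH ?acstM. Qed.

Lemma nm_acst x : nm (acst x) <= nm x.
Proof.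
apply/nm_api_le; [exact: bdd_cst | exact: nm_ge0 |].
by move=> e e0; exists 0%N => k _; lra.
Qed.

(** In the asymptotic algebra h X is exactly nilpotent, since h annihilates X^(q+1), and h is 1
    modulo the ideal. *)
Lemma nearly_nilpotent_lift X d : 0 < d -> I (X ^+ q.+1) -> exists x,
  [/\ I (x - X), nm x <= nm X + d & nm (x ^+ q.+1) <= d].
Proof.
move=> d0 IX.
have [|g [h [[sg sh gh gh1] ghX hi _ h1]]] := @asym_partition _ _ I [:: X ^+ q.+1] [:: X].
  by move=> i; rewrite inE => /eqP ->.
have [Xg Xh] := ghX X (mem_head _ _).
have hX : h * acst X ^+ q.+1 = 0 by rewrite acstX; exact/hi/mem_head.
have cU : cong I (h * acst X) (1 * X) by apply: congM => //; exact: cong_refl.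
have nU := nmM_le (nm_part_le1 sg sh gh1) (nm_acst X).
have nUn : nm ((h * acst X) ^+ q.+1) <= 0 by rewrite (cutoff_nilpotent Xh hX) nm0.
have [x [xX nx nxn _]] := cong_extract (z := 0) d0 cU nU nUn (lexx _).
by rewrite mul1r in xX; rewrite mul1r in nx; rewrite add0r in nxn; exists x.
Qed.

Lemma nilpotent_step X r d : 0 < d -> 0 < r <= 1 -> I (X ^+ q.+1) ->
  nm X <= 2 -> nm (X ^+ q.+1) <= r ^+ tpow q ->
  (forall d, 0 < d -> exists x, [/\ I (x - X), nm x <= 2 & nm (x ^+ q.+1) <= d]) ->
  exists x, [/\ I (x - X), nm (x - X) <= trunc_dist R q * r + d &
    nm (x ^+ q.+1) <= trunc_pow R q * (2 * r ^+ 2) ^+ tpow q + d].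
Proof.
move=> d0 /andP[r0 r1] IX X2 Xr hx.
pose C := trunc_dist R q; have C0 : 0 <= C by exact: trunc_dist_ge0.
pose c := 2 + 2 * C; have c1 : 1 <= c by rewrite /c; lra.
pose K := q.+1%:R * c ^+ q.+1 * C + C + 1.
have cn : 0 <= q.+1%:R * c ^+ q.+1 by rewrite mulr_ge0 // exprn_ge0 // (le_trans _ c1).
have K1 : 1 <= K by have := mulr_ge0 cn C0; rewrite /K; lra.
(* So small that C s, and its effect on the power q+1 through [nm_perturb], stay below d/2. *)
pose s := Num.min r (d / (2 * K)).
have s0 : 0 < s by rewrite lt_min r0 divr_gt0 //; lra.
have sr : s <= r by rewrite ge_min lexx.
have sK : s * K <= d / 2.
  have : s <= d / (2 * K) by rewrite ge_min lexx orbT.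
  by rewrite ler_pdivlMr; [lra | lra].
(* An auxiliary lift so nearly nilpotent that it can be truncated with the scalar s in place of
   rho. *)
have [Y [YX Y2 Yn]] := hx _ (exprn_gt0 (tpow q) s0).
pose j : E := (s^-1)%:S.
have sj : s%:S * j = 1 by rewrite -rmorphM /= divff ?rmorph1 // gt_eqF.
have js : j * s%:S = 1 by rewrite -rmorphM /= mulVf ?rmorph1 // gt_eqF.
have s01 : 0 <= s <= 1 by rewrite ltW //= (le_trans sr).
have Ys : nm (Y - trunc Y j q) <= C * s.
  apply: (nm_trunc_dist q0 s01 Y2 (adj_sc s) _ sj js (scC s Y)).
    by apply: le_trans (nm_sc _ _) _; rewrite gtr0_norm.
  by apply: (nm_inv_eigen _ sj js erefl Yn); rewrite s0 (le_trans sr).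
have cs2 : q.+1%:R * c ^+ q.+1 * (C * s) <= d / 2.
  by apply: le_trans sK; have := mulr_ge0 cn C0; rewrite /K; nra.
have Cs2 : C * s <= d / 2.
  by apply: le_trans sK; have := mulr_ge0 cn C0; rewrite /K; nra.
have Cs0 : 0 <= C * s by rewrite mulr_ge0 // ltW.
have Cr0 : 0 <= C * r by rewrite mulr_ge0 // ltW.
have Crs : 2 + C * r + C * s <= c by rewrite /c; nra.
have d2 : 0 < d / 2 by lra.
have dd2 : d / 2 + d / 2 = d by lra.
have [|g [h [[sg sh gh gh1] ghX hi g0 _]]] := @asym_partition _ _ I [:: X ^+ q.+1] [:: X].
  by move=> i; rewrite inE => /eqP ->.
have [Xg Xh] := ghX X (mem_head _ _).
have hX : h * acst X ^+ q.+1 = 0 by rewrite acstX; exact/hi/mem_head.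
have aX2 := le_trans (nm_acst X) X2.
have aXr : nm (acst X ^+ q.+1) <= r ^+ tpow q.
  by rewrite acstX; apply: le_trans (nm_acst _) Xr.
have [io [ri ir Fd Fn]] := trunc_partition sg sh gh1 Xg q0 s0 sr r1 aX2 hX aXr.
rewrite -/C in Fd; set F := trunc _ _ _ in Fd Fn.
have cio : cong I io j.
  have crho := congD (cong_sc I s) (congM (cong_sc I (r - s)) (congM g0 g0)).
  by apply: (cong_inv crho ri ir); rewrite mul0r mulr0 addr0.
have cF : cong I F (trunc Y j q).
  apply: cong_trunc cio; apply: cong_cst.
  by rewrite -opprB; exact: nidealN.
(* Modulo the ideal F is the truncation of Y. Adding D gives the class of Y, which is that of X, at
   a cost of C s. *)
pose D := Y - trunc Y j q.
have cU : cong I (F + acst D) Y.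
  have -> : Y = trunc Y j q + D by rewrite /D; ncring.
  by apply: congD => //; exact: cong_refl.
have nD : nm (acst D) <= C * s by exact: le_trans (nm_acst _) Ys.
have [nU nUX nUn] := nm_perturb q.+1 Cr0 Cs0 Crs aX2 Fd nD.
have [x [xX _ nxn nxX]] := cong_extract d2 cU nU (le_trans nUn (lerD Fn cs2)) nUX.
exists x; split; first exact: nideal_trans xX YX.
- by apply: le_trans nxX _; rewrite -addrA lerD2l -[leRHS]dd2 lerD2r.
- by apply: le_trans nxn _; rewrite -addrA lerD2l dd2.
Qed.

(** Modulo the ideal g is 0 and h is 1, so the damped element becomes X1 there and remains a lift of
    the same class. *)
Lemma contraction_step X X1 b d : 0 < d -> 1 <= b <= 2 -> nm X <= b ->
  I (X1 - X) -> nm X1 <= 1 + d -> exists x,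
  [/\ I (x - X), nm x <= 1 + 2 * d, nm (x ^+ q.+1) <= nm (X ^+ q.+1) + d &
      nm (x - X) <= (b - 1) * 2 + d].
Proof.
move=> d0 b12 Xb X1X X1d.
have [|g [h [[sg sh gh gh1] ghX hi g0 h1]]] := @asym_partition _ _ I [:: X1 - X] [:: X; X1].
  by move=> i; rewrite inE => /eqP ->.
have [Xg Xh] := ghX X (mem_head _ _).
have [X1g X1h] : GRing.comm (acst X1) g /\ GRing.comm (acst X1) h.
  by apply: ghX; rewrite !inE eqxx orbT.
have hX : h * acst X = h * acst X1.
  have := hi _ (mem_head _ _); rewrite acstD acstN mulrBr => /eqP.
  by rewrite subr_eq0 => /eqP.
have c1 : 1 <= 1 + d by lra.
have [nU nUn nUX] := contract_partition sg sh gh gh1 Xg Xh q.+1 X1g X1h b12 c1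
  (le_trans (nm_acst X) Xb) (le_trans (nm_acst X1) X1d) hX.
set U := _ + _ in nU nUn nUX.
have cU : cong I U (0 * 0 * ((2 - b)%:S * X) + 1 * 1 * X1).
  apply: congD; (apply: congM; [exact: congM|]); last exact: cong_refl.
  by apply: congM; [exact: cong_sc | exact: cong_refl].
have e : 0 * 0 * ((2 - b)%:S * X) + 1 * 1 * X1 = X1 by rewrite !mul0r add0r !mul1r.
have nUn' : nm (U ^+ q.+1) <= nm (X ^+ q.+1).
  by apply: le_trans nUn _; rewrite acstX; exact: nm_acst.
have [x [xX nx nxn nxX]] := cong_extract d0 cU nU nUn' nUX.
rewrite e in xX; exists x; split=> //; first exact: nideal_trans xX X1X.
by apply: le_trans nx _; rewrite -addrA -mulr2n mulr_natl.
Qed.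

End Steps.

(** * Iteration of the corrections *)

Section Lifting.
Variables (R : realType) (E : posStarType R) (I : nideal E) (q : nat) (X0 : E).
Hypotheses (cE : ncomplete E) (q0 : (0 < q)%N) (IX0 : I (X0 ^+ q.+1)).
Hypothesis X0_le : forall d : R, 0 < d -> exists x, I (x - X0) /\ nm x <= 1 + d.

Local Notation p := (tpow q).
Local Notation C := (trunc_dist R q).
Local Notation C' := (trunc_pow R q).

Let near d : 0 < d -> exists x, [/\ I (x - X0), nm x <= 1 + d & nm (x ^+ q.+1) <= d].
Proof.
move=> d0; have d2 : 0 < d / 2 by lra.
have [x [xX xd]] := X0_le d2.
have Ix : I (x ^+ q.+1).
  rewrite -(subrK (X0 ^+ q.+1) (x ^+ _)); apply: nidealD => //; exact: nideal_powB.
have [y [yx yd yn]] := nearly_nilpotent_lift d2 Ix.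
by exists y; split; [exact: nideal_trans yx xX | lra | lra].
Qed.

(** A single scale [r] measures the excess of the norm and, through the exponent p, the failure of
    nilpotency. Each step halves it. *)
Definition nearly_lifted r X := [/\ I (X - X0), nm X <= 1 + r & nm (X ^+ q.+1) <= r ^+ p].

(** A step moves X by at most C r + d + 2 (b - 1) + d', where b - 1 = (C + 2) r, d <= r and d' <=
    r/4. The choice of [r0] makes both (C + 2) r and 8 (C' + 1) r at most 1. *)
Let K : R := 3 * C + 6.
Let r0 : R := ((C + 2) * (8 * (C' + 1)))^-1.

Let C0 : 0 <= C. Proof. exact: trunc_dist_ge0. Qed.
Let C'0 : 0 <= C'. Proof. exact: trunc_pow_ge0. Qed.
Let K0 : 0 <= K. Proof. by rewrite /K; have := C0; lra. Qed.

Let r0_gt0 : 0 < r0.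
Proof. by rewrite invr_gt0 mulr_gt0 //; have := C0; have := C'0; lra. Qed.

Let r0E : r0 * ((C + 2) * (8 * (C' + 1))) = 1.
Proof.
have c1 : 0 < C + 2 by have := C0; lra.
have c2 : 0 < 8 * (C' + 1) by have := C'0; lra.
by rewrite mulVf // gt_eqF // mulr_gt0.
Qed.

Lemma lift_step r X : 0 < r -> r <= r0 -> nearly_lifted r X ->
  exists Y, nearly_lifted (r / 2) Y /\ nm (Y - X) <= K * r.
Proof.
move=> rp rr0 [XX Xr Xn].
have cc := C0; have cc' := C'0.
have a1 : r * (C + 2) <= r0 * (C + 2) by apply: ler_wpM2r => //; lra.
have a2 : r0 * (C + 2) <= 1.
  rewrite -[leRHS]r0E; apply: ler_wpM2l; first exact: ltW.
  by rewrite ler_peMr //; lra.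
have a3 : r * (8 * (C' + 1)) <= r0 * (8 * (C' + 1)) by apply: ler_wpM2r => //; lra.
have a4 : r0 * (8 * (C' + 1)) <= 1.
  rewrite -[leRHS]r0E; apply: ler_wpM2l; first exact: ltW.
  by rewrite ler_peMl //; lra.
have h1 : (C + 2) * r <= 1 by lra.
have rC' : 0 <= r * C' by rewrite mulr_ge0 // ltW.
have h2 : C' * (4 * r) <= 2^-1 by lra.
have r4 : 4 * r <= 1 by lra.
set t := (r / 2) ^+ p.
have t0 : 0 < t by apply: exprn_gt0; lra.
have h3 : C' * (2 * r ^+ 2) ^+ p <= t / 2.
  (* One factor 4 r absorbs C' by the choice of [r0]; the other p - 1 factors are at most 1. *)
  have -> : 2 * r ^+ 2 = (r / 2) * (4 * r) by field.
  rewrite exprMn -/t mulrCA [t / 2]mulrC [leRHS]mulrC; apply: ler_wpM2l; first exact: ltW.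
  apply: le_trans h2; apply: ler_wpM2l => //.
  have -> : p = (tpow q).-1.+1 by rewrite prednK // /tpow; lia.
  by rewrite exprS ger_pMr ?exprn_ile1 //; lra.
(* The target t splits into t/2 for the truncation and t/4 for each of the two tolerances. The bound
   r/4 gives the norm 1 + 2 d' <= 1 + r/2. *)
pose d := Num.min r (t / 4); pose d' := Num.min (r / 4) (t / 4).
have d0 : 0 < d by rewrite lt_min rp /=; lra.
have d'0 : 0 < d' by rewrite lt_min; apply/andP; split; lra.
have dr : d <= r by rewrite ge_min lexx.
have dt : d <= t / 4 by rewrite ge_min lexx orbT.
have d'r : d' <= r / 4 by rewrite ge_min lexx.
have d't : d' <= t / 4 by rewrite ge_min lexx orbT.
have Ipow x : I (x - X0) -> I (x ^+ q.+1).
  move=> xX; rewrite -(subrK (X0 ^+ q.+1) (x ^+ _)); apply: nidealD => //.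
  exact: nideal_powB.
have back x y : I (x - X0) -> I (y - X0) -> I (x - y).
  by move=> hx hy; apply: nideal_trans hx _; rewrite -opprB; exact: nidealN.
have [|||e e0|Y [YX Yd Yn]] := @nilpotent_step _ _ I q q0 X r d d0 _ (Ipow _ XX).
- by rewrite rp; lra.
- by lra.
- exact: Xn.
- have [|x [x1 x2 x3]] := @near (Num.min 1 e); first by rewrite lt_min ltr01.
  have m1 : Num.min 1 e <= 1 by rewrite ge_min lexx.
  have m2 : Num.min 1 e <= e by rewrite ge_min lexx orbT.
  by exists x; split; [exact: back | lra | lra].
have YX0 : I (Y - X0) by exact: nideal_trans YX XX.
pose b := 1 + (C + 2) * r.
have Yb : nm Y <= b.
  have -> : Y = X + (Y - X) by ncring.
  by have := nmD_le Xr Yd; rewrite /b; lra.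
have [Z1 [Z1X Z1d _]] := near d'0.
have b12 : 1 <= b <= 2.
  by apply/andP; split; rewrite /b; [have : 0 <= (C + 2) * r by apply: mulr_ge0; lra | ]; lra.
have [Z [ZY Zd Zn ZYd]] := contraction_step q d'0 b12 Yb (back _ _ Z1X YX0) Z1d.
exists Z; split.
  split; [exact: nideal_trans ZY YX0 | lra |].
  by rewrite -/t; lra.
have -> : Z - X = (Z - Y) + (Y - X) by ncring.
apply: le_trans (nmD_le ZYd Yd) _; rewrite /b /K; lra.
Qed.

Theorem nilpotent_contraction_lift : exists X, [/\ I (X - X0), nm X <= 1 & X ^+ q.+1 = 0].
Proof.
pose r k := r0 * 2^-1 ^+ k.
have rS k : r k.+1 = r k / 2 by rewrite /r exprSr mulrA.
have r_gt0 k : 0 < r k by rewrite mulr_gt0 // exprn_gt0 // invr_gt0.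
have r_le k : r k <= r0 by rewrite ger_pMr // exprn_ile1 // ?invr_ge0 // invf_le1 // ler1n.
have [S0 S0P] : exists X, nearly_lifted (r 0%N) X.
  have m0 : 0 < Num.min (r 0%N) (r 0%N ^+ p) by rewrite lt_min r_gt0 exprn_gt0.
  have [x [x1 x2 x3]] := near m0; exists x; split => //.
    by apply: le_trans x2 _; rewrite lerD2l ge_min lexx.
  by apply: le_trans x3 _; rewrite ge_min lexx orbT.
(* The implication sits under the existential so that choice gives a function on all X; off the
   invariant its value is 0. *)
have next k X : exists Y,
    nearly_lifted (r k) X -> nearly_lifted (r k.+1) Y /\ nm (Y - X) <= K * r k.
  have [h|h] := pselect (nearly_lifted (r k) X); last by exists 0.
  by have [Y hY] := lift_step (r_gt0 k) (r_le k) h; exists Y; rewrite rS.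
pose f k X := projT1 (cid (next k X)).
pose u := fix u k := if k is k'.+1 then f k' (u k') else S0.
have uP k : nearly_lifted (r k) (u k).
  elim: k => //= k IH; rewrite /f; case: cid => Y /= /(_ IH)[]. by [].
have uS k : nm (u k.+1 - u k) <= K * r k.
  by have := uP k; rewrite /= /f; case: cid => Y /= h /h[].
have uD k m : nm (u (k + m)%N - u k) <= 2 * K * r k - 2 * K * r (k + m)%N.
  elim: m => [|m IH]; first by rewrite addn0 !subrr nm0.
  have -> : u (k + m.+1)%N - u k = (u (k + m).+1 - u (k + m)%N) + (u (k + m)%N - u k).
    by rewrite addnS; ncring.
  apply: le_trans (nmD_le (uS _) IH) _; rewrite addnS rS; lra.
have uD' k m : (k <= m)%N -> nm (u m - u k) <= 2 * K * r k.
  move=> km; have := uD k (m - k)%N; rewrite subnKC // => /le_trans; apply.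
  rewrite gerBl; apply: mulr_ge0; last exact: ltW.
  by apply: mulr_ge0 => //; exact: K0.
have half01 : 0 <= (2^-1 : R) < 1 by rewrite invr_ge0 ler0n /= invf_lt1 // ltr1n.
have small c e : 0 < e -> exists k, c * r k <= e.
  move=> e0; have [k hk] := expr_small (c * r0) half01 e0.
  by exists k; rewrite /r mulrA mulrC ltW.
have [|X hX] := cE (u := u).
  move=> e /(small (2 * K))[k hk]; exists k => m /uD' h; exact: le_trans hk.
have X_near e : 0 < e -> exists k, nm (X - u k) <= e /\ r k <= e.
  move=> e0; have [N hN] := hX e e0; have [k hk] := small 1 e e0.
  exists (maxn N k); split; first by apply: hN; exact: leq_maxl.
  rewrite mul1r in hk; apply: le_trans hk; rewrite /r ler_wpM2l ?(ltW r0_gt0) //.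
  by apply: ler_wiXn2l; rewrite ?leq_maxr ?invr_ge0 // invf_le1 // ler1n.
have X1 : nm X <= 1.
  apply/ler_addgt0Pr => e e0; have [|k [h1 h2]] := X_near (e / 2); first by lra.
  have [_ h3 _] := uP k; have -> : X = (X - u k) + u k by ncring.
  by have := nmD_le h1 h3; lra.
exists X; split=> //.
- apply: (@nideal_closed _ _ I) => e /X_near[k [h1 _]].
  have [h2 _ _] := uP k; exists (u k - X0) => //.
  by have -> : X - X0 - (u k - X0) = X - u k by ncring.
- apply: nm_small => e e0.
  pose c : R := q.+1%:R * 2 ^+ q.+1 + 1.
  have c0 : 0 < c by rewrite ltr_wpDl // mulr_ge0 // exprn_ge0.
  have [s s0 sc] : exists2 s, 0 < s & s * c = e.
    by exists (e / c); [exact: divr_gt0 | rewrite divfK // gt_eqF].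
  have m0 : 0 < Num.min 1 (s / 2) by rewrite lt_min ltr01 divr_gt0.
  have [k [h1 h2]] := X_near _ m0.
  have m1 : Num.min 1 (s / 2) <= 1 by rewrite ge_min lexx.
  have m2 : Num.min 1 (s / 2) <= s / 2 by rewrite ge_min lexx orbT.
  have [_ h3 h4] := uP k.
  have u2 : nm (u k) <= 2 by lra.
  have X2 : nm X <= 2 by lra.
  have := nm_powB q.+1 (ler1n R 2) X2 u2; set a := _ * _ ^+ _ => h5.
  have a0 : 0 <= a by rewrite mulr_ge0 // exprn_ge0.
  have rp : r k ^+ p <= r k.
    have -> : p = (tpow q).-1.+1 by rewrite prednK // /tpow; lia.
    by rewrite exprS ger_pMr ?exprn_ile1 // ?(ltW (r_gt0 k)) //; lra.
  have -> : X ^+ q.+1 = (X ^+ q.+1 - u k ^+ q.+1) + u k ^+ q.+1 by ncring.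
  apply: le_trans (nmD_le h5 h4) _.
  have : a * nm (X - u k) <= a * (s / 2) by rewrite ler_wpM2l //; lra.
  have -> : a = c - 1 by rewrite /c -/a; ring.
  by nra.
Qed.

End Lifting.

Local Open Scope star_scope.

(** * Complex scalars with a real-valued modulus *)

Section ComplexModulus.
Variable R : realType.
Implicit Types l : R[i].

Definition absC l : R := complex.Re `|l|.

Lemma absCE l : `|l| = (absC l)%:C%C.
Proof.
have : 0 <= `|l| by exact: normr_ge0.
by rewrite /absC; case: (`|l| : R[i]) => a b /ger0_Im /= ->.
Qed.
Lemma absC_ge0 l : 0 <= absC l.
Proof. by have := normr_ge0 l; rewrite absCE lecR. Qed.
Lemma absCD l m : absC (l + m) <= absC l + absC m.
Proof. by have := ler_normD l m; rewrite !absCE -rmorphD lecR. Qed.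
Lemma absCM l m : absC (l * m) = absC l * absC m.
Proof. by apply: complexI; rewrite rmorphM -!absCE normrM. Qed.
Lemma absC_conj l : absC l^* = absC l.
Proof. by apply: complexI; rewrite -!absCE norm_conjC. Qed.
Lemma absC_real (c : R) : absC c%:C%C = `|c|.
Proof.
apply: complexI; rewrite -absCE; case: (leP 0 c) => c0.
  by rewrite !ger0_norm // lecR.
by rewrite !ltr0_norm // ?rmorphN // ltcR.
Qed.
Lemma absC_eq0 l : absC l <= 0 -> l = 0.
Proof.
move=> h; have /eqP : absC l = 0 by apply/le_anti; rewrite h absC_ge0.
by move=> /eqP h0; apply/normr0_eq0; rewrite absCE h0.
Qed.
Lemma absC_i : absC 'i = 1.
Proof. by apply: complexI; rewrite -absCE normCi. Qed.

Lemma absC_ReIm l : absC l <= `|complex.Re l| + `|complex.Im l|.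
Proof.
rewrite {1}[l]complexE complexiE; apply: le_trans (absCD _ _) _.
by rewrite absCM absC_i mul1r !absC_real.
Qed.
Lemma ReB l (m : R[i]) : complex.Re (l - m) = complex.Re l - complex.Re m.
Proof. by case: l m => [a b] [c d]. Qed.
Lemma ImB l (m : R[i]) : complex.Im (l - m) = complex.Im l - complex.Im m.
Proof. by case: l m => [a b] [c d]. Qed.
Lemma Re_le_absC l : `|complex.Re l| <= absC l.
Proof. by case: l => a b; rewrite /absC normc_def /= -{1}sqrtr_sqr ler_wsqrtr // lerDl sqr_ge0. Qed.
Lemma Im_le_absC l : `|complex.Im l| <= absC l.
Proof. by case: l => a b; rewrite /absC normc_def /= -{1}sqrtr_sqr ler_wsqrtr // lerDr sqr_ge0. Qed.

Lemma real_complete (u : nat -> R) :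
  (forall e : R, 0 < e -> exists N, forall m, (N <= m)%N -> `|u m - u N| <= e) ->
  exists w, forall e : R, 0 < e -> exists N, forall m, (N <= m)%N -> `|w - u m| <= e.
Proof.
move=> hu; have uc : cvg (u @ \oo)%classic.
  apply/cauchy_cvgP/cauchy_exP => e /= e0.
  have [|N hN] := hu (e / 2); first lra.
  exists (u N); exists N => // m /= Nm.
  by rewrite -ball_normE /ball_ /= distrC; apply: le_lt_trans (hN m Nm) _; lra.
exists (lim (u @ \oo)%classic) => e e0.
have /cvgrPdist_le /(_ e e0) [N _ hN] := uc.
by exists N => m Nm; exact: hN.
Qed.

Lemma complex_complete (u : nat -> R[i]) :
  (forall e : R, 0 < e -> exists N, forall m, (N <= m)%N -> absC (u m - u N) <= e) ->
  exists w, forall e : R, 0 < e -> exists N, forall m, (N <= m)%N -> absC (w - u m) <= e.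
Proof.
move=> hu.
have [|a ha] := @real_complete (fun n => complex.Re (u n)).
  move=> e /hu[N hN]; exists N => m /hN; apply: le_trans.
  by rewrite -ReB; exact: Re_le_absC.
have [|b hb] := @real_complete (fun n => complex.Im (u n)).
  move=> e /hu[N hN]; exists N => m /hN; apply: le_trans.
  by rewrite -ImB; exact: Im_le_absC.
exists (Complex a b) => e e0.
have [|N hN] := ha (e / 2); first lra; have [|M hM] := hb (e / 2); first lra.
exists (maxn N M) => m; rewrite geq_max => /andP[/hN h1 /hM h2].
by apply: le_trans (absC_ReIm _) _; rewrite ReB ImB /=; lra.
Qed.

End ComplexModulus.

Section CStarComplete.
Variables (R : realType) (A : cstarAlgType R).

Lemma cstar_complete (u : nat -> A) :
  (forall e : R, 0 < e -> exists N, forall m, (N <= m)%N -> rnorm (u m - u N) <= e) ->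
  exists w, forall e : R, 0 < e -> exists N, forall m, (N <= m)%N -> rnorm (w - u m) <= e.
Proof.
move=> hu; have uc : cvg (u @ \oo)%classic.
  apply/cauchy_cvgP/cauchy_exP => _ /= /gt0_real [e e0 ->].
  have [|N hN] := hu (e / 2); first lra.
  exists (u N); exists N => // m /= Nm.
  rewrite -ball_normE /ball_ /= rnormE ltcR -rnormN opprB.
  by apply: le_lt_trans (hN m Nm) _; lra.
exists (lim (u @ \oo)%classic) => e e0.
have /cvgrPdist_le /(_ e%:C%C) := uc.
rewrite ltcR => /(_ e0) [n _ hn]; exists n => m nm.
by have := hn m nm; rewrite rnormE lecR.
Qed.

Lemma rnormZC (l : R[i]) (x : A) : rnorm (l *: x) = absC l * rnorm x.
Proof. by apply: complexI; rewrite -rnormE normrZ absCE rnormE -rmorphM. Qed.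

End CStarComplete.

(** * The unitization as a complete normed star ring *)

Section Unitization.
Variables (R : realType) (A : cstarAlgType R).

Definition unitization : Type := (A * R[i])%type.
HB.instance Definition _ := GRing.Zmodule.on unitization.
Implicit Types (u v w : unitization) (x y : A) (c d : R).

Definition umul u v : unitization :=
  (u.1 ** v.1 + u.2 *: v.1 + v.2 *: u.1, u.2 * v.2).
Definition uone : unitization := (0, 1).
Definition uadj u : unitization := (star u.1, u.2^*).
Definition uact u x : A := u.1 ** x + u.2 *: x.
Definition usc c : unitization := (0, c%:C%C).

Fact umulA : associative umul.
Proof.
move=> [a l] [b m] [c n]; congr (_, _); rewrite /= ?mulrA //.
rewrite !(smulDl, smulDr, scalerDr, smulZl, smulZr, smulA, scalerA).
rewrite (mulrC n l) (mulrC n m) !addrA.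
by rewrite [RHS](ACl (1*3*5*2*4*6*7))%AC.
Qed.
Fact umul1 : left_id uone umul.
Proof. by move=> [a l]; congr (_, _); rewrite /= ?mul1r // smul0l scale1r scaler0 addr0 add0r. Qed.
Fact umulr1 : right_id uone umul.
Proof. by move=> [a l]; congr (_, _); rewrite /= ?mulr1 // smul0r scale1r scaler0 !add0r. Qed.
Fact umulDl : left_distributive umul +%R.
Proof.
move=> [a l] [b m] [c n]; congr (_, _); rewrite /= ?mulrDl //.
by rewrite smulDl scalerDl scalerDr !addrA [LHS](ACl (1*3*5*2*4*6))%AC.
Qed.
Fact umulDr : right_distributive umul +%R.
Proof.
move=> [a l] [b m] [c n]; congr (_, _); rewrite /= ?mulrDr //.
by rewrite smulDr scalerDl scalerDr !addrA [LHS](ACl (1*3*5*2*4*6))%AC.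
Qed.
HB.instance Definition _ := GRing.Zmodule_isPzRing.Build unitization
  umulA umul1 umulr1 umulDl umulDr.

Lemma uactM u v x : uact (u * v) x = uact u (uact v x).
Proof.
rewrite /uact /= !(smulDl, smulDr, scalerDr, smulZl, smulZr, smulA, scalerA) !addrA.
by rewrite [LHS](ACl (1*3*2*4))%AC.
Qed.
Lemma uactD u v x : uact (u + v) x = uact u x + uact v x.
Proof. by rewrite /uact /= smulDl scalerDl addrACA. Qed.

(** [uadj u] is the adjoint of [u] for the A-valued inner product star x ** y. This yields the
    C*-identity for the operator norm. *)
Lemma uact_star u x y : star (uact u x) ** y = star x ** uact (uadj u) y.
Proof. by rewrite /uact starD starM starZ smulDl smulDr smulZl smulZr smulA. Qed.

Lemma uact_star_le u x : rnorm (uact u x) ^+ 2 <= rnorm x * rnorm (uact (uadj u) (uact u x)).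
Proof.
by rewrite -rnorm_star_mul uact_star; apply: le_trans (rnormM _ _) _; rewrite rnorm_star.
Qed.

(* The operator norm on A is only a seminorm when A has a unit; |l| makes it a
   norm. *)
Definition unle u c :=
  [/\ 0 <= c, absC u.2 <= c & forall x, rnorm (uact u x) <= c * rnorm x].

Fact usc_zmod : zmod_morphism usc.
Proof. by move=> c d; congr (_, _); rewrite /= ?subr0 // rmorphB. Qed.
Fact usc_monoid : monoid_morphism usc.
Proof.
by split=> [|c d]; congr (_, _); rewrite /= ?rmorph1 ?rmorphM // smul0l !scaler0 !addr0.
Qed.
Fact uscC c u : usc c * u = u * usc c.
Proof.
congr (_, _) => /=; last exact: mulrC.
by rewrite smul0l smul0r !scaler0 addr0 !add0r.
Qed.
Fact uadjK : involutive uadj.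
Proof. by move=> [a l]; congr (_, _); rewrite /= ?starK ?conjCK. Qed.
Fact uadjD : {morph uadj : u v / u + v}.
Proof. by move=> u v; congr (_, _); rewrite /= ?starD // rmorphD. Qed.
Fact uadjM u v : uadj (u * v) = uadj v * uadj u.
Proof.
congr (_, _); rewrite /= ?rmorphM 1?mulrC //.
by rewrite !starD starM !starZ addrAC.
Qed.
Fact uadj_sc c : uadj (usc c) = usc c.
Proof.
congr (_, _); rewrite /= ?star0 // conj_Creal // realE.
by rewrite -(rmorph0 (real_complex R)) !lecR le_total.
Qed.
Fact unle_ge0 u c : unle u c -> 0 <= c. Proof. by case. Qed.
Fact unle_ex u : exists c, unle u c.
Proof.
exists (rnorm u.1 + absC u.2); split.
- by rewrite addr_ge0 ?rnorm_ge0 ?absC_ge0.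
- by rewrite lerDr rnorm_ge0.
- move=> x; apply: le_trans (rnormD _ _) _.
  by rewrite mulrDl lerD ?rnormM // rnormZC.
Qed.
Fact unle_mono u c d : unle u c -> c <= d -> unle u d.
Proof.
move=> [c0 lc ac] cd; split; [exact: le_trans cd | exact: le_trans cd |].
by move=> x; apply: le_trans (ac x) _; rewrite ler_wpM2r ?rnorm_ge0.
Qed.
Fact unle_lim u c : (forall e, 0 < e -> unle u (c + e)) -> unle u c.
Proof.
move=> h; split.
- by apply/ler_addgt0Pr => e /h[].
- by apply/ler_addgt0Pr => e /h[].
move=> x; apply/ler_addgt0Pr => e e0.
have x0 : 0 < rnorm x + 1 by have := rnorm_ge0 x; lra.
have d0 : 0 < e / (rnorm x + 1) by rewrite divr_gt0.
have [_ _ /(_ x) hx] := h _ d0; apply: le_trans hx _; rewrite mulrDl lerD2l.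
by rewrite mulrAC ler_pdivrMr //; have := rnorm_ge0 x; nra.
Qed.
Fact unle_eq0 u : unle u 0 -> u = 0.
Proof.
case: u => a l [_ /= /absC_eq0 -> h].
congr (_, _); apply: rnorm_eq0.
have := h (star a); rewrite /uact /= scale0r addr0 rnorm_mul_star mul0r.
by have := rnorm_ge0 a; nra.
Qed.
Fact unleD u v c d : unle u c -> unle v d -> unle (u + v) (c + d).
Proof.
move=> [c0 lc ac] [d0 ld ad]; split; first exact: addr_ge0.
- by apply: le_trans (absCD _ _) _; rewrite lerD.
- move=> x; rewrite uactD mulrDl; apply: le_trans (rnormD _ _) _; exact: lerD.
Qed.
Fact unleM u v c d : unle u c -> unle v d -> unle (u * v) (c * d).
Proof.
move=> [c0 lc ac] [d0 ld ad]; split; first exact: mulr_ge0.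
- by rewrite absCM ler_pM ?absC_ge0.
- move=> x; rewrite uactM -mulrA; apply: le_trans (ac _) _; exact: ler_wpM2l.
Qed.
Fact unle_adj u c : unle u c -> unle (uadj u) c.
Proof.
move=> [c0 lc ac]; split; rewrite ?absC_conj // => x.
pose y := uact (uadj u) x.
have h1 : rnorm (uact u y) <= c * rnorm y by exact: ac.
have h2 : rnorm y ^+ 2 <= rnorm x * rnorm (uact u y).
  by have := uact_star_le (uadj u) x; rewrite uadjK.
have a0 := rnorm_ge0 x; have n0 := rnorm_ge0 y; rewrite -/y.
have h3 : rnorm x * rnorm (uact u y) <= rnorm x * (c * rnorm y) by exact: ler_wpM2l.
have : 0 <= c * rnorm x by exact: mulr_ge0.
move: (rnorm x) (rnorm y) (rnorm _) a0 n0 h1 h2 h3 => p n b; nra.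
Qed.
Fact unle_cstar u c : 0 <= c -> unle (uadj u * u) (c ^+ 2) -> unle u c.
Proof.
move=> c0 [_ lc ac]; split=> //.
- by move: lc; rewrite absCM absC_conj -expr2 ler_pXn2r ?nnegrE ?absC_ge0.
- move=> x; have h1 := uact_star_le u x; rewrite -uactM in h1.
  have h2 := ac x; have a0 := rnorm_ge0 x; have b0 := rnorm_ge0 (uact u x).
  have h3 : rnorm (uact u x) ^+ 2 <= (c * rnorm x) ^+ 2.
    apply: le_trans h1 _; rewrite exprMn [(rnorm x ^+ 2)%R]expr2 mulrCA.
    exact: ler_wpM2l.
  by rewrite ler_pXn2r ?nnegrE ?mulr_ge0 in h3.
Qed.
Fact unle_sc c : unle (usc c) `|c|.
Proof.
split=> [||x]; rewrite ?absC_real //.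
by rewrite /uact smul0l add0r rnormZC absC_real.
Qed.

HB.instance Definition _ := PzRing_isNormedStar.Build R unitization
  usc_zmod usc_monoid uscC uadjK uadjD uadjM uadj_sc
  unle_ge0 unle_ex unle_mono unle_lim unle_eq0 unleD unleM unle_adj unle_cstar unle_sc.

Definition uinj (x : A) : unitization := (x, 0).

Lemma nm_uinj x : nm (uinj x) = rnorm x.
Proof.
apply/le_anti/andP; split.
  apply/nm_le; split=> [||y]; rewrite ?rnorm_ge0 //.
    by rewrite /= -(rmorph0 (@real_complex R)) absC_real normr0 rnorm_ge0.
  by rewrite /uact /= scale0r addr0 rnormM.
have [_ _ /(_ (star x))] := nmP (uinj x).
rewrite /uact /= scale0r addr0 rnorm_mul_star rnorm_star expr2.
have [->|x0] := eqVneq (rnorm x) 0; first by rewrite nm_ge0.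
by rewrite ler_pM2r // lt0r x0 rnorm_ge0.
Qed.

Lemma absC_snd_le u : absC u.2 <= nm u.
Proof. by have [] := nmP u. Qed.

Lemma nm_scalar (l : R[i]) : nm ((0, l) : unitization) <= absC l.
Proof.
apply/nm_le; split=> [||x]; rewrite ?absC_ge0 //.
by rewrite /uact smul0l add0r rnormZC.
Qed.

Lemma rnorm_fst_le u : rnorm u.1 <= 2 * nm u.
Proof.
rewrite -nm_uinj; have -> : uinj u.1 = u - (0, u.2).
  by case: u => a l; congr (_, _); rewrite /= ?subr0 ?subrr.
have := nmB u (0, u.2); have := nm_scalar u.2; have := absC_snd_le u; lra.
Qed.

Lemma nm_pair_le u : nm u <= rnorm u.1 + absC u.2.
Proof.
have {1}-> : u = uinj u.1 + (0, u.2).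
  by case: u => a l; congr (_, _); rewrite /= ?addr0 ?add0r.
by rewrite -nm_uinj; apply: nmD_le => //; exact: nm_scalar.
Qed.

Lemma unitization_complete : ncomplete unitization.
Proof.
move=> f hf.
have [|a ha] := @cstar_complete _ _ (fun n => (f n).1).
  move=> e e0; have [|N hN] := hf (e / 2); first lra.
  exists N => m /hN h; have := rnorm_fst_le (f m - f N).
  have -> : (f m - f N).1 = (f m).1 - (f N).1 by [].
  lra.
have [|l hl] := @complex_complete _ (fun n => (f n).2).
  move=> e /hf[N hN]; exists N => m /hN; apply: le_trans.
  exact: (absC_snd_le (f m - f N)).
exists (a, l) => e e0.
have [|N hN] := ha (e / 2); first lra; have [|M hM] := hl (e / 2); first lra.
exists (maxn N M) => m; rewrite geq_max => /andP[/hN h1 /hM h2].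
by apply: le_trans (nm_pair_le _) _ => /=; lra.
Qed.

(** [sc] has real scalars only; this is the central imaginary unit that the positivity argument
    requires. *)
Let J : unitization := (0, 'i).
Let JJ : J * J = -1.
Proof.
congr (_, _) => /=; first by rewrite smul0l !scaler0 !addr0 oppr0.
by rewrite -expr2 sqrCi.
Qed.
Let adjJ : adj J = - J.
Proof. by congr (_, _); rewrite /= ?star0 ?oppr0 // conjCi. Qed.
Let JC (u : unitization) : J * u = u * J.
Proof.
congr (_, _) => /=; last exact: mulrC.
by rewrite smul0l smul0r !scaler0 addr0 !add0r.
Qed.

HB.instance Definition _ := NormedStar_isPositive.Build R unitization
  (complete_nle_psum unitization_complete JJ adjJ JC)
  (complete_psum_inv unitization_complete JJ adjJ JC).

Lemma uinjD x y : uinj (x + y) = uinj x + uinj y.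
Proof. by congr (_, _); rewrite /= ?addr0. Qed.
Lemma uinjB x y : uinj (x - y) = uinj x - uinj y.
Proof. by congr (_, _); rewrite /= ?subr0. Qed.
Lemma uinjM x y : uinj (x ** y) = uinj x * uinj y.
Proof. by congr (_, _); rewrite /= ?mulr0 // !scale0r !addr0. Qed.
Lemma uinj_star x : uinj (star x) = adj (uinj x).
Proof. by congr (_, _); rewrite /= ?conjC0. Qed.
Lemma uinj_pow x n : uinj (spow x n.+1) = uinj x ^+ n.+1.
Proof.
elim: n => [|n IH]; first by rewrite expr1.
by rewrite exprS -IH -uinjM.
Qed.

Section Ideal.
Variable I : closedIdeal A.

Definition uideal_set u : Prop := u.2 = 0 /\ I u.1.

Fact uideal0 : uideal_set 0. Proof. by split=> //; exact: ideal0. Qed.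
Fact uidealD u v : uideal_set u -> uideal_set v -> uideal_set (u + v).
Proof.
by move=> [u2 Iu] [v2 Iv]; split; [rewrite /= u2 v2 addr0 | exact: idealD].
Qed.
Fact uidealMl u v : uideal_set v -> uideal_set (u * v).
Proof.
move=> [v2 Iv]; split; first by rewrite /= v2 mulr0.
rewrite /= v2 scale0r addr0; apply: idealD; [exact: ideal_mull | exact: idealZ].
Qed.
Fact uidealMr u v : uideal_set v -> uideal_set (v * u).
Proof.
move=> [v2 Iv]; split; first by rewrite /= v2 mul0r.
rewrite /= v2 scale0r addr0; apply: idealD; [exact: ideal_mulr | exact: idealZ].
Qed.
Fact uideal_adj u : uideal_set u -> uideal_set (adj u).
Proof. by move=> [u2 Iu]; split; [rewrite /= u2 conjC0 | exact: ideal_star]. Qed.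
Fact uideal_closed : nclosed uideal_set.
Proof.
move=> u h; split.
  apply/absC_eq0/ler_addgt0Pr => e /h[v [v2 _] uv]; rewrite add0r.
  by apply: le_trans uv; have := absC_snd_le (u - v); rewrite /= v2 subr0.
apply: (rnorm_closed (@ideal_closed _ _ I)) => e e0.
have [|v [_ Iv] uv] := h (e / 4); first lra.
by exists v.1 => //; have := rnorm_fst_le (u - v); rewrite /=; lra.
Qed.

Definition uideal : nideal unitization :=
  NIdeal uideal0 uidealD uidealMl uidealMr uideal_adj uideal_closed.

Lemma uideal_inj x : uideal (uinj x) <-> I x.
Proof. by split=> [[]|h] //; split. Qed.

End Ideal.
End Unitization.

(** * Closed star-subalgebras *)

Record starSubalgebra (R : realType) (B : cstarAlgType R) := StarSubalgebra {
  sub_set :> B -> Prop;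
  sub0 : sub_set 0;
  subD : forall x y, sub_set x -> sub_set y -> sub_set (x + y);
  subZ : forall (a : R[i]) x, sub_set x -> sub_set (a *: x);
  subM : forall x y, sub_set x -> sub_set y -> sub_set (x ** y);
  sub_star : forall x, sub_set x -> sub_set (star x);
  sub_closed : closed (sub_set : set B)
}.

Section Subalgebra.
Variables (R : realType) (B : cstarAlgType R) (S : starSubalgebra B).

Record subalg := Subalg { subval : B; subvalP : S subval }.
Implicit Types x y z : subalg.

Lemma subval_inj x y : subval x = subval y -> x = y.
Proof.
case: x y => [x Sx] [y Sy] /= xy; case: _ / xy Sy => Sy.
by congr Subalg; exact: Prop_irrelevance.
Qed.

HB.instance Definition _ := gen_eqMixin subalg.
HB.instance Definition _ := gen_choiceMixin subalg.

Fact subN (x : B) : S x -> S (- x). Proof. by rewrite -scaleN1r; exact: subZ. Qed.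

Definition sub_add x y := Subalg (subD (subvalP x) (subvalP y)).
Definition sub_zero := Subalg (sub0 S).
Definition sub_opp x := Subalg (subN (subvalP x)).
Definition sub_scale (a : R[i]) x := Subalg (subZ a (subvalP x)).
Definition sub_mul x y := Subalg (subM (subvalP x) (subvalP y)).
Definition sub_adj x := Subalg (sub_star (subvalP x)).

Fact sub_addA : associative sub_add.
Proof. by move=> x y z; apply: subval_inj; exact: addrA. Qed.
Fact sub_addC : commutative sub_add.
Proof. by move=> x y; apply: subval_inj; exact: addrC. Qed.
Fact sub_add0 : left_id sub_zero sub_add.
Proof. by move=> x; apply: subval_inj; exact: add0r. Qed.
Fact sub_addN : left_inverse sub_zero sub_opp sub_add.
Proof. by move=> x; apply: subval_inj; exact: addNr. Qed.
HB.instance Definition _ := GRing.isZmodule.Build subalg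
  sub_addA sub_addC sub_add0 sub_addN.

Fact sub_scaleA a b x : sub_scale a (sub_scale b x) = sub_scale (a * b) x.
Proof. by apply: subval_inj; exact: scalerA. Qed.
Fact sub_scale1 : left_id 1 sub_scale.
Proof. by move=> x; apply: subval_inj; exact: scale1r. Qed.
Fact sub_scaleDr : right_distributive sub_scale +%R.
Proof. by move=> a x y; apply: subval_inj; exact: scalerDr. Qed.
Fact sub_scaleDl x : {morph sub_scale^~ x : a b / a + b}.
Proof. by move=> a b; apply: subval_inj; exact: scalerDl. Qed.
HB.instance Definition _ := GRing.Zmodule_isLmodule.Build R[i] subalg
  sub_scaleA sub_scale1 sub_scaleDr sub_scaleDl.

Definition sub_norm x : R[i] := `|subval x|.
Fact sub_normD x y : sub_norm (x + y) <= sub_norm x + sub_norm y.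
Proof. exact: ler_normD. Qed.
Fact sub_normZ (a : R[i]) x : sub_norm (a *: x) = `|a| * sub_norm x.
Proof. exact: normrZ. Qed.
Fact sub_norm_eq0 x : sub_norm x = 0 -> x = 0.
Proof. by move=> h; apply: subval_inj; exact: normr0_eq0. Qed.
HB.instance Definition _ := Lmodule_isNormed.Build R[i] subalg
  sub_normD sub_normZ sub_norm_eq0.

Fact sub_ball x (e : R[i]) y : ball x e y = ball (subval x) e (subval y).
Proof. by rewrite -!ball_normE. Qed.

Fact subalg_complete (F : set_system subalg) : ProperFilter F -> cauchy F -> cvg F.
Proof.
move=> FF /(cauchyP F) cF.
pose G : set_system B := (subval @ F)%classic.
have GG : ProperFilter G by exact: fmap_proper_filter.
have /(cauchy_cvgP G) GC : cauchy G.
  apply: cauchy_exP => e e0; have [x Fx] := cF e e0.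
  exists (subval x); rewrite /G /fmap /=; apply: filterS Fx => y /=.
  by rewrite sub_ball.
have G_ball e : 0 < e -> F [set y | ball (lim G) e (subval y)]%classic.
  by move=> e0; have := GC _ (nbhsx_ballx _ _ e0).
have Sl : S (lim G).
  apply: (rnorm_closed (@sub_closed _ _ S)) => e e0.
  have e0' : 0 < e%:C%C :> R[i] by rewrite ltcR.
  have [y /=] := @filter_ex _ _ FF _ (G_ball _ e0').
  rewrite -ball_normE /ball_ /= rnormE ltcR => hy.
  by exists (subval y) => //; exact: subvalP.
apply/cvg_ex; exists (Subalg Sl); apply/cvg_ballP => e e0.
by apply: filterS (G_ball e e0) => y /=; rewrite sub_ball.
Qed.
HB.instance Definition _ := Uniform_isComplete.Build subalg subalg_complete.

Fact sub_mulA : associative sub_mul.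
Proof. by move=> x y z; apply: subval_inj; exact: smulA. Qed.
Fact sub_mulDl : left_distributive sub_mul +%R.
Proof. by move=> x y z; apply: subval_inj; exact: smulDl. Qed.
Fact sub_mulDr : right_distributive sub_mul +%R.
Proof. by move=> x y z; apply: subval_inj; exact: smulDr. Qed.
Fact sub_mulZl (a : R[i]) x y : sub_mul (a *: x) y = a *: sub_mul x y.
Proof. by apply: subval_inj; exact: smulZl. Qed.
Fact sub_mulZr (a : R[i]) x y : sub_mul x (a *: y) = a *: sub_mul x y.
Proof. by apply: subval_inj; exact: smulZr. Qed.
Fact sub_adjK : involutive sub_adj.
Proof. by move=> x; apply: subval_inj; exact: starK. Qed.
Fact sub_adjD : {morph sub_adj : x y / x + y}.
Proof. by move=> x y; apply: subval_inj; exact: starD. Qed.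
Fact sub_adjZ (a : R[i]) x : sub_adj (a *: x) = a^* *: sub_adj x.
Proof. by apply: subval_inj; exact: starZ. Qed.
Fact sub_adjM x y : sub_adj (sub_mul x y) = sub_mul (sub_adj y) (sub_adj x).
Proof. by apply: subval_inj; exact: starM. Qed.
HB.instance Definition _ := Lmodule_isStarAlgebra.Build R[i] subalg
  sub_mulA sub_mulDl sub_mulDr sub_mulZl sub_mulZr
  sub_adjK sub_adjD sub_adjZ sub_adjM.

Fact sub_cstar_normM x y : `|x ** y| <= `|x| * `|y|.
Proof. exact: cstar_normM. Qed.
Fact sub_cstar_norm x : `|star x ** x| = `|x| ^+ 2.
Proof. exact: cstar_norm. Qed.
HB.instance Definition _ := StarAlgebra_isCStar.Build R subalg
  sub_cstar_normM sub_cstar_norm.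

End Subalgebra.

Lemma spow_morph (C : numClosedFieldType) (A B : starAlgType C) (f : A -> B) x n :
  {morph f : a b / a ** b} -> f (spow x n.+1) = spow (f x) n.+1.
Proof.
move=> fM; elim: n => // n IH.
by rewrite -[spow x n.+2]/(x ** spow x n.+1) fM IH.
Qed.

(* The inclusion of a closed *-subalgebra containing x0 has, by the universal
   property, a right inverse. *)
Lemma universal_generated (R : realType) (n : nat) (U : cstarAlgType R) (x0 : U)
  (S : starSubalgebra U) : is_universal n x0 -> S x0 -> forall u, S u.
Proof.
move=> [[xn x1] univ] Sx0.
pose s0 : subalg S := Subalg Sx0.
have s0n : spow s0 n = 0.
  apply: subval_inj; rewrite -[RHS]xn.
  by case: (n) => // m; rewrite (spow_morph (f := @subval _ _ S)).
have [|phi [[phiM phi0] _]] := univ (subalg S) s0; first by split.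
have [psi [_ psiU]] := univ U x0 (conj xn x1).
have idM : star_morphism (fun u : U => u) by split.
have e1 := psiU _ (conj idM erefl).
have cM : star_morphism (fun u => subval (phi u)).
  have [h1 h2 h3] := phiM; split=> [a x y|x y|x].
  - by rewrite h1.
  - by rewrite h2.
  - by rewrite h3.
have e2 : psi = fun u => subval (phi u) by apply: psiU; split=> //; rewrite phi0.
move=> u; have e : u = subval (phi u) by rewrite -[LHS]/((fun v : U => v) u) -e1 e2.
by rewrite e; exact: subvalP.
Qed.

Section StarMorphism.
Variables (C : numClosedFieldType) (A B : starAlgType C) (f : A -> B).
Hypothesis fM : star_morphism f.

Lemma smorphD x y : f (x + y) = f x + f y.
Proof. by have [h _ _] := fM; rewrite -[x]scale1r h !scale1r. Qed.
Lemma smorph0 : f 0 = 0.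
Proof. by apply: (@addrI _ (f 0)); rewrite -smorphD !addr0. Qed.
Lemma smorphZ a x : f (a *: x) = a *: f x.
Proof. by have [h _ _] := fM; rewrite -[a *: x]addr0 h smorph0 addr0. Qed.
Lemma smorphB x y : f (x - y) = f x - f y.
Proof. by rewrite -scaleN1r smorphD smorphZ scaleN1r. Qed.
Lemma smorphM x y : f (x ** y) = f x ** f y. Proof. by have [_ h _] := fM. Qed.
Lemma smorph_star x : f (star x) = star (f x). Proof. by have [_ _ h] := fM. Qed.

End StarMorphism.

(** * Lifts with control of the norm *)

Section Contractive.
Variables (R : realType) (A B : cstarAlgType R) (I : closedIdeal A) (f : B -> cquot I).
Hypothesis fM : star_morphism f.
Local Notation pi := (cquot_pi I).

Lemma cquot_pi_morphism : star_morphism pi.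
Proof.
split=> [a x y|x y|x].
- by rewrite cquot_piD cquot_piZE.
- exact: cquot_piM.
- exact: cquot_pi_star.
Qed.

(* h = (2i)^-1 (v^* - v) with 1 - v unitary. *)
Lemma sa_unitary (h : B) : star h = h -> rnorm h < 1 -> exists v : B,
  [/\ star v ** v = v + star v, v ** star v = v + star v &
      h = (2 * 'i)^-1 *: (star v - v)].
Proof.
move=> sh h1.
have [|w [ww wP]] := @sqrt_1B R (unitization B) (@unitization_complete R B) (uinj (h ** h)).
  rewrite nm_uinj; apply: le_lt_trans (rnormM _ _) _.
  by have := rnorm_ge0 h; nra.
have sS : adj (uinj (h ** h)) = uinj (h ** h) by rewrite -uinj_star starM sh.
(* The iteration never leaves the ideal [B] of its unitization. Hence the square root gives an
   element of [B], to which [f] can be applied. *)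
have w2 : w.2 = 0.
  apply: (wP (fun u : unitization B => u.2 = 0)) => // [u hu|u u2].
    apply/absC_eq0/ler_addgt0Pl => e /hu[v v2 uv]; rewrite addr0.
    by apply: le_trans uv; have := absC_snd_le (u - v); rewrite /= v2 subr0.
  by rewrite /= u2 !mulr0 add0r mulr0.
have sw : adj w = w.
  apply: (wP _ (@nclosed_sa _ _)); first exact: adj0.
  by move=> u su; rewrite adjM adjD adjM sS su adj_sc -scC.
have cw : GRing.comm (uinj h) w.
  apply: (wP _ (@nclosed_comm _ _ (uinj h))); first exact: commr0.
  move=> u hu; apply: commrM; first by rewrite /GRing.comm scC.
  apply: commrD; last exact: commrM.
  by rewrite /GRing.comm -!uinjM smulA.
have wE : w = uinj w.1 by case: (w) w2 => a l /= ->.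
move: ww sw cw; rewrite wE; move: (w.1) => b; rewrite -uinj_star /GRing.comm -!uinjM -!uinjD.
move=> [bb] [sb] [hb] {w wP w2 wE sS}.
pose v := b - 'i *: h.
have i2 : 'i * 'i = -1 :> R[i] by rewrite -expr2 sqrCi.
have sv : star v = b + 'i *: h by rewrite starB starZ sh sb conjCi scaleNr opprK.
have vv : v + star v = b + b by rewrite sv addrACA addNr addr0.
exists v; split.
- rewrite vv bb sv /v smulDl !smulBr !smulZl !smulZr scalerA i2 scaleN1r opprK hb.
  by rewrite addrA subrK addrC.
- rewrite vv bb sv /v smulBl !smulDr !smulZl !smulZr scalerA i2 scaleN1r hb.
  by rewrite opprD opprK addrA addrK addrC.
- have -> : star v - v = (2 * 'i) *: h.
    by rewrite sv /v opprB addrC subrKA -scalerDl -mulr2n mulr_natl.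
  rewrite scalerA mulVf ?scale1r // mulf_neq0 ?pnatr_eq0 //.
  by apply/eqP => i0; move: i2; rewrite i0 mulr0 => /eqP; rewrite eq_sym oppr_eq0 oner_eq0.
Qed.

Lemma nm_cut (x e : unitization A) (c : R) : 0 <= c -> adj e = e ->
  nm ((1 - e) * (adj x * x) * (1 - e)) <= c ^+ 2 -> nm (x * (1 - e)) <= c.
Proof.
move=> c0 se h; apply: nm_cstar_le => //.
by rewrite adjM adjB adj1 se !mulrA in h *.
Qed.

(** Nothing is presupposed about continuity of [f]. The relations that make 1 - v unitary are
    algebraic, so they survive in the quotient; multiplying 1 - V and its adjoint by 1 - e makes
    their defects in I small, and [h] is half the difference of the two up to the factor i. *)
Lemma lift_sa (h : B) (d : R) : star h = h -> rnorm h < 1 -> 0 < d ->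
  exists y : A, pi y = f h /\ rnorm y <= 1 + d.
Proof.
move=> sh h1 d0; have [v [v1 v2 hv]] := sa_unitary sh h1.
pose V : A := repr (f v); have piV : pi V = f v by exact: cquot_pi_repr.
have pM := cquot_pi_morphism.
have I1 : I (star V ** V - (V + star V)).
  apply/cquot_piP; rewrite (smorphM pM) (smorphD pM) (smorph_star pM) piV.
  by rewrite -(smorph_star fM) -(smorphM fM) -(smorphD fM) v1.
have I2 : I (V ** star V - (V + star V)).
  apply/cquot_piP; rewrite (smorphM pM) (smorphD pM) (smorph_star pM) piV.
  by rewrite -(smorph_star fM) -(smorphM fM) -(smorphD fM) v2.
set i1 := _ - _ in I1; set i2 := _ - _ in I2.
pose y0 := (2 * 'i)^-1 *: (star V - V).
have piy0 : pi y0 = f h.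
  rewrite hv (smorphZ pM) (smorphZ fM) (smorphB pM) (smorphB fM).
  by rewrite (smorph_star pM) (smorph_star fM) piV.
have [|e [[e2 Ie] se e1 ei]] :=
    @approx_unit _ _ (uideal I) [:: uinj i1; uinj i2] d d0.
  by move=> i; rewrite !inE => /orP[] /eqP ->; apply/uideal_inj.
have eE : e = uinj e.1 by case: (e) e2 => a l /= ->.
exists (y0 - y0 ** e.1); split.
  by rewrite -piy0; apply/cquot_piP; rewrite addrAC subrr add0r; apply/idealN/ideal_mull.
pose u : unitization A := 1 - uinj V.
have au : adj u = 1 - uinj (star V) by rewrite adjB adj1 uinj_star.
have u1 : adj u * u = 1 + uinj i1.
  by rewrite au /u /i1 uinjB uinjD uinjM; ncring.
have u2 : adj (adj u) * adj u = 1 + uinj i2.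
  by rewrite adjK au /u /i2 uinjB uinjD uinjM; ncring.
have bound x i : adj x * x = 1 + i -> nm ((1 - e) * i) <= d -> nm (x * (1 - e)) <= 1 + d.
  move=> xx hi; apply: nm_cut => //; first lra.
  have -> : (1 - e) * (adj x * x) * (1 - e) = (1 - e) * (1 - e) + (1 - e) * i * (1 - e).
    by rewrite xx; ncring.
  by apply: le_trans (nmD_le (nmM_le e1 e1) (nmM_le hi e1)) _; nra.
have b1 : nm (u * (1 - e)) <= 1 + d by apply: bound u1 (ei _ _); rewrite mem_head.
have b2 : nm (adj u * (1 - e)) <= 1 + d.
  by apply: bound u2 (ei _ _); rewrite !inE eqxx orbT.
rewrite -nm_uinj; pose s : unitization A := (0, (2 * 'i)^-1).
have -> : uinj (y0 - y0 ** e.1) = s * (u * (1 - e) - adj u * (1 - e)).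
  rewrite -mulrBl uinjB uinjM -eE.
  have -> : u - adj u = uinj (star V) - uinj V by rewrite au /u; ncring.
  have -> : uinj y0 = s * (uinj (star V) - uinj V).
    by rewrite -uinjB /y0; congr (_, _); rewrite /= ?mulr0 // smul0l scale0r add0r addr0.
  by ncring.
have hc : nm s <= 2^-1.
  apply: le_trans (nm_scalar _ _) _.
  have a2 : absC (2 * 'i : R[i]) = 2.
    by rewrite absCM absC_i mulr1 -(rmorph_nat (real_complex R)) absC_real ger0_norm.
  have a1 : absC (1 : R[i]) = 1 by rewrite -(rmorph1 (real_complex R)) absC_real normr1.
  have i0 : 2 * 'i != 0 :> R[i].
    by apply/eqP => h0; move: a2; rewrite h0 -(rmorph0 (real_complex R)) absC_real normr0; lra.
  have : absC (2 * 'i)^-1 * absC (2 * 'i : R[i]) = 1 by rewrite -absCM mulVf.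
  by rewrite a2; lra.
by apply: le_trans (nmM_le hc (nmB_le b1 b2)) _; lra.
Qed.

End Contractive.

Section ContractiveLift.
Variables (R : realType) (A B : cstarAlgType R) (I : closedIdeal A) (f : B -> cquot I).
Hypothesis fM : star_morphism f.
Local Notation pi := (cquot_pi I).

(** Reduction to b^* b, which is self-adjoint. Its lift [z] of norm at most 1 + d/2 differs from X^*
    X by an element of I, and X (1 - e) cuts that difference down to d/2. *)
Lemma lift_lt1 (b : B) (d : R) : rnorm b < 1 -> 0 < d ->
  exists y : A, pi y = f b /\ rnorm y <= 1 + d.
Proof.
move=> b1 d0; have pM := cquot_pi_morphism I.
have d2 : 0 < d / 2 by lra.
have [||z [piz zd]] := @lift_sa _ _ _ _ _ fM (star b ** b) (d / 2) _ _ d2.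
- by rewrite starM starK.
- by rewrite rnorm_star_mul; have := rnorm_ge0 b; nra.
pose X : A := repr (f b); have piX : pi X = f b by exact: cquot_pi_repr.
have Ii : I (star X ** X - z).
  apply/cquot_piP; rewrite piz (smorphM pM) (smorph_star pM) piX.
  by rewrite -(smorph_star fM) -(smorphM fM).
have [|e [[e2 Ie] se e1 ei]] :=
    @approx_unit _ _ (uideal I) [:: uinj (star X ** X - z)] (d / 2) d2.
  by move=> i; rewrite inE => /eqP ->; apply/uideal_inj.
have eE : e = uinj e.1 by case: (e) e2 => a l /= ->.
exists (X - X ** e.1); split.
  by rewrite -piX; apply/cquot_piP; rewrite addrAC subrr add0r; apply/idealN/ideal_mull.
rewrite -nm_uinj uinjB uinjM -eE.
have -> : uinj X - uinj X * e = uinj X * (1 - e) by ncring.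
apply: nm_cut => //; first lra.
have xx : adj (uinj X) * uinj X = uinj z + uinj (star X ** X - z).
  by rewrite -uinj_star -uinjM -uinjD addrC subrK.
have -> : (1 - e) * (adj (uinj X) * uinj X) * (1 - e) =
  (1 - e) * uinj z * (1 - e) + (1 - e) * uinj (star X ** X - z) * (1 - e).
  by rewrite xx; ncring.
have zd' : nm (uinj z) <= 1 + d / 2 by rewrite nm_uinj.
apply: le_trans (nmD_le (nmM_le (nmM_le e1 zd') e1) (nmM_le (ei _ (mem_head _ _)) e1)) _.
nra.
Qed.

Lemma lift_le (b : B) (d : R) : 0 < d ->
  exists y : A, pi y = f b /\ rnorm y <= rnorm b + d.
Proof.
move=> d0; pose t := rnorm b + d / 2.
have t0 : 0 < t by have := rnorm_ge0 b; rewrite /t; lra.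
have [||y [piy yd]] := @lift_lt1 ((t^-1)%:C%C *: b) (d / 2 / t).
- rewrite rnormZ ?invr_ge0 ?(ltW t0) // mulrC ltr_pdivrMr // mul1r /t; lra.
- by rewrite divr_gt0 //; lra.
exists (t%:C%C *: y); split.
  rewrite cquot_piZE piy -(smorphZ fM) scalerA -rmorphM /= divff ?gt_eqF //.
  by rewrite rmorph1 scale1r.
rewrite rnormZ ?(ltW t0) //; apply: le_trans (ler_wpM2l (ltW t0) yd) _.
rewrite mulrDr mulr1 mulrCA divff ?gt_eqF // mulr1 /t; lra.
Qed.

End ContractiveLift.

Lemma closed_rnorm (R : realType) (A : cstarAlgType R) (S : A -> Prop) :
  (forall x, (forall e : R, 0 < e -> exists2 y, S y & rnorm (x - y) < e) -> S x) ->
  closed (S : set A).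
Proof.
move=> h x Sx; apply: h => e e0.
have e0' : 0 < e%:C%C :> R[i] by rewrite ltcR.
have [y [Sy]] := Sx _ (nbhsx_ballx x _ e0').
by rewrite -ball_normE /ball_ /= rnormE ltcR; exists y.
Qed.

(** * Automatic continuity and the equalizer *)

Section ZeroIdeal.
Variables (R : realType) (A : cstarAlgType R).

Definition zero_ideal : closedIdeal A.
Proof.
apply: (@ClosedIdeal R A (fun x => x = 0)) => //.
- by move=> x y -> ->; rewrite addr0.
- by move=> a x ->; rewrite scaler0.
- by move=> a x ->; rewrite smul0r.
- by move=> x a ->; rewrite smul0l.
- apply: closed_rnorm => x h; apply: rnorm_small => e /h[y ->].
  by rewrite subr0 => /ltW.
Defined.

(** Over the zero ideal the only lift of g b is g b itself, so [lift_le] is a norm bound. *)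
Lemma star_morphism_contractive (B : cstarAlgType R) (g : B -> A) b :
  star_morphism g -> rnorm (g b) <= rnorm b.
Proof.
move=> gM; apply/ler_addgt0Pr => e e0.
have pM := cquot_pi_morphism zero_ideal.
have hM : star_morphism (fun x => cquot_pi zero_ideal (g x)).
  split=> [a x y|x y|x].
  - by rewrite (smorphD gM) (smorphZ gM) (smorphD pM) (smorphZ pM).
  - by rewrite (smorphM gM) (smorphM pM).
  - by rewrite (smorph_star gM) (smorph_star pM).
have [y [/cquot_piP /= /eqP]] := lift_le hM b e0.
by rewrite subr_eq0 => /eqP ->.
Qed.

End ZeroIdeal.

Section Equalizer.
Variables (R : realType) (A B : cstarAlgType R) (I : closedIdeal A).
Variables (f : B -> cquot I) (g : B -> A).
Hypotheses (fM : star_morphism f) (gM : star_morphism g).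

Let pM := cquot_pi_morphism I.

Definition equalizer : starSubalgebra B.
Proof.
apply: (@StarSubalgebra R B (fun b => f b = cquot_pi I (g b))).
- by rewrite (smorph0 fM) (smorph0 gM) (smorph0 pM).
- by move=> x y hx hy; rewrite (smorphD fM) (smorphD gM) (smorphD pM) hx hy.
- by move=> a x hx; rewrite (smorphZ fM) (smorphZ gM) (smorphZ pM) hx.
- by move=> x y hx hy; rewrite (smorphM fM) (smorphM gM) (smorphM pM) hx hy.
- by move=> x hx; rewrite (smorph_star fM) (smorph_star gM) (smorph_star pM) hx.
(* The distance in the quotient is measured by lifts: for y near x, [lift_le] gives a small lift of
   f (x - y), and g (x - y) is small by contractivity. Subtracting their difference moves repr (f x)
   - g x into I. *)
apply: closed_rnorm => x h.
have fx : cquot_pi I (repr (f x)) = f x by exact: cquot_pi_repr.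
rewrite -fx; apply/cquot_piP; apply: (rnorm_closed (@ideal_closed _ _ I)) => e e0.
have [|y fy xy] := h (e / 4); first lra.
have e4 : 0 < e / 4 by lra.
have [a [pia ae]] := lift_le fM (x - y) e4.
have gxy := star_morphism_contractive (x - y) gM.
exists (repr (f x) - g x - (a - g (x - y))).
  apply/cquot_piP; rewrite !(smorphB pM) pia (smorphB fM) (smorphB gM) fx.
  by rewrite (smorphB pM) fy opprB addrA subrK.
have -> (z w : A) : z - (z - w) = w by rewrite opprB addrC subrK.
by apply: le_lt_trans (rnormB _ _) _; lra.
Defined.

End Equalizer.

Theorem theorem5 (R : realType) (n : nat) (hn : (0 < n)%N)
    (U : cstarAlgType R) (x0 : U) :
  is_universal n x0 -> projective U.
Proof.
move=> univ A I f fM; have pM := cquot_pi_morphism I.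
case: n hn univ => // q _ univ; have [[x0n x01] uU] := univ.
pose X0 : A := repr (f x0); have piX0 : cquot_pi I X0 = f x0 by exact: cquot_pi_repr.
have IX0 : I (spow X0 q.+1).
  rewrite -[spow _ _]subr0; apply/cquot_piP; rewrite (smorph0 pM).
  have [_ pMM _] := pM; have [_ fMM _] := fM.
  by rewrite (spow_morph _ _ pMM) piX0 -(spow_morph _ _ fMM) x0n (smorph0 fM).
have [X [XX0 [Xn X1]]] : exists X : A, I (X - X0) /\ nilpotent_contraction q.+1 X.
  (* For n = 1 the element f(x0) is 0 and lifts to 0; the truncation needs at least one layer. *)
  case: q x0n {univ uU} IX0 => [_ IX0|q x0n IX0].
    exists 0; split; first by rewrite sub0r; exact: idealN.
    by split=> //; rewrite normr0 ler01.
  have IX0' : uideal I (uinj X0 ^+ q.+2) by rewrite -uinj_pow; apply/uideal_inj.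
  have [|//|d d0|X [[X2 IX] X1 Xn]] := @nilpotent_contraction_lift _ _
    (uideal I) q.+1 (uinj X0) _ _ IX0'.
  - exact: unitization_complete.
  - have [y [piy yd]] := lift_le fM x0 d0.
    exists (uinj y); rewrite -uinjB nm_uinj; split.
      by apply/uideal_inj/cquot_piP; rewrite piy.
    apply: le_trans yd _; rewrite lerD2r; move: x01.
    by rewrite rnormE -(rmorph1 (real_complex R)) lecR.
  have XE : X = uinj X.1.
    by move: X2; case: (X) => a l /=; rewrite subr0 => ->.
  exists X.1; split; first exact: IX.
  split; first by have := uinj_pow X.1 q.+1; rewrite -XE Xn => -[].
  by rewrite rnormE -(rmorph1 (real_complex R)) lecR -nm_uinj -XE.
have [g [[gM g0] _]] := uU A X (conj Xn X1).
have E0 : f x0 = cquot_pi I (g x0).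
  by rewrite g0 -piX0; apply/cquot_piP; rewrite -opprB; exact: idealN.
by exists g => // b; exact: (universal_generated (S := equalizer fM gM) univ E0 b).
Qed.
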